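(* Let $M$ be a finitely generated module over a generalized Golod ring $R$ with residue field $k$. Then $\operatorname{curv}_R M\in\{0,\,1,\,\operatorname{curv}_R k\}$.
   Context: All rings are commutative Noetherian local rings with $1\neq 0$, and all modules are finitely generated. Let $R$ be a local ring with maximal ideal $\mathfrak m$ and residue field $k=R/\mathfrak m$. Curvature: for a finitely generated $R$-module $M$ put $\beta^R_n(M)=\dim_k\operatorname{Tor}^R_n(k,M)$ and $\operatorname{curv}_R M=\limsup_{n\to\infty}(\beta^R_n(M))^{1/n}$. Acyclic closure: the acyclic closure $R\langle X\rangle$ of $k$ over $R$ is the DG $R$-algebra resolution of $k$ obtained from $R$ by Tate's process of killing cycles in a minimal way: one adjoins exterior variables in odd degrees and divided power variables in even degrees, the degree $1$ variables being mapped by the differential onto a minimal generating set of $\mathfrak m$, and, for $n\ge 1$, the degree $n+1$ variables being mapped to cycles whose classes form a minimal generating set of $H_n(R\langle X_{\le n}\rangle)$. Here $R\langle X_{\le n}\rangle$ is the DG subalgebra generated by the variables of degree at most $n$. Trivial Massey operation: let $U$ be such a DG algebra with augmentation $U\to k$, and set $\overline a=(-1)^{d+1}a$ for $a\in U_d$ (extended additively). $U$ admits a trivial Massey operation if to each finite sequence $v_1,\dots,v_n$ ($n\ge 1$) of elements of $\widetilde H(U)=\ker(H(U)\to k)$ one can assign an element $\gamma(v_1,\dots,v_n)\in\ker(U\to k)$ such that (i) $\gamma(v)$ is a cycle representing the homology class $v$ for each $v\in\widetilde H(U)$, and (ii) $d\gamma(v_1,\dots,v_n)=\sum_{j=1}^{n-1}\overline{\gamma(v_1,\dots,v_j)}\,\gamma(v_{j+1},\dots,v_n)$.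 Generalized Golod ring: $R$ is generalized Golod (of level $\le q$, where $q\geq 1$) if $R\langle X_{\le q}\rangle$ admits a trivial Massey operation; $R$ is generalized Golod if this holds for some $q$. *)

(* Defs.v *)
From HB Require Import structures.
From mathcomp Require Import all_boot all_order all_algebra.
From mathcomp Require Import finmap.
From mathcomp Require Import all_classical all_reals all_analysis.

Set Implicit Arguments.
Unset Strict Implicit.
Unset Printing Implicit Defensive.

Import Order.TTheory GRing.Theory Num.Theory.
Local Open Scope classical_set_scope.
Local Open Scope ring_scope.

(** * Local Noetherian rings and finitely generated modules *)

Definition is_submodule (A : comUnitRingType) (V : lmodType A) (N : set V) :=
  [/\ N 0, forall x y, N x -> N y -> N (x + y) & forall a x, N x -> N (a *: x)].

Definition finitely_generated (A : comUnitRingType) (V : lmodType A)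
    (N : set V) :=
  exists (n : nat) (g : 'I_n -> V),
    (forall i, N (g i)) /\
    (forall x, N x -> exists c : 'I_n -> A, x = \sum_i c i *: g i).

Definition noetherian (A : comUnitRingType) :=
  forall I : set A^o, is_submodule I -> finitely_generated I.

Definition maximal_ideal (A : comUnitRingType) : set A :=
  [set a | a \isn't a GRing.unit].

Definition local_ring (A : comUnitRingType) :=
  forall a b : A, maximal_ideal a -> maximal_ideal b -> maximal_ideal (a + b).

(* [k] is the residue field A/m, with [pi] the canonical projection. *)
Definition residue_field (A : comUnitRingType) (k : fieldType)
    (pi : {rmorphism A -> k}) :=
  (forall y : k, exists a, pi a = y) /\
  (forall a, pi a = 0 <-> maximal_ideal a).

Definition residue_module (A : comUnitRingType) (k : fieldType)
  (pi : {rmorphism A -> k}) : Type := k.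

Section ResidueModule.
Context (A : comUnitRingType) (k : fieldType) (pi : {rmorphism A -> k}).

HB.instance Definition _ := GRing.Zmodule.on (residue_module pi).

Definition residue_scale (a : A) (x : residue_module pi) : residue_module pi :=
  pi a * (x : k).

Fact residue_scaleA a b x :
  residue_scale a (residue_scale b x) = residue_scale (a * b) x.
Proof. by rewrite /residue_scale rmorphM mulrA. Qed.

Fact residue_scale1 : left_id 1 residue_scale.
Proof. by move=> x; rewrite /residue_scale rmorph1 mul1r. Qed.

Fact residue_scaleDr : right_distributive residue_scale +%R.
Proof. by move=> a x y; rewrite /residue_scale mulrDr. Qed.

Fact residue_scaleDl x : {morph residue_scale^~ x : a b / a + b}.
Proof. by move=> a b; rewrite /residue_scale rmorphD mulrDl. Qed.

HB.instance Definition _ := GRing.Zmodule_isLmodule.Build A (residue_module pi)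
  residue_scaleA residue_scale1 residue_scaleDr residue_scaleDl.

End ResidueModule.

(** * Betti numbers and curvature *)

(* A resolution ... -> A^(b 1) -> A^(b 0) -> M -> 0 by finite free modules;
   the differentials act on row vectors by right multiplication. *)
Record free_resolution (A : comUnitRingType) (M : lmodType A) := FreeResolution {
  fr_rank : nat -> nat;
  fr_diff : forall n, 'M[A]_(fr_rank n.+1, fr_rank n);
  fr_aug : {linear 'rV[A]_(fr_rank 0) -> M};
  fr_aug_surj : forall x : M, exists v, fr_aug v = x;
  fr_exact0 : forall v, fr_aug v = 0 <-> exists w, v = w *m fr_diff 0;
  fr_exact : forall n (v : 'rV_(fr_rank n.+1)),
    v *m fr_diff n = 0 <-> exists w, v = w *m fr_diff n.+1
}.

Section Curvature.
Context (A : comUnitRingType) (k : fieldType) (pi : {rmorphism A -> k}).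
Context (M : lmodType A) (F : free_resolution M).

Definition tor_diff n : 'M[k]_(fr_rank F n.+1, fr_rank F n) :=
  map_mx pi (fr_diff F n).

(* The dimension of Tor_n(k, M) = H_n(k (x) F): [Z :\: B]%MS is a complement
   in the cycles Z of the boundaries B. *)
Definition betti (n : nat) : nat :=
  match n with
  | 0 => \rank ((1%:M : 'M[k]_(fr_rank F 0)) :\: tor_diff 0)%MS
  | n'.+1 => \rank (kermx (tor_diff n') :\: tor_diff n'.+1)%MS
  end.

Definition curv (R : realType) : \bar R :=
  limn_esup (fun n => (((betti n)%:R : R) `^ (n%:R^-1))%:E).

End Curvature.

(** * DG algebras *)

(* Graded-commutative DG algebras in nonnegative degrees, augmented to k.
   [dg_comp n a] is the homogeneous component of degree n of a. *)
Record dg_algebra (A : comUnitRingType) (k : fieldType)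
    (pi : {rmorphism A -> k}) := DGAlgebra {
  dg_sort :> algType A;
  dg_comp : nat -> {linear dg_sort -> dg_sort};
  dg_d : {linear dg_sort -> dg_sort};
  dg_aug : {rmorphism dg_sort -> k};
  dg_hom := fun (n : nat) (a : dg_sort) => dg_comp n a = a;
  dg_compK : forall m n a,
    dg_comp m (dg_comp n a) = if m == n then dg_comp n a else 0;
  dg_comp_sum : forall a, exists N,
    (forall n, (N <= n)%N -> dg_comp n a = 0) /\ a = \sum_(n < N) dg_comp n a;
  dg_hom1 : dg_hom 0 1;
  dg_homM : forall m n a b, dg_hom m a -> dg_hom n b -> dg_hom (m + n) (a * b);
  dg_mulC : forall m n a b, dg_hom m a -> dg_hom n b ->
    a * b = (-1) ^+ (m * n) * (b * a);
  dg_sqr_odd : forall n a, odd n -> dg_hom n a -> a * a = 0;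
  dg_hom_d0 : forall a, dg_hom 0 a -> dg_d a = 0;
  dg_hom_d : forall n a, dg_hom n.+1 a -> dg_hom n (dg_d a);
  dg_dd : forall a, dg_d (dg_d a) = 0;
  dg_leibniz : forall n a b, dg_hom n a ->
    dg_d (a * b) = dg_d a * b + (-1) ^+ n * (a * dg_d b);
  dg_aug_scalar : forall r : A, dg_aug r%:A = pi r;
  dg_aug_pos : forall n a, dg_hom n.+1 a -> dg_aug a = 0;
  dg_aug_d : forall a, dg_aug (dg_d a) = 0
}.

Section Massey.
Context (A : comUnitRingType) (k : fieldType) (pi : {rmorphism A -> k}).
Context (U : dg_algebra pi).

(* The sum is finitely supported by [dg_comp_sum]. *)
Definition dg_bar (a : U) : U :=
  \sum_(n \in [set: nat]) (-1) ^+ n.+1 * dg_comp U n a.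

(* [S] is a DG subalgebra of U; a class in H(S) is represented as the coset
   z + d(S) of a cycle z, so that [v w] says that w represents v. *)
Definition reduced_homology (S : set U) : set (set U) :=
  [set v | exists z, [/\ S z, dg_d U z = 0, dg_aug U z = 0 &
                       v = [set z + dg_d U b | b in S]]].

Definition is_trivial_massey (S : set U) (gamma : seq (set U) -> U) :=
  (forall s : seq (set U), s <> [::] -> (forall v, v \in s -> reduced_homology S v) ->
     [/\ S (gamma s), dg_aug U (gamma s) = 0 &
         dg_d U (gamma s) = \sum_(1 <= j < size s)
           dg_bar (gamma (take j s)) * gamma (drop j s)]) /\
  (forall v, reduced_homology S v -> v (gamma [:: v])).

Definition has_trivial_massey (S : set U) :=
  exists gamma, is_trivial_massey S gamma.

End Massey.

(** * Acyclic closures *)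

(* The classes of the [z i] minimally generate the module Z/B. *)
Definition generates (A : comUnitRingType) (V : lmodType A) (Z B : set V)
    (n : nat) (P : pred 'I_n) (z : 'I_n -> V) :=
  forall a, Z a -> exists c : 'I_n -> A, B (a - \sum_(i | P i) c i *: z i).

Definition minimally_generates (A : comUnitRingType) (V : lmodType A)
    (Z B : set V) (n : nat) (z : 'I_n -> V) :=
  [/\ forall i, Z (z i), generates Z B predT z &
      forall i, ~ generates Z B (predC1 i) z].

Section TateVariables.
Context (A : comUnitRingType) (k : fieldType) (pi : {rmorphism A -> k}).
Context (U : dg_algebra pi) (e : nat -> nat).

(* There are [e n] variables in degree n. *)
Definition variable : choiceType := {n : nat & 'I_(e n)}.
Definition vdeg (x : variable) : nat := tag x.
Definition exponent : choiceType := {fsfun variable -> nat with 0%N}.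

(* [dp x j] is the divided power x^(j); for x of odd degree only j <= 1 is
   meaningful. *)
Context (dp : variable -> nat -> U).

Definition normal (m : exponent) :=
  forall x, odd (vdeg x) -> (m x <= 1)%N.

(* The factors are taken in an unspecified order: by graded commutativity this
   determines the monomial up to sign, which does not affect being a basis. *)
Definition monomial (m : exponent) : U := \prod_(x <- finsupp m) dp x (m x).

Definition lincomb (c : {fsfun exponent -> A with 0}) : U :=
  \sum_(m <- finsupp c) c m *: monomial m.

Definition normal_monomials_basis :=
  (forall a, exists c : {fsfun exponent -> A with 0},
     (forall m, c m <> 0 -> normal m) /\ a = lincomb c) /\
  (forall c : {fsfun exponent -> A with 0},
     (forall m, c m <> 0 -> normal m) -> lincomb c = 0 -> forall m, c m = 0).

Definition is_subalgebra (S : set U) :=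
  [/\ S 1, forall a b, S a -> S b -> S (a + b),
      forall (r : A) a, S a -> S (r *: a) &
      forall a b, S a -> S b -> S (a * b)].

(* R<X_{<= n}>, the subalgebra generated by the variables of degree at most n
   and their divided powers. *)
Definition generated_upto (n : nat) : set U :=
  [set a | forall S : set U, is_subalgebra S ->
     (forall x j, (vdeg x <= n)%N -> (odd (vdeg x) -> (j <= 1)%N) ->
        S (dp x j)) -> S a].

Definition cycles_upto (n i : nat) : set U :=
  [set a | [/\ generated_upto n a, dg_hom (d := U) i a & dg_d U a = 0]].

Definition boundaries_upto (n i : nat) : set U :=
  [set dg_d U b | b in [set b | generated_upto n b /\ dg_hom (d := U) i.+1 b]].

Definition variable_d (n : nat) (i : 'I_(e n)) : U :=
  dg_d U (dp (Tagged (fun n => 'I_(e n)) i) 1).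

End TateVariables.

Record acyclic_closure (A : comUnitRingType) (k : fieldType)
    (pi : {rmorphism A -> k}) := AcyclicClosure {
  ac_dg :> dg_algebra pi;
  ac_num : nat -> nat;
  ac_dp : variable ac_num -> nat -> ac_dg;
  ac_num0 : ac_num 0 = 0%N;
  ac_dp0 : forall x, ac_dp x 0 = 1;
  ac_dp_hom : forall x j, (odd (vdeg x) -> (j <= 1)%N) ->
    dg_hom (d := ac_dg) (j * vdeg x) (ac_dp x j);
  ac_dpM : forall x i j, ~~ odd (vdeg x) ->
    ac_dp x i * ac_dp x j = 'C(i + j, i)%:R * ac_dp x (i + j)%N;
  ac_dp_d : forall x j, ~~ odd (vdeg x) ->
    dg_d ac_dg (ac_dp x j.+1) = dg_d ac_dg (ac_dp x 1) * ac_dp x j;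
  ac_basis : normal_monomials_basis ac_dp;
  ac_kill1 : minimally_generates
    [set r%:A | r in @maximal_ideal A] [set (0 : ac_dg)]
    (@variable_d A k pi ac_dg ac_num ac_dp 1);
  ac_kill : forall n, (1 <= n)%N -> minimally_generates
    (cycles_upto ac_dp n n) (boundaries_upto ac_dp n n)
    (@variable_d A k pi ac_dg ac_num ac_dp n.+1)
}.

(* The acyclic closure is unique up to isomorphism, so the choice of [E] is
   immaterial. *)
Definition generalized_golod_level (A : comUnitRingType) (k : fieldType)
    (pi : {rmorphism A -> k}) (q : nat) :=
  exists E : acyclic_closure pi,
    has_trivial_massey (generated_upto (@ac_dp A k pi E) q).

Definition generalized_golod (A : comUnitRingType) (k : fieldType)
    (pi : {rmorphism A -> k}) :=
  exists2 q, (1 <= q)%N & generalized_golod_level pi q.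

(* Main.v *)
Require Import Defs.
From HB Require Import structures.
From mathcomp Require Import all_boot all_order all_algebra.
From mathcomp Require Import finmap.
From mathcomp Require Import all_classical all_reals all_analysis.
From mathcomp Require Import ring zify.

Set Implicit Arguments.
Unset Strict Implicit.
Unset Printing Implicit Defensive.

Import Order.TTheory GRing.Theory Num.Theory.
Local Open Scope classical_set_scope.
Local Open Scope ring_scope.

(* Let S be the subalgebra R<X_{<= q}> and C_n its component of degree n; S is
   free, and rank C_n grows polynomially in n. A trivial Massey operation makes
   the bar construction on minimal generators b of the positive-degree homology of
   S a resolution, whence a chain map g_b from a resolution G of k to S which hits
   the class of b in degree 0. The cone of these maps, over all b, is again a
   resolution of k. So H(S (x) M), Tor(k, M) and the shifted copies of Tor(k, M)
   indexed by the b fit into a long exact sequence, and with w_i the number of b of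
   degree i this gives, for every M,
     beta_n <= e_n + sum_i w_i beta_{n-1-i},
     sum_i w_i beta_{n-i} <= beta_{n+1} + e_n,
   where e_n = dim H_n(S (x) M) is at most a constant times rank C_n (devissage to
   M = k). Devissage also gives curv M <= curv k. Let curv M < r with r > 1. If
   sum_i w_i r^(-i-1) >= 1, the second inequality would make beta_n(M) grow at
   least like r^n unless it is subexponential, so curv M <= 1; and curv M < 1 means
   that beta_n(M) vanishes for large n. If sum_i w_i r^(-i-1) < 1 for all such r,
   the first inequality for k gives curv k <= r, so curv k <= curv M. *)

(** The bar construction has the words in the letters b as basis over S, and its differential cuts
    an initial piece off a word. Its component from the words ending in b to the empty word is, up
    to sign, a chain map to S; composed with a comparison map from G it gives g_b. Thus only the
    exactness of the bar construction matters, and it is built without grading or ranks. Exactness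
    rests on three facts: the values of the operation on letters minimally generate the reduced
    homology, products of reduced classes vanish, and the values on longer words make the
    differential square to zero. The cone is exact because the bottom of the copy of G at b kills
    the class of b, while minimality forces the coefficients of a bounding combination into m, and G
    turns those into boundaries. Dimensions are sizes of families independent modulo m, and a long
    exact sequence is used only as subadditivity at one spot, for which the next term must be killed
    by m. Hence the null-homotopies of multiplication by elements of m, on S and on G. The w_i obey
    no growth bound, so their power series is replaced by its partial sums at a radius r. *)

(** * Submodules and the maximal ideal of a local ring *)

Section LocalRing.
Context (A : comUnitRingType).

Lemma maximal_idealM (a b : A) : maximal_ideal b -> maximal_ideal (a * b).
Proof. by rewrite /maximal_ideal /= unitrM => /negbTE ->; rewrite andbF. Qed.

Lemma maximal_ideal0 : maximal_ideal (0 : A).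
Proof. by rewrite /maximal_ideal /= unitr0. Qed.

Lemma not_maximal_ideal (a : A) : ~ maximal_ideal a -> a \is a GRing.unit.
Proof. by rewrite /maximal_ideal /=; case: (a \is a GRing.unit). Qed.

End LocalRing.

Section Submodules.
Context (A : comUnitRingType) (W : lmodType A).

Section One.
Context (N : set W) (N_sub : is_submodule N).

Lemma submodule0 : N 0. Proof. by case: N_sub. Qed.
Lemma submoduleD x y : N x -> N y -> N (x + y). Proof. by case: N_sub => _ h _; exact: h. Qed.
Lemma submoduleZ a x : N x -> N (a *: x). Proof. by case: N_sub => _ _; exact. Qed.
Lemma submoduleN x : N x -> N (- x).
Proof. by rewrite -scaleN1r; exact: submoduleZ. Qed.
Lemma submoduleB x y : N x -> N y -> N (x - y).
Proof. by move=> hx /submoduleN; exact: submoduleD. Qed.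
Lemma submodule_sum I (r : seq I) (P : pred I) (F : I -> W) :
  (forall i, P i -> N (F i)) -> N (\sum_(i <- r | P i) F i).
Proof. by move=> h; apply: big_ind => //; [exact: submodule0|exact: submoduleD]. Qed.
Lemma submoduleDl x y : N y -> N (x + y) <-> N x.
Proof.
move=> hy; split=> [h|h]; last exact: submoduleD.
by rewrite -(addrK y x); exact: submoduleB.
Qed.
End One.

Lemma submodule_zero : is_submodule [set (0 : W)].
Proof.
by split=> //= [x y -> ->|a x ->]; rewrite ?addr0 ?scaler0.
Qed.

End Submodules.

(** * Dimensions of subquotients killed by the maximal ideal *)

Section Dimension.
Context (A : comUnitRingType).

(** Linear independence over the residue field in Z/B, tested with coefficients in A. No quotient
    module is formed, so that cycles and boundaries of different complexes are compared through
    representatives. *)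
Definition indep (W : lmodType A) (Z B : set W) (n : nat) :=
  exists z : 'I_n -> W, (forall i, Z (z i)) /\
    forall c : 'I_n -> A, B (\sum_i c i *: z i) -> forall i, maximal_ideal (c i).

Definition dim_le (W : lmodType A) (Z B : set W) (h : nat) :=
  forall n, indep Z B n -> (n <= h)%N.

Definition killed (W : lmodType A) (Z B : set W) :=
  forall a z, maximal_ideal a -> Z z -> B (a *: z).

Lemma indep_set (W : lmodType A) (Z B : set W) (T : finType) (s : {set T})
    (z : T -> W) :
  (forall i, i \in s -> Z (z i)) ->
  (forall c : T -> A, B (\sum_(i in s) c i *: z i) ->
     forall i, i \in s -> maximal_ideal (c i)) ->
  indep Z B #|s|.
Proof.
move=> Zz zs; exists (fun i : 'I_#|s| => z (enum_val i)); split.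
  by move=> i; apply: Zz; exact: enum_valP.
move=> c Bc i.
pose c' t := if insub t : {? x | x \in s} is Some u
  then c (enum_rank_in (valP u) (val u)) else 0.
have c'E j : c' (enum_val j) = c j.
  rewrite /c'; case: insubP => [u us uj|]; last by rewrite enum_valP.
  congr (c _); apply: enum_val_inj; rewrite enum_rankK_in //; exact: valP.
rewrite -c'E; apply: zs; last exact: enum_valP.
by rewrite big_enum_val; under eq_bigr do rewrite c'E.
Qed.

Lemma indep_fin (W : lmodType A) (Z B : set W) (T : finType) (z : T -> W) :
  (forall i, Z (z i)) ->
  (forall c : T -> A, B (\sum_i c i *: z i) -> forall i, maximal_ideal (c i)) ->
  indep Z B #|T|.
Proof.
move=> Zz zs; rewrite -cardsT; apply: (@indep_set _ _ _ _ _ z) => // c Bc i _.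
by apply: zs; move: Bc; congr B; apply: eq_bigl => j; rewrite inE.
Qed.

Lemma indep0 (W : lmodType A) (Z B : set W) : indep Z B 0.
Proof. by exists (fun=> 0); split=> [[]|c _ []]. Qed.

(** f is a relation and not a map because connecting homomorphisms are multivalued on
    representatives. *)
Lemma indep_map (W1 W2 : lmodType A) (Z1 B1 : set W1) (Z2 B2 : set W2)
    (f : W1 -> W2 -> Prop) n :
  (forall z, Z1 z -> exists2 z', Z2 z' & f z z') ->
  (forall m (z : 'I_m -> W1) (z' : 'I_m -> W2) c, (forall i, Z1 (z i)) ->
     (forall i, Z2 (z' i)) -> (forall i, f (z i) (z' i)) ->
     B2 (\sum_i c i *: z' i) -> B1 (\sum_i c i *: z i)) ->
  indep Z1 B1 n -> indep Z2 B2 n.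
Proof.
move=> ff fB [z [Zz zB]].
have /choice [z' z'P] : forall i, exists z', Z2 z' /\ f (z i) z'.
  by move=> i; have [z' ? ?] := ff _ (Zz i); exists z'.
exists z'; split=> [i|c Bc]; first by case: (z'P i).
by apply: zB; apply: fB Bc => // i; case: (z'P i).
Qed.

Lemma dim_le_sub (W1 W2 : lmodType A) (Z1 B1 : set W1) (Z2 B2 : set W2)
    (f : {linear W1 -> W2}) h :
  is_submodule Z1 ->
  (forall z, Z1 z -> Z2 (f z)) -> (forall z, Z1 z -> B2 (f z) -> B1 z) ->
  dim_le Z2 B2 h -> dim_le Z1 B1 h.
Proof.
move=> Z1s ff fB h2 n ind; apply: h2.
apply: (@indep_map _ _ _ _ _ _ (fun z z' => z' = f z)) ind.
  by move=> z Zz; exists (f z) => //; exact: ff.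
move=> m z z' c Zz Zz' zz' Bc; apply: fB.
  by apply: submodule_sum => // i _; exact: submoduleZ.
by rewrite linear_sum; under eq_bigr do rewrite linearZ /= -zz'.
Qed.

Lemma dim_le_trans (W : lmodType A) (Z B : set W) h h' :
  (h <= h')%N -> dim_le Z B h -> dim_le Z B h'.
Proof. by move=> hh d n /d hn; exact: leq_trans hh. Qed.

Lemma dim_le0 (W : lmodType A) (Z B : set W) h :
  is_submodule B -> (forall z, Z z -> B z) -> dim_le Z B h.
Proof.
move=> Bs ZB [|n] // [z [Zz zB]].
have hB : B (\sum_i (1 : A) *: z i).
  by apply: submodule_sum => // i _; rewrite scale1r; exact: ZB.
by have := zB _ hB ord0; rewrite /maximal_ideal /= unitr1.
Qed.

(** Among the subfamilies whose images in Z3/B3 are independent take a maximal one, s. Each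
    remaining z j, corrected by a combination of s, dies in Z3/B3 and so lifts to Z1; thus s has at
    most h3 elements and its complement at most h1. *)
Lemma dim_le_exact (A_local : local_ring A) (W1 W2 W3 : lmodType A)
    (Z1 B1 : set W1) (Z2 B2 : set W2) (Z3 B3 : set W3)
    (f : {linear W1 -> W2}) (g : {linear W2 -> W3}) h1 h3 :
  is_submodule Z2 -> is_submodule B2 -> is_submodule B3 ->
  killed Z3 B3 ->
  (forall b, B1 b -> B2 (f b)) ->
  (forall z, Z2 z -> Z3 (g z)) ->
  (forall z, Z2 z -> B3 (g z) -> exists2 u, Z1 u & B2 (z - f u)) ->
  dim_le Z1 B1 h1 -> dim_le Z3 B3 h3 -> dim_le Z2 B2 (h1 + h3).
Proof.
move=> Z2s B2s B3s k3 fB gZ ex d1 d3 n [z [Zz zB]].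
pose P (s : {set 'I_n}) := `[< forall c : 'I_n -> A,
  B3 (\sum_(i in s) c i *: g (z i)) -> forall i, i \in s -> maximal_ideal (c i) >].
have P0 : P finset.set0 by apply/asboolP => c _ i; rewrite inE.
have [s /maxsetP[/asboolP sP smax] _] := maxset_exists P0.
have s3 : (#|s| <= h3)%N.
  apply: d3; apply: (@indep_set _ _ _ _ _ (fun i => g (z i))) => // i _; exact: gZ.
(* By maximality, s with j added carries a relation with a coefficient outside the maximal ideal.
   Its coefficient at j is a unit: otherwise [k3] drops that term and leaves a forbidden relation on
   s. *)
have /choice [c cP] : forall j, exists c : 'I_n -> A,
    j \notin s -> B3 (g (z j + \sum_(i in s) c i *: z i)).
  move=> j; case: (boolP (j \in s)) => js; first by exists (fun=> 0).
  have : ~ P (j |: s)%SET.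
    by move=> /smax/(_ (finset.subsetUr _ _))/finset.setP/(_ j); rewrite finset.setU11 (negbTE js).
  move=> nP; have /existsNP[c /not_implyP[Bc /existsNP[i /not_implyP[i_js ci]]]] :
    ~ forall c : 'I_n -> A, B3 (\sum_(i in (j |: s)%SET) c i *: g (z i)) ->
      forall i, i \in (j |: s)%SET -> maximal_ideal (c i).
    by move=> h; apply: nP; apply/asboolP.
  move: Bc; rewrite finset.big_setU1 //= => Bc.
  have cj : c j \is a GRing.unit.
    apply: not_maximal_ideal => cj.
    have : B3 (\sum_(i in s) c i *: g (z i)).
      by move: Bc; rewrite addrC submoduleDl //; apply: k3 => //; exact: gZ.
    move=> /sP cs; apply: ci; move: i_js.
    by rewrite !inE => /orP[/eqP ->|/cs].
  exists (fun i => (c j)^-1 * c i) => _.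
  have := submoduleZ B3s (c j)^-1 Bc.
  rewrite scalerDr scalerA mulVr // scale1r scaler_sumr; congr B3.
  rewrite [RHS]linearD [X in _ = _ + X]linear_sum; congr (_ + _); apply: eq_bigr => i' _.
  by rewrite [RHS]linearZ /= scalerA.
pose y j := z j + \sum_(i in s) c j i *: z i.
have Zy j : Z2 (y j).
  by apply: submoduleD => //; apply: submodule_sum => // i _; exact: submoduleZ.
have /choice [u uP] : forall j, exists u, j \notin s -> Z1 u /\ B2 (y j - f u).
  move=> j; case: (boolP (j \in s)) => js; first by exists 0.
  by have [u ? ?] := ex _ (Zy j) (cP j js); exists u.
(* The lifts are independent: a relation among them becomes one among the z j in which the
   coefficient at an index i outside s is still [e i]. *)
have s1 : (#|~: s| <= h1)%N.
  apply: d1; apply: (@indep_set _ _ _ _ _ u) => [i|e Be i].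
    by rewrite inE => /uP[].
  rewrite inE => is_.
  have : B2 (\sum_(j in ~: s) e j *: y j).
    have -> : \sum_(j in ~: s) e j *: y j =
        \sum_(j in ~: s) e j *: (y j - f (u j)) + f (\sum_(j in ~: s) e j *: u j).
      rewrite linear_sum -big_split /=; apply: eq_bigr => j _.
      by rewrite linearZ -scalerDr subrK.
    apply: submoduleD => //; last exact: fB.
    apply: submodule_sum => // j; rewrite inE => js; apply: submoduleZ => //.
    by have [] := uP j js.
  have -> : \sum_(j in ~: s) e j *: y j =
    \sum_j (if j \in s then \sum_(l in ~: s) e l * c l j else e j) *: z j.
    transitivity (\sum_(j in ~: s) e j *: z j +
        \sum_(i in s) (\sum_(l in ~: s) e l * c l i) *: z i).
      under [X in _ = _ + X]eq_bigr do rewrite scaler_suml.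
      rewrite exchange_big -big_split /=; apply: eq_bigr => l _.
      rewrite scalerDr scaler_sumr; congr (_ + _).
      by apply: eq_bigr => j _; rewrite scalerA.
    rewrite [RHS](bigID [pred j in s]) /= addrC; congr (_ + _).
      by apply: eq_big => [j|j]; rewrite inE // => /negbTE ->.
    by apply: eq_bigr => j ->.
  by move=> /zB/(_ i); rewrite ifN.
by rewrite -[n]card_ord -(finset.cardsC s) addnC leq_add.
Qed.

(** Adjoining u to z must create a relation. If its coefficient at u were in the maximal ideal,
    [killed] would drop that term and all other coefficients would lie there too; so it is a unit
    and u can be solved for. *)
Lemma indep_generates (W : lmodType A) (Z B : set W) n (z : 'I_n -> W) :
  is_submodule Z -> is_submodule B -> killed Z B ->
  (forall i, Z (z i)) ->
  (forall c : 'I_n -> A, B (\sum_i c i *: z i) -> forall i, maximal_ideal (c i)) ->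
  ~ indep Z B n.+1 ->
  forall u, Z u -> exists c : 'I_n -> A, B (u - \sum_i c i *: z i).
Proof.
move=> Zs Bs kB Zz zB nind u Zu; apply: contrapT => nex; apply: nind.
exists (fun i => oapp z u (unlift ord0 i)); split.
  by move=> i; case: unliftP => [j|] /=.
move=> c; rewrite big_ord_recl unlift_none /=.
under eq_bigr do rewrite liftK /=.
move=> Bc; have c0 : maximal_ideal (c ord0).
  apply: contrapT => /not_maximal_ideal cu; apply: nex.
  exists (fun i => - ((c ord0)^-1 * c (lift ord0 i))).
  have := submoduleZ Bs (c ord0)^-1 Bc.
  rewrite scalerDr scalerA mulVr // scale1r scaler_sumr -sumrN.
  by congr (B (_ + _)); apply: eq_bigr => i _; rewrite scaleNr opprK scalerA.
move=> i; case: (unliftP ord0 i) => [j ->|-> //].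
apply: (zB (fun i => c (lift ord0 i))).
by move: Bc; rewrite addrC submoduleDl //; exact: kB.
Qed.

Lemma dim_le_basis (W : lmodType A) (Z B : set W) h :
  is_submodule Z -> is_submodule B -> killed Z B -> dim_le Z B h ->
  exists n (z : 'I_n -> W), [/\ (n <= h)%N, forall i, Z (z i),
    forall c : 'I_n -> A, B (\sum_i c i *: z i) -> forall i, maximal_ideal (c i) &
    forall u, Z u -> exists c : 'I_n -> A, B (u - \sum_i c i *: z i)].
Proof.
move=> Zs Bs kB dh.
have [n [/asboolP nind nmax]] : exists n, `[< indep Z B n >] /\
    (forall m, `[< indep Z B m >] -> (m <= n)%N).
  have ex : exists n, `[< indep Z B n >] by exists 0; apply/asboolP; exact: indep0.
  have ub m : `[< indep Z B m >] -> (m <= h)%N by move=> /asboolP/dh.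
  by have [n ? ?] := ex_maxnP ex ub; exists n.
have [z [Zz zB]] := nind; exists n, z; split=> //; first exact: dh.
apply: indep_generates => // /asboolP/nmax; by rewrite ltnn.
Qed.

End Dimension.

(** * Complexes of finite free modules *)

(* A complex of free modules with one basis indexed by [cidx]; [cbasis n] lists
   the basis elements of degree n and [cd s t] is the coefficient of t in the
   differential of s. *)
Record complex (A : comUnitRingType) := Complex {
  cidx :> choiceType;
  cdeg : cidx -> nat;
  cbasis : nat -> seq cidx;
  cd : cidx -> cidx -> A;
  cbasis_uniq : forall n, uniq (cbasis n);
  mem_cbasis : forall n s, (s \in cbasis n) = (cdeg s == n);
  cd_deg : forall s t, cdeg s != (cdeg t).+1 -> cd s t = 0;
  cdd : forall s u, \sum_(t <- cbasis (cdeg u).+1) cd s t * cd t u = 0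
}.

Lemma subrACA (V : zmodType) (a b c d : V) : a + b - (c + d) = (a - c) + (b - d).
Proof. by rewrite opprD addrACA. Qed.

Section PointwiseMap.
Context (A : comUnitRingType) (I : Type) (V1 V2 : lmodType A) (f : {linear V1 -> V2}).

Definition pointwise (x : I -> V1) : I -> V2 := fun t => f (x t).

Fact pointwise_linear : linear pointwise.
Proof. by move=> a x y; apply/funext => t; rewrite /pointwise linearP. Qed.

HB.instance Definition _ := GRing.isLinear.Build A (I -> V1) (I -> V2) *:%R
  pointwise pointwise_linear.

End PointwiseMap.

Section Chains.
Context (A : comUnitRingType) (X : complex A).

Section Module.
Context (V : lmodType A).

(** A chain is any function on the whole basis, of all degrees at once and with no finiteness
    condition: the value of [del] at t involves only the finite basis of degree [(cdeg t).+1].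
    Homogeneity is imposed afterwards by [supported] and recovered by [truncate]. *)
Definition del (x : X -> V) : X -> V :=
  fun t => \sum_(s <- cbasis X (cdeg t).+1) cd s t *: x s.

Fact del_linear : linear del.
Proof.
move=> a x y; apply/funext => t.
rewrite [RHS]/(a *: del x t + del y t) /del scaler_sumr.
apply: etrans (big_split _ _ _ _ _); apply: eq_bigr => s _; rewrite [(a *: x + y) s]/(a *: x s + y s).
by rewrite scalerDr !scalerA mulrC.
Qed.

HB.instance Definition _ := GRing.isLinear.Build A (X -> V) (X -> V) *:%R
  del del_linear.

Lemma del_del x : del (del x) = 0.
Proof.
apply/funext => u; rewrite /del.
have -> : \sum_(s <- cbasis X (cdeg u).+1) cd s u *:
    \sum_(r <- cbasis X (cdeg s).+1) cd r s *: x r =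
  \sum_(s <- cbasis X (cdeg u).+1) \sum_(r <- cbasis X (cdeg u).+2)
    (cd r s * cd s u) *: x r.
  apply: eq_big_seq => s; rewrite mem_cbasis => /eqP ->.
  by rewrite scaler_sumr; apply: eq_bigr => r _; rewrite scalerA mulrC.
rewrite exchange_big /= big1 // => r _.
by rewrite -scaler_suml cdd scale0r.
Qed.

Definition truncate (n : nat) (x : X -> V) : X -> V :=
  fun t => if cdeg t == n then x t else 0.

Lemma del_truncate n x t :
  del (truncate n.+1 x) t = if cdeg t == n then del x t else 0.
Proof.
rewrite /del; case: eqP => [->|tn].
  apply: eq_big_seq => s; rewrite mem_cbasis /truncate => /eqP ->.
  by rewrite eqxx.
rewrite big_seq big1 // => s; rewrite mem_cbasis /truncate => /eqP ->.
by rewrite eqSS; case: eqP => // _; rewrite scaler0.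
Qed.

Definition supported (n : nat) (x : X -> V) := forall t, cdeg t != n -> x t = 0.

Lemma supported_truncate n x : supported n (truncate n x).
Proof. by move=> t /negbTE tn; rewrite /truncate tn. Qed.

Lemma truncate_id n x : supported n x -> truncate n x = x.
Proof.
move=> xn; apply/funext => t; rewrite /truncate; case: ifPn => // /xn ->; done.
Qed.

(* Chains of X (x) V/B are represented by chains of X (x) V. *)
Definition cycles n (B : set V) : set (X -> V) :=
  [set x | supported n x /\ forall t, B (del x t)].

Definition boundaries (B : set V) : set (X -> V) :=
  [set x | exists y, forall t, B (x t - del y t)].

Context (B : set V) (B_sub : is_submodule B).

Lemma cycles_submodule n : is_submodule (cycles n B).
Proof.
split=> [|x y [xn xB] [yn yB]|a x [xn xB]]; split.
- by [].
- by move=> t; rewrite linear0; exact: submodule0.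
- by move=> t tn; rewrite [LHS]/(x t + y t) xn // yn //; exact: addr0.
- by move=> t; rewrite linearD; exact: submoduleD.
- by move=> t tn; rewrite [LHS]/(a *: x t) xn //; exact: scaler0.
- by move=> t; rewrite linearZ; exact: submoduleZ.
Qed.

Lemma boundaries_submodule : is_submodule (boundaries B).
Proof.
split=> [|x y [x' hx] [y' hy]|a x [x' hx]].
- by exists 0 => t; rewrite linear0 subr0; exact: submodule0.
- exists (x' + y') => t; rewrite linearD.
  have -> : (x + y) t - (del x' + del y') t = (x t - del x' t) + (y t - del y' t).
    exact: subrACA.
  exact: submoduleD.
- exists (a *: x') => t; rewrite linearZ.
  have -> : (a *: x) t - (a *: del x') t = a *: (x t - del x' t).
    by rewrite scalerBr.
  exact: submoduleZ.
Qed.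

End Module.

Lemma del_pointwise (V1 V2 : lmodType A) (f : {linear V1 -> V2}) x t :
  del (pointwise f x) t = f (del x t).
Proof. by rewrite /del linear_sum; apply: eq_bigr => s _; rewrite linearZ. Qed.

(* The homology of X (x) N is a vector space over the residue field, for every
   module N. *)
Definition homology_killed := forall (V : lmodType A) (B : set V) n,
  is_submodule B -> killed (cycles n B) (boundaries B).

(** A null-homotopy of multiplication by a, given as a matrix h over A, acts on X (x) V for every V
    and preserves chains with values in any submodule B. *)
Lemma homotopy_killed :
  (forall a : A, maximal_ideal a -> exists h : X -> X -> A, forall s t,
     cdeg s = cdeg t ->
     \sum_(u <- cbasis X (cdeg t).+1) h s u * cd u t +
     \sum_(u <- cbasis X (cdeg t).-1) cd s u * h u t = if s == t then a else 0) ->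
  homology_killed.
Proof.
move=> hX V B n Bs a x /hX[h hP] [xn xB].
exists (fun u => \sum_(s <- cbasis X (cdeg u).-1) h s u *: x s) => t.
(* By the homotopy identity the defect of x from the boundary of h x is h applied to [del x], which
   has values in B. *)
have -> : (a *: x) t - del (fun u => \sum_(s <- cbasis X (cdeg u).-1) h s u *: x s) t =
    \sum_(u <- cbasis X (cdeg t).-1)
       h u t *: \sum_(s <- cbasis X (cdeg t)) cd s u *: x s.
  have e1 : del (fun u => \sum_(s <- cbasis X (cdeg u).-1) h s u *: x s) t =
      \sum_(s <- cbasis X (cdeg t))
        (\sum_(u <- cbasis X (cdeg t).+1) h s u * cd u t) *: x s.
    under [RHS]eq_bigr do rewrite scaler_suml.
    rewrite [RHS]exchange_big /=; apply: eq_big_seq => u.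
    rewrite mem_cbasis => /eqP ->; rewrite scaler_sumr /=.
    by apply: eq_bigr => s _; rewrite scalerA mulrC.
  have e2 : \sum_(u <- cbasis X (cdeg t).-1)
       h u t *: \sum_(s <- cbasis X (cdeg t)) cd s u *: x s =
      \sum_(s <- cbasis X (cdeg t))
        (\sum_(u <- cbasis X (cdeg t).-1) cd s u * h u t) *: x s.
    under [RHS]eq_bigr do rewrite scaler_suml.
    rewrite [RHS]exchange_big /=; apply: eq_bigr => u _; rewrite scaler_sumr.
    by apply: eq_bigr => s _; rewrite scalerA mulrC.
  rewrite e1 e2; apply/eqP; rewrite subr_eq addrC -big_split /=; apply/eqP.
  transitivity (\sum_(s <- cbasis X (cdeg t)) (if s == t then a else 0) *: x s).
    rewrite (bigD1_seq t) ?cbasis_uniq ?mem_cbasis //= eqxx big1 ?addr0 //.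
    by move=> s /negbTE ->; rewrite scale0r.
  apply: eq_big_seq => s; rewrite mem_cbasis => /eqP st.
  by rewrite -scalerDl hP.
rewrite big_seq; apply: submodule_sum => // u; rewrite mem_cbasis => /eqP ut.
(* In degree 0 the truncated predecessor is 0 again, and there the sum vanishes because [cd] does
   not preserve degree. *)
apply: submoduleZ => //; case tE: (cdeg t) ut => [|n'] /= ut.
  rewrite big_seq big1 => [|s]; first exact: submodule0.
  rewrite mem_cbasis => /eqP st.
  by rewrite cd_deg ?scale0r // ut st.
by have := xB u; rewrite /del ut.
Qed.

End Chains.

(** P may be assumed for all strictly larger ideals. Otherwise choice produces a strictly increasing
    sequence of counterexamples, and its union is finitely generated. *)
Lemma noetherian_ind (A : comUnitRingType) (A_noetherian : noetherian A)
    (P : set A^o -> Prop) :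
  (forall I : set A^o, is_submodule I ->
     (forall J : set A^o, is_submodule J -> I `<=` J -> ~ (J `<=` I) -> P J) -> P I) ->
  forall I : set A^o, is_submodule I -> P I.
Proof.
move=> step I0 sI0; apply: contrapT => nP0.
pose T := {I : set A^o | is_submodule I /\ ~ P I}.
have /choice [next nextP] : forall I : T,
    exists J : T, sval I `<=` sval J /\ ~ (sval J `<=` sval I).
  move=> [I [sI nPI]] /=; apply: contrapT => nex; apply/nPI/step => // J sJ IJ nJI.
  by apply: contrapT => nPJ; apply: nex; exists (exist _ J (conj sJ nPJ)).
pose C n : T := iter n next (exist _ I0 (conj sI0 nP0)).
have Cle m n : (m <= n)%N -> sval (C m) `<=` sval (C n).
  move=> /subnK <-; elim: (n - m)%N => // l IH x /IH.
  by have [h _] := nextP (C (l + m)); exact: h.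
pose U : set A^o := [set x | exists n, sval (C n) x].
have sC n : is_submodule (sval (C n)) by case: (svalP (C n)).
have sU : is_submodule U.
  split=> [|x y [m hx] [n hy]|a x [n hx]].
  - by exists 0; exact: submodule0.
  - exists (maxn m n); apply: submoduleD => //.
      exact: (Cle m _ (leq_maxl _ _)).
    exact: (Cle n _ (leq_maxr _ _)).
  - by exists n; exact: submoduleZ.
have [n [g [/choice[k kP] gen]]] := A_noetherian _ sU.
(* All generators of the union already lie in stage K, so stage K + 1 adds nothing, against
   strictness. *)
pose K := \max_i k i.
have [_] := nextP (C K); apply => x xK.
have /gen[c ->] : U x by exists K.+1.
apply: submodule_sum => // i _; apply: submoduleZ => //.
by apply: (Cle (k i)) => //; exact: leq_bigmax.
Qed.

(** * Devissage: bounding H(X (x) N) by H(X (x) k) *)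

Section Devissage.
Context (A : comUnitRingType) (A_local : local_ring A) (A_noetherian : noetherian A).
Context (X : complex A) (X_killed : homology_killed X).

Definition homology_le (n : nat) (V : lmodType A) (B : set V) h :=
  dim_le (cycles (X := X) n B) (boundaries B) h.

Section ShortExact.
(* The short exact sequence 0 -> V1/B1 -> V2/B2 -> V2/(B2 + f V1) -> 0. *)
Context (V1 V2 : lmodType A) (f : {linear V1 -> V2}).
Context (B1 : set V1) (B2 : set V2) (B2_sub : is_submodule B2).
Hypothesis B1E : forall v, B1 v <-> B2 (f v).

Definition adjoin_image : set V2 := [set v | exists u, B2 (v - f u)].

Lemma adjoin_image_submodule : is_submodule adjoin_image.
Proof.
split=> [|x y [u hu] [v hv]|a x [u hu]].
- by exists 0; rewrite linear0 subr0; exact: submodule0.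
- by exists (u + v); rewrite linearD subrACA; exact: submoduleD.
- by exists (a *: u); rewrite linearZ -scalerBr; exact: submoduleZ.
Qed.

(** This is exactness at the middle term of the long homology sequence: a chain y bounding z modulo
    the larger submodule leaves a remainder f u, and [B1E] makes u a cycle. *)
Lemma cycle_lift n z : cycles (X := X) n B2 z -> boundaries adjoin_image z ->
  exists2 u, cycles n B1 u & boundaries B2 (z - pointwise f u).
Proof.
move=> [zn zB] [y /choice[u hu]].
have del_trunc t : cdeg t = n -> del (truncate n.+1 y) t = del y t.
  by move=> tn; rewrite del_truncate tn eqxx.
have hB t : B2 (z t - pointwise f (truncate n u) t - del (truncate n.+1 y) t).
  have [tn|tn] := eqVneq (cdeg t) n.
    rewrite del_trunc // /pointwise /truncate tn eqxx.
    by have := hu t; rewrite addrAC.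
  rewrite del_truncate (negbTE tn) zn // /pointwise /truncate (negbTE tn).
  by rewrite linear0 !subr0; exact: submodule0.
exists (truncate n u); last by exists (truncate n.+1 y) => t; exact: hB.
split; first exact: supported_truncate.
move=> t; apply/B1E; rewrite -del_pointwise.
(* The chain w has values in B2, hence so has its differential; the contribution of y to the latter
   is a double differential and disappears. *)
set w := fun t => z t - pointwise f (truncate n u) t - del (truncate n.+1 y) t.
have : B2 (del w t).
  by apply: submodule_sum => // s _; apply: submoduleZ => //; exact: hB.
have -> : w = z - pointwise f (truncate n u) - del (truncate n.+1 y) by [].
rewrite !linearB /= del_del subr0.
have -> : (del z - del (pointwise f (truncate n u))) t =
  del z t - del (pointwise f (truncate n u)) t by [].
by rewrite addrC submoduleDl // => /(submoduleN B2_sub); rewrite opprK.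
Qed.

Lemma homology_le_ses n h1 h3 :
  homology_le n B1 h1 -> homology_le n adjoin_image h3 ->
  homology_le n B2 (h1 + h3).
Proof.
apply: (dim_le_exact A_local (f := pointwise f) (g := idfun)).
- exact: cycles_submodule.
- exact: boundaries_submodule.
- exact/boundaries_submodule/adjoin_image_submodule.
- exact/X_killed/adjoin_image_submodule.
- move=> b [y hy]; exists (pointwise f y) => t.
  by rewrite del_pointwise /pointwise -linearB; exact/B1E.
- move=> z [zn zB]; split=> // t; exists 0.
  by rewrite linear0 subr0.
- by move=> z /cycle_lift.
Qed.

End ShortExact.

(** Here a is regular on A/I. The kernel of H(X (x) A/I) -> H(X (x) A/(I + aA)) is the image of
    multiplication by a, which is zero because a kills homology; so the map is injective. *)
Lemma homology_le_regular n (I : set A^o) (a : A) h : is_submodule I ->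
  maximal_ideal a -> (forall v : A^o, I (a *: v) -> I v) ->
  homology_le n (adjoin_image (a \*: (@idfun A^o)) I) h -> homology_le n I h.
Proof.
move=> sI am reg.
apply: (dim_le_sub (f := idfun)); first exact: cycles_submodule.
  move=> z [zn zB]; split=> // t; exists 0.
  by rewrite linear0 subr0.
move=> z zc zb.
have IE (v : A^o) : I v <-> I ((a \*: (@idfun A^o)) v).
  by split=> [|/reg //]; exact: submoduleZ.
have [u uc ub] := cycle_lift sI IE zc zb.
rewrite -(subrK (pointwise (a \*: (@idfun A^o)) u) z).
apply: submoduleD => //; first exact: boundaries_submodule.
have -> : pointwise (a \*: (@idfun A^o)) u = a *: u by [].
exact: X_killed uc.
Qed.

(** Noetherian induction on I. Apart from I = A and I = m, take a in m outside I; then I + aA is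
    larger. If a is regular on A/I, that ideal suffices. If not, J = (I : a) is larger too, and 0 ->
    A/J -> A/I -> A/(I + aA) -> 0 adds the two constants. The constant depends on I but not on n. *)
Lemma homology_le_cyclic h :
  (forall n, homology_le n (@maximal_ideal A : set A^o) (h n)) ->
  forall I : set A^o, is_submodule I ->
    exists C, forall n, homology_le n I (C * h n).
Proof.
move=> hk; apply: noetherian_ind => // I sI IH.
have [I1|nI1] := pselect (I 1).
  exists 0 => n; apply: dim_le0; first exact: boundaries_submodule.
  move=> z _; exists 0 => t; rewrite -[_ - _]mulr1; exact: (submoduleZ sI).
have Im (v : A^o) : I v -> maximal_ideal (v : A).
  move=> Iv; apply: contrapT => /not_maximal_ideal vu; apply: nI1.
  by have := submoduleZ sI (v^-1 : A) Iv; rewrite /GRing.scale /= mulVr.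
have [mI|/existsNP[a /not_implyP[am aI]]] := pselect (forall v : A^o, maximal_ideal (v : A) -> I v).
  exists 1 => n; rewrite mul1n.
  suff -> : I = @maximal_ideal A by exact: hk.
  by apply/seteqP; split.
pose f : {linear A^o -> A^o} := a \*: (@idfun A^o).
have [C3 hC3] : exists C, forall n, homology_le n (adjoin_image f I) (C * h n).
  apply: IH; first exact: adjoin_image_submodule.
    by move=> v Iv; exists 0; rewrite linear0 subr0.
  move=> /(_ (a : A^o)) h'; apply: aI; apply: h'; exists (1 : A^o).
  by rewrite /f /= /GRing.scale /= mulr1 subrr; exact: submodule0.
have [reg|/existsNP[v /not_implyP[Iav Iv]]] := pselect (forall v : A^o, I (a *: v) -> I v).
  by exists C3 => n; exact: (homology_le_regular (a := a)).
pose J : set A^o := [set v | I (f v)].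
have [C1 hC1] : exists C, forall n, homology_le n J (C * h n).
  apply: IH; last by move=> /(_ v Iav).
    split.
    - by rewrite /J /mkset linear0; exact: submodule0.
    - by move=> x y; rewrite /J /mkset linearD; exact: submoduleD.
    - by move=> b x; rewrite /J /mkset linearZ; exact: submoduleZ.
  by move=> u Iu; exact: submoduleZ.
exists (C1 + C3) => n; rewrite mulnDl.
by apply: (homology_le_ses (f := f) (B1 := J)) => //.
Qed.

Section ScaleTo.
Context (V : lmodType A) (g : V).
Definition scale_to (r : A^o) : V := (r : A) *: g.
Fact scale_to_linear : linear scale_to.
Proof. by move=> a x y; rewrite /scale_to scalerDl scalerA. Qed.
HB.instance Definition _ := GRing.isLinear.Build A A^o V *:%R scale_to scale_to_linear.
End ScaleTo.

(** V/B is filtered by adjoining its generators to B one at a time; the successive kernels are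
    cyclic, generated by g0 with annihilator (B : g0). *)
Lemma homology_le_fg h (V : lmodType A) (B : set V) :
  (forall n, homology_le n (@maximal_ideal A : set A^o) (h n)) ->
  @finitely_generated A V setT -> is_submodule B ->
  exists C, forall n, homology_le n B (C * h n).
Proof.
move=> hk [b [g [_ gen]]] sB.
(* Generation is restated with lists, so that the induction can run over the generators while B
   varies; [zip] lets an exhausted coefficient list stand for zeros. *)
have: forall v, exists cs, B (v - \sum_(p <- zip cs (map g (enum 'I_b))) p.1 *: p.2).
  move=> v; have [//|c ->] := gen v; exists (map c (enum 'I_b)).
  rewrite zip_map big_map big_enum /= subrr; exact: submodule0.
elim: (map _ _) B sB => [|g0 s IH] B sB {}gen.
  exists 0 => n; apply: dim_le0; first exact: boundaries_submodule.
  move=> z _; exists 0 => t; have [cs] := gen (z t).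
  by rewrite linear0; case: cs => [|? ?] /=; rewrite big_nil; exact.
have [|C3 hC3] := IH (adjoin_image (scale_to g0) B) (adjoin_image_submodule _ sB).
  move=> v; have [[|c cs]] := gen v.
    rewrite /= big_nil => hv; exists [::]; exists 0.
    by case: (s) => [|? ?] /=; rewrite big_nil (linear0 (scale_to g0)) subr0.
  rewrite /= big_cons /= => hv; exists cs; exists c.
  by rewrite -addrA -opprD [_ + scale_to _ _]addrC.
pose J : set A^o := [set r | B (scale_to g0 r)].
have sJ : is_submodule J.
  split=> [|x y|a x]; rewrite /J /=.
  - by rewrite linear0; exact: submodule0.
  - by rewrite linearD; exact: submoduleD.
  - by rewrite linearZ; exact: submoduleZ.
have [C1 hC1] := homology_le_cyclic hk sJ.
exists (C1 + C3) => n; rewrite mulnDl.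
by apply: (homology_le_ses (f := scale_to g0) (B1 := J)).
Qed.

End Devissage.

(** * Tor is balanced *)

(* X is a free resolution of the residue field A/m; the augmentation is
   represented by a lift [al] to A. *)
Record resolves_residue (A : comUnitRingType) (X : complex A) (al : X -> A) : Prop :=
  ResolvesResidue {
  rr_exact : forall n (x : X -> A^o), supported n.+1 x -> del x = 0 ->
    exists y, x = del y;
  rr_exact0 : forall x : X -> A^o, supported 0 x ->
    (maximal_ideal (\sum_(t <- cbasis X 0) al t * x t) <-> exists y, x = del y);
  rr_unit : exists2 x : X -> A^o, supported 0 x &
    \sum_(t <- cbasis X 0) al t * x t = 1
}.

Lemma del_supported (A : comUnitRingType) (X : complex A) (V : lmodType A) n (x : X -> V) :
  supported n.+1 x -> supported n (del x).
Proof.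
by move=> /truncate_id <- t /negbTE tn; rewrite del_truncate tn.
Qed.

Section FreeCoefficients.
Context (A : comUnitRingType) (A_local : local_ring A).
Context (X : complex A) (al : X -> A) (X_res : resolves_residue al).
Context (b : nat).

Section Coord.
Context (j : 'I_b).
Definition coord (v : 'rV[A]_b) : A^o := v 0 j.
Fact coord_linear : linear coord.
Proof. by move=> a x y; rewrite /coord !mxE. Qed.
HB.instance Definition _ := GRing.isLinear.Build A 'rV[A]_b A^o *:%R coord coord_linear.
End Coord.

Lemma coord_inj (v w : 'rV[A]_b) : (forall j, coord j v = coord j w) -> v = w.
Proof. by move=> vw; apply/rowP => j; exact: vw. Qed.

Definition of_coords (y : 'I_b -> X -> A^o) : X -> 'rV[A]_b := fun t => \row_j y j t.

Lemma coord_of_coords y j t : coord j (of_coords y t) = y j t.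
Proof. by rewrite /coord mxE. Qed.

Lemma del_of_coords y j t : coord j (del (of_coords y) t) = del (y j) t.
Proof.
rewrite -(del_pointwise (coord j)); congr (del _ t).
by apply/funext => s; exact: coord_of_coords.
Qed.

Lemma free_boundary (x : X -> 'rV[A]_b) :
  (forall j, exists y, pointwise (coord j) x = del y) -> exists y, x = del y.
Proof.
move=> /choice[y hy]; exists (of_coords y); apply/funext => t.
by apply: coord_inj => j; rewrite del_of_coords -hy.
Qed.

Lemma free_exact n (x : X -> 'rV[A]_b) :
  supported n.+1 x -> del x = 0 -> exists y, x = del y.
Proof.
move=> xn dx; apply: free_boundary => j; apply: (rr_exact X_res (n := n)).
  by move=> t tn; rewrite /pointwise xn // linear0.
by apply/funext => t; rewrite del_pointwise dx linear0.
Qed.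

Definition augment (V : lmodType A) (x : X -> V) : V :=
  \sum_(t <- cbasis X 0) al t *: x t.

Fact augment_linear V : linear (@augment V).
Proof.
move=> a x y; rewrite /augment scaler_sumr.
apply: etrans (big_split _ _ _ _ _); apply: eq_bigr => s _.
by rewrite [(a *: x + y) s]/(a *: x s + y s) scalerDr !scalerA mulrC.
Qed.
HB.instance Definition _ (V : lmodType A) := GRing.isLinear.Build A (X -> V) V *:%R
  (@augment V) (@augment_linear V).

Lemma augment_pointwise (V1 V2 : lmodType A) (f : {linear V1 -> V2}) x :
  augment (pointwise f x) = f (augment x).
Proof. by rewrite /augment linear_sum; apply: eq_bigr => s _; rewrite linearZ. Qed.

Definition maximal_row (v : 'rV[A]_b) := forall j, maximal_ideal (v 0 j).

Lemma augment_boundary (x : X -> 'rV[A]_b) : supported 0 x ->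
  maximal_row (augment x) <-> exists y, x = del y.
Proof.
move=> x0.
have x0j j : supported 0 (pointwise (coord j) x).
  by move=> t tn; rewrite /pointwise x0 // linear0.
have aj j : augment x 0 j =
    \sum_(t <- cbasis X 0) al t * (pointwise (coord j) x t : A).
  by rewrite -/(coord j (augment x)) -augment_pointwise.
split=> [xm|[y xy] j].
  apply: free_boundary => j; apply/(rr_exact0 X_res) => //.
  by have := xm j; rewrite aj.
rewrite aj; apply/(rr_exact0 X_res) => //; exists (pointwise (coord j) y).
by apply/funext => t; rewrite del_pointwise -xy.
Qed.

Lemma augment_del (x : X -> 'rV[A]_b) : maximal_row (augment (del x)).
Proof.
have -> : augment (del x) = augment (del (truncate 1 x)).
  apply: eq_big_seq => t; rewrite mem_cbasis => t0.
  by rewrite del_truncate t0.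
apply/augment_boundary; first exact/del_supported/supported_truncate.
by exists (truncate 1 x).
Qed.

Lemma augment_surj (p : 'rV[A]_b) : exists2 v : X -> 'rV[A]_b,
  supported 0 v & augment v = p /\
  forall c (f : {linear 'rV[A]_b -> 'rV[A]_c}), f p = 0 -> pointwise f v = 0.
Proof.
have [x x0 x1] := rr_unit X_res; exists (fun t => (x t : A) *: p).
  by move=> t t0; rewrite x0 // scale0r.
split.
  rewrite /augment; under eq_bigr do rewrite scalerA.
  by rewrite -scaler_suml x1 scale1r.
by move=> c f fp; apply/funext => t; rewrite /pointwise linearZ fp; exact: scaler0.
Qed.

End FreeCoefficients.

Section RankOfSubquotient.
Context (A : comUnitRingType) (k : fieldType) (pi : {rmorphism A -> k}).
Context (k_residue : residue_field pi).

Lemma residue0 a : maximal_ideal a <-> pi a = 0.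
Proof. by case: k_residue => _ h; split=> /h. Qed.

Lemma residue_lift m n (B : 'M[k]_(m, n)) : exists C : 'M[A]_(m, n), map_mx pi C = B.
Proof.
case: k_residue => /choice[l hl] _; exists (map_mx l B).
by apply/matrixP => i j; rewrite !mxE hl.
Qed.

Lemma maximal_row0 b (p : 'rV[A]_b) : maximal_row p <-> map_mx pi p = 0.
Proof.
split=> [h|h j]; first by apply/rowP => j; rewrite !mxE; apply/residue0/h.
by apply/residue0; have /rowP/(_ j) := h; rewrite !mxE.
Qed.

(** Reduction to k turns independence modulo B into row independence modulo E: the matrix P of
    reduced rows is free and meets E trivially, so its rank adds to that of E inside K. *)
Lemma indep_rank b r e (K : 'M[k]_(r, b)) (E : 'M[k]_(e, b)) (Z B : set 'rV[A]_b) :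
  (E <= K)%MS -> (forall p, Z p <-> (map_mx pi p <= K)%MS) ->
  (forall p, B p <-> (map_mx pi p <= E)%MS) ->
  forall m, indep Z B m <-> (m <= \rank (K :\: E)%MS)%N.
Proof.
move=> EK ZK BE m.
have mapsum (c : 'I_m -> A) (z : 'I_m -> 'rV[A]_b) : map_mx pi (\sum_i c i *: z i) =
    (\row_i pi (c i)) *m (\matrix_i map_mx pi (z i)).
  rewrite map_mx_sum mulmx_sum_row; apply: eq_bigr => i _.
  by rewrite map_mxZ rowK mxE.
have rkE : \rank (K :\: E)%MS = (\rank K - \rank E)%N.
  have := mxrank_cap_compl K E.
  have -> : \rank (K :&: E)%MS = \rank E by have /capmx_idPr -> := EK.
  by move=> <-; rewrite addKn.
split=> [[z [Zz zB]]|hm].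
  pose P := \matrix_i map_mx pi (z i).
  have PK : (P <= K)%MS by apply/row_subP => i; rewrite rowK; exact/ZK.
  have Pind (c : 'rV[k]_m) : (c *m P <= E)%MS -> c = 0.
    have [c' <-] := residue_lift c => cE; apply/maximal_row0 => j.
    apply: (zB (fun i => c' 0 i)); apply/BE; rewrite mapsum.
    by move: cE; congr (_ *m _ <= _)%MS; apply/rowP => i; rewrite !mxE.
  have PE0 : (P :&: E)%MS = 0.
    apply/eqP; rewrite -submx0; apply/row_subP => i.
    set v := row i _.
    have : (v <= P :&: E)%MS by exact: row_sub.
    rewrite sub_capmx => /andP[/submxP[c vc] vE].
    by rewrite vc (Pind c) ?mul0mx ?sub0mx // -vc.
  have Pfree : \rank P = m.
    apply/eqP; rewrite -/(row_free P) -kermx_eq0 -submx0; apply/row_subP => i.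
    by rewrite (Pind (row i (kermx P))) ?sub0mx // -row_mul mulmx_ker row0 sub0mx.
  rewrite rkE leq_subRL; last exact: mxrankS.
  have <- : \rank (E + P)%MS = (\rank E + m)%N.
    by rewrite mxrank_disjoint_sum ?Pfree // capmxC.
  by apply: mxrankS; rewrite addsmx_sub EK.
(* Conversely, the first m rows of a basis of a complement of E in K are lifted to A. *)
pose Q := row_base (K :\: E)%MS.
have [Q' Q'E] := residue_lift Q.
exists (fun i => row (widen_ord hm i) Q'); split=> [i|c].
  apply/ZK; rewrite map_row Q'E (submx_trans (row_sub _ _)) //.
  by rewrite (submx_trans _ (diffmxSl K E)) // eq_row_base.
move=> /BE; rewrite mapsum.
set cc := \row_i _; set P := \matrix_i _ => ccE i.
pose S : 'M[k]_(m, _) := rowsub (widen_ord hm) 1%:M.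
have PQ : P = S *m Q.
  by rewrite mul_rowsub_mx mul1mx; apply/matrixP => l j; rewrite [RHS]mxE -Q'E !mxE.
have : (cc *m P <= (K :\: E) :&: E)%MS.
  by rewrite sub_capmx ccE andbT PQ mulmxA (submx_trans (submxMl _ _)) ?eq_row_base.
rewrite capmx_diff submx0 PQ mulmxA mulmx_free_eq0 ?row_base_free // => /eqP cS0.
apply/residue0; have /rowP/(_ (widen_ord hm i)) := cS0.
rewrite !mxE (bigD1 i) //= big1 => [|l li]; first by rewrite !mxE eqxx mulr1 addr0.
by rewrite !mxE -val_eqE /= val_eqE (negbTE li) mulr0.
Qed.

End RankOfSubquotient.

(** * Dimension shifting along the syzygies of M *)

Section Syzygies.
Context (A : comUnitRingType) (A_local : local_ring A).
Context (k : fieldType) (pi : {rmorphism A -> k}) (k_residue : residue_field pi).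
Context (M : lmodType A) (F : free_resolution M).
Context (X : complex A) (al : X -> A) (X_res : resolves_residue al).

Local Notation V s := 'rV[A]_(fr_rank F s).

Definition syz_map s : {linear V s.+1 -> V s} := mulmxr (fr_diff F s).

(* The s-th syzygy module is presented as the quotient of A^(b s) by the image
   of A^(b (s+1)). *)
Definition syz_relations s : set (V s) := [set v | exists w, v = syz_map s w].

Lemma syz_relations_submodule s : is_submodule (@syz_relations s).
Proof.
split=> [|_ _ [v ->] [w ->]|a _ [v ->]]; first by exists 0; rewrite linear0.
  by exists (v + w); rewrite linearD.
by exists (a *: v); rewrite linearZ.
Qed.

Lemma syz_map_eq0 s v : syz_map s v = 0 <-> syz_relations v.
Proof. exact: fr_exact. Qed.

(** The connecting map of 0 -> Syz (s+1) -> V s -> Syz s -> 0 after tensoring with X, as a relation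
    between representatives; v is determined only modulo [syz_relations]. *)
Definition connecting s (z : X -> V s) (v : X -> V s.+1) :=
  del z = pointwise (syz_map s) v.

Lemma connecting_sum s m (z : 'I_m -> X -> V s) v (c : 'I_m -> A) :
  (forall i, connecting (z i) (v i)) ->
  connecting (\sum_i c i *: z i) (\sum_i c i *: v i).
Proof.
move=> zv; rewrite /connecting !linear_sum; apply: eq_bigr => i _.
by rewrite !linearZ /=; congr (_ *: _); exact: zv.
Qed.

Lemma connecting_exists s n z : cycles n.+1 (@syz_relations s) z ->
  exists2 v, cycles n (@syz_relations s.+1) v & connecting z v.
Proof.
move=> [zn /choice[v vz]].
have zv : connecting z (truncate n v).
  apply/funext => t; rewrite /pointwise /truncate; case: eqP => [_|/eqP tn].
    exact: vz.
  by rewrite linear0 (del_supported zn).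
exists (truncate n v) => //; split; first exact: supported_truncate.
by move=> t; apply/syz_map_eq0; rewrite -del_pointwise -zv del_del.
Qed.

Lemma connecting_cycle s n z v : supported n.+1 z -> connecting z v ->
  cycles n.+1 (@syz_relations s) z.
Proof. by move=> zn zv; split=> // t; exists (v t); rewrite zv. Qed.

(** From left to right the connecting map is well defined; from right to left it is injective,
    because V s is free and X (x) V s is exact in positive degrees. *)
Lemma connecting_boundaries s n z v : supported n.+1 z -> connecting z v ->
  boundaries (@syz_relations s) z <-> boundaries (@syz_relations s.+1) v.
Proof.
move=> zn zv; split=> [[y /choice[u hu]]|[y hy]].
  exists u => t; apply/syz_map_eq0; rewrite linearB -del_pointwise.
  apply/eqP; rewrite subr_eq0; apply/eqP.
  transitivity (del z t); first by rewrite zv.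
  have -> : pointwise (syz_map s) u = z - del y by apply/funext => t'; rewrite [RHS]hu.
  by rewrite linearB /= del_del subr0.
have dz : del z = del (pointwise (syz_map s) y).
  apply/funext => t; rewrite zv del_pointwise; apply/eqP.
  by rewrite -subr_eq0 -linearB; apply/eqP/syz_map_eq0.
pose y' := truncate n.+1 (pointwise (syz_map s) y).
have [||y'' hy''] := @free_exact _ _ _ X_res _ n (z - y').
- move=> t tn; have y0 : y' t = 0 by exact: supported_truncate.
  by rewrite [LHS]/(z t - y' t) zn // y0; exact: subr0.
- apply/funext => t; rewrite linearB [LHS]/(del z t - del y' t) del_truncate.
  case: eqP => [_|/eqP tn]; first by rewrite dz; exact: subrr.
  by rewrite (del_supported zn) //; exact: subr0.
exists y'' => t; rewrite -hy''.
have -> : z t - (z - y') t = y' t by exact: subKr.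
rewrite /y' /truncate; case: ifP => _; first by exists (y t).
by apply: submodule0; exact: syz_relations_submodule.
Qed.

(** Both directions use that X (x) V s is acyclic in degrees n + 1 and n + 2. The shift therefore
    stops at degree 1, where the augmentation has to take over. *)
Lemma homology_shift n s m :
  indep (cycles (X := X) n.+2 (@syz_relations s)) (boundaries (@syz_relations s)) m <->
  indep (cycles (X := X) n.+1 (@syz_relations s.+1)) (boundaries (@syz_relations s.+1)) m.
Proof.
split.
- apply: (indep_map (f := @connecting s)) => [z|m' z v c zc vc zv].
    exact: connecting_exists.
  have sc : cycles n.+2 (@syz_relations s) (\sum_i c i *: z i).
    apply: submodule_sum => [|i _]; first exact/cycles_submodule/syz_relations_submodule.
    by apply: submoduleZ => //; exact/cycles_submodule/syz_relations_submodule.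
  by move/(connecting_boundaries sc.1 (connecting_sum c zv)).
- apply: (indep_map (f := fun v z => @connecting s z v)) => [v [vn vB]|m' z v c vc zc vz].
    have [||z hz] := @free_exact _ _ _ X_res _ n (pointwise (syz_map s) v).
    + by move=> t tn; rewrite /pointwise vn // linear0.
    + by apply/funext => t; rewrite del_pointwise; apply/syz_map_eq0.
    have zv : connecting (truncate n.+2 z) v.
      apply/funext => t; rewrite del_truncate -hz; case: eqP => // /eqP tn.
      by rewrite /pointwise vn // linear0.
    exists (truncate n.+2 z) => //.
    by apply: connecting_cycle zv; exact: supported_truncate.
  have sc : cycles n.+2 (@syz_relations s) (\sum_i c i *: v i).
    apply: submodule_sum => [|i _]; first exact/cycles_submodule/syz_relations_submodule.
    by apply: submoduleZ => //; exact/cycles_submodule/syz_relations_submodule.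
  by move/(connecting_boundaries sc.1 (connecting_sum c vz)).
Qed.

(** The cycles and boundaries of F (x) k, pulled back to F: being zero over k is having all entries
    in the maximal ideal. *)
Definition tor_cycles s : set (V s.+1) := [set p | maximal_row (syz_map s p)].
Definition tor_boundaries s : set (V s) :=
  [set p | exists w, maximal_row (p - syz_map s w)].

Lemma augment_boundaries s (v : X -> V s) : supported 0 v ->
  boundaries (@syz_relations s) v <-> tor_boundaries (augment al v).
Proof.
move=> v0; split=> [[y /choice[w hw]]|[w hw]].
  exists (augment al w); rewrite -augment_pointwise -linearB /=.
  have -> : v - pointwise (syz_map s) w = del y.
    by apply/funext => t; rewrite [LHS]/(v t - syz_map s (w t)) -hw; exact: subKr.
  exact: (augment_del X_res).
have [e e0 [ew eK]] := augment_surj X_res w.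
have ve0 : supported 0 (v - pointwise (syz_map s) e).
  by move=> t t0; rewrite [LHS]/(v t - syz_map s (e t)) v0 // e0 // linear0; exact: subr0.
have vem : maximal_row (augment al (v - pointwise (syz_map s) e)).
  by rewrite linearB /= augment_pointwise ew.
have [y hy] := (augment_boundary X_res ve0).1 vem.
exists y => t; rewrite -hy; exists (e t); exact: subKr.
Qed.

(** The connecting map ends in X_0 (x) V (s+1), and the augmentation of X identifies classes there
    with vectors over k; those coming from cycles are the ones killed by [syz_map] modulo m. *)
Lemma homology1 s m :
  indep (cycles (X := X) 1 (@syz_relations s)) (boundaries (@syz_relations s)) m <->
  indep (@tor_cycles s) (@tor_boundaries s.+1) m.
Proof.
pose R (z : X -> V s) p := exists v, [/\ supported 0 v, connecting z v & augment al v = p].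
have Rsum m' (z : 'I_m' -> X -> V s) p c : (forall i, R (z i) (p i)) ->
    R (\sum_i c i *: z i) (\sum_i c i *: p i).
  move=> /choice[v hv]; exists (\sum_i c i *: v i); split.
  - elim/big_ind: _ => // [x y x0 y0 t t0|i _ t t0].
      by rewrite [LHS]/(x t + y t) x0 // y0 //; exact: addr0.
    by have [v0 _ _] := hv i; rewrite [LHS]/(c i *: v i t) v0 //; exact: scaler0.
  - by apply: connecting_sum => i; have [] := hv i.
  - by rewrite linear_sum; apply: eq_bigr => i _; rewrite linearZ /=; have [_ _ ->] := hv i.
have RB z p : supported 1 z -> R z p ->
    boundaries (@syz_relations s) z <-> tor_boundaries p.
  move=> z1 [v [v0 zv <-]]; rewrite (connecting_boundaries z1 zv).
  exact: augment_boundaries.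
have sc m' (z : 'I_m' -> X -> V s) c : (forall i, cycles 1 (@syz_relations s) (z i)) ->
    supported 1 (\sum_i c i *: z i).
  move=> zc; suff: cycles 1 (@syz_relations s) (\sum_i c i *: z i) by case.
  apply: submodule_sum => [|i _]; first exact/cycles_submodule/syz_relations_submodule.
  by apply: submoduleZ => //; exact/cycles_submodule/syz_relations_submodule.
split.
- apply: (indep_map (f := R)) => [z zc|m' z p c zc _ zp /RB].
    have [v [v0 vB] zv] := connecting_exists zc.
    exists (augment al v); last by exists v.
    rewrite /tor_cycles /mkset -augment_pointwise -zv; exact: (augment_del X_res).
  by apply; [exact: sc|exact: Rsum].
- apply: (indep_map (f := fun p z => R z p)) => [p pc|m' p z c _ zc zp /RB h].
    have [v v0 [vp vK]] := augment_surj X_res p.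
    have fv0 : supported 0 (pointwise (syz_map s) v).
      by move=> t t0; rewrite /pointwise v0 // linear0.
    have fvm : maximal_row (augment al (pointwise (syz_map s) v)).
      by rewrite augment_pointwise vp.
    have [z hz] := (augment_boundary X_res fv0).1 fvm.
    have zv : connecting (truncate 1 z) v.
      apply/funext => t; rewrite del_truncate -hz; case: eqP => // /eqP t0.
      by rewrite /pointwise v0 // linear0.
    exists (truncate 1 z); last by exists v.
    by apply: connecting_cycle zv; exact: supported_truncate.
  by apply: h; [exact: sc|exact: Rsum].
Qed.

Lemma homology0 m :
  indep (cycles (X := X) 0 (@syz_relations 0)) (boundaries (@syz_relations 0)) m <->
  indep setT (@tor_boundaries 0) m.
Proof.
pose R (v : X -> V 0) p := augment al v = p.
have sc m' (z : 'I_m' -> X -> V 0) c : (forall i, cycles 0 (@syz_relations 0) (z i)) ->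
    supported 0 (\sum_i c i *: z i).
  move=> zc; suff: cycles 0 (@syz_relations 0) (\sum_i c i *: z i) by case.
  apply: submodule_sum => [|i _]; first exact/cycles_submodule/syz_relations_submodule.
  by apply: submoduleZ => //; exact/cycles_submodule/syz_relations_submodule.
have Rsum m' (z : 'I_m' -> X -> V 0) p c : (forall i, R (z i) (p i)) ->
    R (\sum_i c i *: z i) (\sum_i c i *: p i).
  by move=> h; rewrite /R linear_sum; apply: eq_bigr => i _; rewrite linearZ /= h.
split.
- apply: (indep_map (f := R)) => [z zc|m' z p c zc _ zp]; first by exists (augment al z).
  by rewrite -(Rsum _ _ _ c zp) => /augment_boundaries; apply; exact: sc.
- apply: (indep_map (f := fun p z => R z p)) => [p pc|m' p z c _ zc zp].
    have [v v0 [vp _]] := augment_surj X_res p.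
    exists v => //; split=> // t; rewrite /del big_seq big1 => [|u].
      by apply: submodule0; exact: syz_relations_submodule.
    by rewrite mem_cbasis => /eqP ut; rewrite v0 ?scaler0 // ut.
  move/augment_boundaries; rewrite (Rsum _ _ _ c zp); apply; exact: sc.
Qed.

(** Tor is balanced, so the Betti numbers of M may be computed from any resolution X of k. This is
    what lets the cone and G be compared without any map between them. *)
Lemma homology_betti n m :
  indep (cycles (X := X) n (@syz_relations 0)) (boundaries (@syz_relations 0)) m <->
  (m <= betti pi F n)%N.
Proof.
have tdE s (w : V s.+1) : map_mx pi (syz_map s w) = map_mx pi w *m tor_diff pi F s.
  by rewrite map_mxM.
have tbE s (p : V s) : tor_boundaries p <-> (map_mx pi p <= tor_diff pi F s)%MS.
  split=> [[w /(maximal_row0 k_residue)]|/submxP[w]].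
    by rewrite map_mxB tdE => /eqP; rewrite subr_eq0 => /eqP ->; exact: submxMl.
  have [w' <-] := residue_lift k_residue w => pw; exists w'.
  by apply/(maximal_row0 k_residue); rewrite map_mxB tdE pw subrr.
case: n => [|n].
  rewrite homology0; apply: (indep_rank k_residue) => // [|p]; first exact: submx1.
  by split=> // _; exact: submx1.
have -> : indep (cycles (X := X) n.+1 (@syz_relations 0)) (boundaries (@syz_relations 0)) m <->
    indep (cycles (X := X) 1 (@syz_relations n)) (boundaries (@syz_relations n)) m.
  (* Each shift lowers the homological degree and raises the syzygy, so the induction must leave s
     free. *)
  have gen s : indep (cycles (X := X) n.+1 (@syz_relations s)) (boundaries (@syz_relations s)) m <->
    indep (cycles (X := X) 1 (@syz_relations (s + n))) (boundaries (@syz_relations (s + n))) m.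
    elim: n s => [|n IH] s; first by rewrite addn0.
    by rewrite homology_shift IH addSnnS.
  exact: gen.
rewrite homology1; apply: (indep_rank k_residue) => //.
  apply/sub_kermxP.
  rewrite -map_mxM; apply/matrixP => i j.
  have : row i (fr_diff F n.+1) *m fr_diff F n = 0.
    by apply/fr_exact; exists (delta_mx 0 i); rewrite rowE.
  by rewrite -row_mul => /rowP/(_ j); rewrite !mxE => ->; rewrite rmorph0.
move=> p; split=> [/(maximal_row0 k_residue)|/sub_kermxP h].
  by rewrite tdE => /sub_kermxP.
by apply/(maximal_row0 k_residue); rewrite tdE.
Qed.

End Syzygies.

(** * Mapping cones *)

Lemma addrBKB (V : zmodType) (a b c : V) : a + c = a + b - (b - c).
Proof. by rewrite opprB -addrA [b + _]addrC subrK. Qed.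

Section Cone.
Context (A : comUnitRingType) (U Q : complex A) (h : Q -> U -> A).
Hypothesis h_deg : forall s u, cdeg s != (cdeg u).+1 -> h s u = 0.
Hypothesis h_d : forall s u,
  \sum_(v <- cbasis U (cdeg u).+1) h s v * cd v u +
  \sum_(t <- cbasis Q (cdeg u).+1) cd s t * h t u = 0.

(** The degrees of Q already contain the shift of the cone: h lowers degree by one and anticommutes
    with the differentials, so no degree is changed here. *)
Definition cone_deg (s : U + Q) := match s with inl u => cdeg u | inr t => cdeg t end.

Definition cone_basis n : seq (U + Q) :=
  map inl (cbasis U n) ++ map inr (cbasis Q n).

Definition cone_d (s t : U + Q) : A :=
  match s, t with
  | inl s, inl t => cd s t
  | inl _, inr _ => 0
  | inr s, inl t => h s t
  | inr s, inr t => cd s t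
  end.

Fact cone_basis_uniq n : uniq (cone_basis n).
Proof.
rewrite cat_uniq !map_inj_uniq ?cbasis_uniq; try by move=> ? ? [].
by rewrite andbT /=; apply/hasPn => _ /mapP[t _ ->]; apply/mapP => -[].
Qed.

Fact mem_cone_basis n s : (s \in cone_basis n) = (cone_deg s == n).
Proof.
rewrite mem_cat; case: s => s /=.
  rewrite mem_map ?mem_cbasis; last by move=> ? ? [].
  by case: (_ == n) => //=; apply/mapP => -[].
rewrite [X in _ || X]mem_map ?mem_cbasis; last by move=> ? ? [].
by case: (_ == n); rewrite ?orbT ?orbF //; apply/mapP => -[].
Qed.

Fact cone_d_deg s t : cone_deg s != (cone_deg t).+1 -> cone_d s t = 0.
Proof. by case: s => s; case: t => t //=; [exact: cd_deg|exact: h_deg|exact: cd_deg]. Qed.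

Fact cone_dd s u :
  \sum_(t <- cone_basis (cone_deg u).+1) cone_d s t * cone_d t u = 0.
Proof.
rewrite big_cat !big_map /=; case: s => s; case: u => u /=.
- by rewrite cdd [X in _ + X]big1 ?addr0 // => t _; rewrite mul0r.
- by rewrite !big1 ?addr0 // => t _; rewrite ?mul0r ?mulr0.
- exact: h_d.
- by rewrite cdd big1 ?addr0 // => t _; rewrite mulr0.
Qed.

Definition cone : complex A :=
  Complex cone_basis_uniq mem_cone_basis cone_d_deg cone_dd.

Section ConeChains.
Context (V : lmodType A).

Definition glue (x : U -> V) (y : Q -> V) : cone -> V :=
  fun s => match s with inl u => x u | inr t => y t end.

Definition twist (y : Q -> V) : U -> V :=
  fun u => \sum_(t <- cbasis Q (cdeg u).+1) h t u *: y t.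

Definition base_part (x : cone -> V) : U -> V := fun u => x (inl u).
Definition shift_part (x : cone -> V) : Q -> V := fun t => x (inr t).

Definition of_base (x : U -> V) : cone -> V := glue x 0.

Fact of_base_linear : linear of_base.
Proof.
move=> a x y; apply/funext => -[u //|t]; rewrite [RHS]/(a *: (0 : V) + 0).
by rewrite scaler0; apply/esym/addr0.
Qed.
HB.instance Definition _ := GRing.isLinear.Build A (U -> V) (cone -> V) *:%R
  of_base of_base_linear.

Fact shift_part_linear : linear shift_part.
Proof. by []. Qed.
HB.instance Definition _ := GRing.isLinear.Build A (cone -> V) (Q -> V) *:%R
  shift_part shift_part_linear.

Fact twist_linear : linear twist.
Proof.
move=> a x y; apply/funext => u; rewrite [RHS]/(a *: twist x u + twist y u).
rewrite /twist scaler_sumr.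
apply: etrans (big_split _ _ _ _ _); apply: eq_bigr => s _.
by rewrite [(a *: x + y) s]/(a *: x s + y s) scalerDr !scalerA mulrC.
Qed.
HB.instance Definition _ := GRing.isLinear.Build A (Q -> V) (U -> V) *:%R
  twist twist_linear.

Lemma del_glue_inl x y u : del (glue x y) (inl u) = del x u + twist y u.
Proof. by rewrite {1}/del /= big_cat !big_map. Qed.

Lemma del_glue_inr x y t : del (glue x y) (inr t) = del y t.
Proof.
rewrite {1}/del /= big_cat !big_map /= big1 => [|u _]; last by rewrite scale0r.
exact: add0r.
Qed.

Lemma glueK (x : cone -> V) : glue (base_part x) (shift_part x) = x.
Proof. by apply/funext => -[]. Qed.

Lemma del_twist y : del (twist y) = - twist (del y).
Proof.
apply/funext => u; apply/eqP; rewrite -subr_eq0 -[X in _ - X]/(- twist (del y) u) opprK.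
apply/eqP; rewrite {1}/del /twist.
have -> : \sum_(v <- cbasis U (cdeg u).+1) cd v u *:
    (\sum_(t <- cbasis Q (cdeg v).+1) h t v *: y t) =
  \sum_(s <- cbasis Q (cdeg u).+2)
    (\sum_(v <- cbasis U (cdeg u).+1) h s v * cd v u) *: y s.
  under [RHS]eq_bigr do rewrite scaler_suml.
  rewrite [RHS]exchange_big /=; apply: eq_big_seq => v.
  rewrite mem_cbasis => /eqP ->; rewrite scaler_sumr.
  by apply: eq_bigr => t _; rewrite scalerA mulrC.
have -> : \sum_(t <- cbasis Q (cdeg u).+1) h t u *: del y t =
  \sum_(s <- cbasis Q (cdeg u).+2)
    (\sum_(t <- cbasis Q (cdeg u).+1) cd s t * h t u) *: y s.
  under [RHS]eq_bigr do rewrite scaler_suml.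
  rewrite [RHS]exchange_big /=; apply: eq_big_seq => t.
  rewrite mem_cbasis => /eqP tu; rewrite /del tu scaler_sumr.
  by apply: eq_bigr => s _; rewrite scalerA mulrC.
rewrite -big_split /= big1 // => s _.
by rewrite -scalerDl h_d scale0r.
Qed.

Lemma twist_supported n y : supported n.+1 y -> supported n (twist y).
Proof.
move=> yn u un; rewrite /twist big_seq big1 // => t.
by rewrite mem_cbasis => /eqP tu; rewrite yn ?scaler0 // tu eqSS.
Qed.

Lemma supported_glue n x y : supported n x -> supported n y -> supported n (glue x y).
Proof. by move=> xn yn [u|t]; [exact: xn|exact: yn]. Qed.

End ConeChains.

Section ConeHomology.
Context (A_local : local_ring A) (V : lmodType A) (B : set V) (B_sub : is_submodule B).

Lemma twist_in (y : Q -> V) u : (forall t, B (y t)) -> B (twist y u).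
Proof. by move=> yB; apply: submodule_sum => // t _; exact: submoduleZ. Qed.

(** Exactness of H(U) -> H(cone) -> H(Q) at the middle, where H(Q) is killed by m. *)
Lemma cone_homology_le n h1 h3 : homology_killed Q ->
  homology_le U n B h1 -> homology_le Q n B h3 ->
  homology_le cone n B (h1 + h3).
Proof.
move=> Qk.
apply: (dim_le_exact A_local (f := @of_base V) (g := @shift_part V)).
- exact: cycles_submodule.
- exact: boundaries_submodule.
- exact: boundaries_submodule.
- exact: Qk.
- move=> x [y hy]; exists (glue y 0) => -[u|t].
    rewrite del_glue_inl linear0.
    have -> : del y u + (0 : U -> V) u = del y u by exact: addr0.
    exact: hy.
  rewrite del_glue_inr linear0.
  have -> : of_base x (inr t) - (0 : Q -> V) t = 0 by exact: subr0.
  exact: submodule0.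
- move=> z [zn zB]; split=> [t tn|t]; first exact: zn.
  by rewrite -(del_glue_inr (base_part z)) glueK.
move=> z [zn zB] [y hy].
pose y' := truncate n.+1 y.
have hy' t : B (z (inr t) - del y' t).
  rewrite /y' del_truncate; case: ifPn => [_|tn]; first exact: hy.
  by rewrite zn // subr0; exact: submodule0.
(* Subtracting the boundary of y', placed in Q, removes the Q-part of z modulo B and changes its
   U-part by [twist y']. *)
exists (base_part z - twist y'); last first.
  exists (glue 0 y') => -[u|t].
    rewrite del_glue_inl linear0.
    have -> : (z - of_base (base_part z - twist y')) (inl u) = twist y' u by exact: subKr.
    have -> : (0 : U -> V) u + twist y' u = twist y' u by exact: add0r.
    by rewrite subrr; exact: submodule0.
  rewrite del_glue_inr.
  by have -> : (z - of_base (base_part z - twist y')) (inr t) = z (inr t) by exact: subr0.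
split.
  move=> u un; have tu : twist y' u = 0.
    by apply: (twist_supported (n := n)) => //; exact: supported_truncate.
  by rewrite [LHS]/(z (inl u) - twist y' u) zn // tu; exact: subr0.
move=> u; rewrite linearB /= del_twist opprK.
have -> : (del (base_part z) + twist (del y')) u =
    del z (inl u) - twist (shift_part z - del y') u.
  rewrite -{2}(glueK z) del_glue_inl linearB /=.
  exact: addrBKB.
apply: submoduleB => //; apply: twist_in => t; exact: hy'.
Qed.

(** The next spot of the same sequence: H(cone) -> H(Q) -> H(U), the second map being induced by h
    and of degree -1; here H(U) must be killed by m. *)
Lemma shift_homology_le n h1 h3 : homology_killed U ->
  homology_le cone n.+1 B h1 -> homology_le U n B h3 ->
  homology_le Q n.+1 B (h1 + h3).
Proof.
move=> Uk.
apply: (dim_le_exact A_local (f := @shift_part V) (g := @twist V)).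
- exact: cycles_submodule.
- exact: boundaries_submodule.
- exact: boundaries_submodule.
- exact: Uk.
- move=> x [y hy]; exists (shift_part y) => t.
  by rewrite -(del_glue_inr (base_part y)) glueK; exact: hy.
- move=> z [zn zB]; split; first exact: twist_supported.
  move=> u; rewrite del_twist; apply: submoduleN => //; exact: twist_in.
move=> z [zn zB] [y hy].
pose y' := truncate n.+1 y.
(* As y' bounds the twist of z, the pair of -y' and z is a cycle of the cone lying over z. *)
exists (glue (- y') z).
  split.
    apply: supported_glue => // u un; have := supported_truncate y un.
    by rewrite -/y' => y0; rewrite [LHS]/(- y' u) y0; exact: oppr0.
  move=> [u|t]; last by rewrite del_glue_inr; exact: zB.
  rewrite del_glue_inl linearN [X in B (X + _)]/(- del y' u) addrC.
  rewrite /y' del_truncate; case: ifPn => [_|un]; first exact: hy.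
  by rewrite (twist_supported zn) // subr0; exact: submodule0.
exists 0 => t; rewrite linear0.
have -> : (z - shift_part (glue (- y') z)) t - (0 : Q -> V) t = 0.
  by apply: etrans (subr0 _) _; exact: subrr.
exact: submodule0.
Qed.

End ConeHomology.
End Cone.

(** * Direct sums of shifted copies of G *)

Section Blocks.
Context (A : comUnitRingType) (G : complex A).
Context (L : choiceType) (ldeg : L -> nat) (letters : nat -> seq L).
Hypothesis letters_uniq : forall n, uniq (letters n).
Hypothesis mem_letters : forall n b, (b \in letters n) = (ldeg b < n)%N.

(* The direct sum over the letters b of G shifted by [ldeg b + 1]. *)
Definition blocks_deg (s : L * G) := (cdeg s.2 + (ldeg s.1).+1)%N.

(** Only letters with [ldeg b < n] are listed, for which the truncated subtraction is exact; since
    there are finitely many of them, the basis in each degree is finite even when L is infinite. *)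
Definition blocks_basis n : seq (L * G) :=
  [seq (b, s) | b <- letters n, s <- cbasis G (n - (ldeg b).+1)].

Definition blocks_d (s t : L * G) : A := if s.1 == t.1 then cd s.2 t.2 else 0.

Fact blocks_basis_uniq n : uniq (blocks_basis n).
Proof.
apply: allpairs_uniq_dep => //; first by move=> b _; exact: cbasis_uniq.
by move=> [b s] [b' s'] _ _ /= [-> ->].
Qed.

Fact mem_blocks_basis n s : (s \in blocks_basis n) = (blocks_deg s == n).
Proof.
case: s => b s; apply/allpairsPdep/eqP => /=.
  move=> [b' [s' [hb hs [-> ->]]]]; move: hb hs.
  by rewrite mem_letters mem_cbasis /blocks_deg /= => h /eqP ->; rewrite subnK.
rewrite /blocks_deg /= => <-; exists b, s; split=> //.
  by rewrite mem_letters addnS ltnS leq_addl.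
by rewrite mem_cbasis addnK.
Qed.

Fact blocks_d_deg s t : blocks_deg s != (blocks_deg t).+1 -> blocks_d s t = 0.
Proof.
rewrite /blocks_d /blocks_deg; case: (s.1 =P t.1) => [->|//].
by rewrite -addSn eqn_add2r => /cd_deg.
Qed.

Lemma sum_blocks_basis (V : zmodType) (F : L * G -> V) b n :
  (forall b' s, b' != b -> F (b', s) = 0) ->
  \sum_(s <- blocks_basis (n + (ldeg b).+1)) F s = \sum_(s <- cbasis G n) F (b, s).
Proof.
move=> F0; rewrite big_allpairs_dep /= (bigD1_seq b) //=; last first.
  by rewrite mem_letters addnS ltnS leq_addl.
rewrite addnK [X in _ + X]big1 ?addr0 // => b' b'b.
by rewrite big1 // => s _; exact: F0.
Qed.

Fact blocks_dd s u :
  \sum_(t <- blocks_basis (blocks_deg u).+1) blocks_d s t * blocks_d t u = 0.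
Proof.
case: u => b u; rewrite {1}/blocks_deg /= -addSn sum_blocks_basis => [|b' t bb].
  rewrite /blocks_d /= eqxx; case: eqP => _; first exact: cdd.
  by rewrite big1 // => t _; rewrite mul0r.
by rewrite /blocks_d /= (negbTE bb) mulr0.
Qed.

Definition blocks : complex A :=
  Complex blocks_basis_uniq mem_blocks_basis blocks_d_deg blocks_dd.

Section BlocksChains.
Context (V : lmodType A).

Definition block b (x : blocks -> V) : G -> V := fun s => x (b, s).

Lemma del_block (x : blocks -> V) b (t : G) : del (X := blocks) x (b, t) = del (block b x) t.
Proof.
transitivity (\sum_(s <- blocks_basis (cdeg t + (ldeg b).+1).+1)
    blocks_d s (b, t) *: x s); first by [].
rewrite -addSn sum_blocks_basis => [|b' s bb].
  by apply: eq_bigr => s _; rewrite /blocks_d /= eqxx.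
by rewrite /blocks_d /= (negbTE bb) scale0r.
Qed.

Lemma supported_block n (x : blocks -> V) b : supported n x ->
  supported (n - (ldeg b).+1) (block b x).
Proof.
move=> xn t tn; apply: xn; rewrite /= /blocks_deg /=.
by apply: contra tn => /eqP <-; rewrite addnK.
Qed.

Lemma block0 n (x : blocks -> V) b : supported n x -> (n <= ldeg b)%N -> block b x = 0.
Proof.
move=> xn nb; apply/funext => t; apply: xn; rewrite /= /blocks_deg /=.
by rewrite gtn_eqF // addnS ltnS (leq_trans nb) // leq_addl.
Qed.

Definition put b (x : G -> V) : blocks -> V := fun s => if s.1 == b then x s.2 else 0.

Lemma put_linear b : linear (put b).
Proof.
move=> a x y; apply/funext => s; rewrite [RHS]/(a *: put b x s + put b y s) /put.
by case: ifP => // _; rewrite scaler0; apply/esym/addr0.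
Qed.
HB.instance Definition _ b := GRing.isLinear.Build A (G -> V) (blocks -> V) *:%R
  (put b) (put_linear b).

Lemma block_linear b : linear (block b).
Proof. by []. Qed.
HB.instance Definition _ b := GRing.isLinear.Build A (blocks -> V) (G -> V) *:%R
  (block b) (block_linear b).

Lemma block_put b x : block b (put b x) = x.
Proof. by apply/funext => s; rewrite /block /put eqxx. Qed.

Lemma block_put_neq b b' x : b' != b -> block b' (put b x) = 0.
Proof. by move=> bb; apply/funext => s; rewrite /block /put /= (negbTE bb). Qed.

Lemma blocks_boundaries (B : set V) (x : blocks -> V) : is_submodule B ->
  boundaries B x <-> forall b, boundaries B (block b x).
Proof.
move=> Bs; split=> [[y hy] b|/choice[y hy]].
  by exists (block b y) => t; rewrite -del_block; exact: (hy (b, t)).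
by exists (fun s => y s.1 s.2) => -[b t]; rewrite del_block; exact: hy.
Qed.

Lemma blocks_cycle (B : set V) n (x : blocks -> V) b :
  cycles n B x -> cycles (n - (ldeg b).+1) B (block b x).
Proof.
move=> [xn xB]; split; first exact: supported_block.
by move=> t; rewrite -del_block.
Qed.

Lemma put_cycle (B : set V) n b (x : G -> V) : is_submodule B -> (ldeg b < n)%N ->
  cycles (n - (ldeg b).+1) B x -> cycles n B (put b x).
Proof.
move=> Bs bn [xn xB]; split.
  move=> [b' t]; rewrite /= /blocks_deg /put /=.
  case: (b' =P b) => [->|//] tn; apply: xn; apply: contra tn => /eqP ->.
  by rewrite subnK.
move=> [b' t]; rewrite del_block; have [->|bb] := eqVneq b' b.
  by rewrite block_put.
rewrite block_put_neq //; have -> : del (0 : G -> V) t = 0 by rewrite linear0.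
exact: submodule0.
Qed.

End BlocksChains.

Lemma blocks_killed : homology_killed G -> homology_killed blocks.
Proof.
move=> Gk V B n Bs a x am xc; apply/blocks_boundaries => // b.
have -> : block b (a *: x) = a *: block b x by [].
by apply: Gk (blocks_cycle b xc).
Qed.

Section BlocksHomology.
Context (A_local : local_ring A) (G_killed : homology_killed G).
Context (V : lmodType A) (B : set V) (B_sub : is_submodule B) (n : nat).

(** A filtration of the cycles by the letters on which they live, so that homology can be counted
    one block at a time. *)
Definition block_cycles (s : seq L) : set (blocks -> V) :=
  [set x | cycles n B x /\ forall b, b \notin s -> block b x = 0].

Lemma block_cycles_submodule s : is_submodule (block_cycles s).
Proof.
have cs := @cycles_submodule A blocks V B B_sub n.
split=> [|x y [xc xs] [yc ys]|a x [xc xs]].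
- by split=> //; exact: submodule0.
- split; first exact: submoduleD.
  move=> b bs; rewrite (linearD (block b)) /= xs // ys //; exact: addr0.
- split; first exact: submoduleZ.
  by move=> b bs; rewrite (linearZ_LR (block b)) /= xs //; exact: scaler0.
Qed.

Lemma block_cycles_letters : block_cycles (letters n) = cycles n B.
Proof.
apply/seteqP; split=> [x []//|x xc]; split=> // b.
by rewrite mem_letters -leqNgt; apply: block0; case: xc.
Qed.

Lemma blocks_homology_le (h : nat -> nat) : (forall m, homology_le G m B (h m)) ->
  homology_le blocks n B (\sum_(b <- letters n) h (n - (ldeg b).+1)).
Proof.
move=> hG; rewrite /homology_le -block_cycles_letters.
elim: (letters n) => [|b s IH].
  rewrite big_nil; apply: dim_le0; first exact: boundaries_submodule.
  move=> x [_ x0]; apply/blocks_boundaries => // b; rewrite x0 //.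
  by apply: submodule0; exact: boundaries_submodule.
rewrite big_cons addnC.
apply: (dim_le_exact A_local (f := idfun) (g := block b) _ _ _ _ _ _ _ IH (hG _)).
- exact: block_cycles_submodule.
- exact: boundaries_submodule.
- exact: boundaries_submodule.
- exact: G_killed.
- by [].
- by move=> z [zc _]; exact: blocks_cycle.
move=> z [zc zs] zb; exists (z - put b (block b z)); last first.
  rewrite /= subKr; apply/blocks_boundaries => // b'.
  have [->|bb] := eqVneq b' b; first by rewrite block_put.
  by rewrite block_put_neq //; apply: submodule0; exact: boundaries_submodule.
have [bn|nb] := ltnP (ldeg b) n; last first.
  have b0 : block b z = 0 by apply: block0 nb; case: zc.
  rewrite b0 linear0 subr0; split=> // b' b's.
  have [-> //|bb] := eqVneq b' b.
  by apply: zs; rewrite inE negb_or bb.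
split.
  apply: submoduleB; [exact: cycles_submodule|by []|].
  by apply: put_cycle => //; exact: blocks_cycle.
move=> b' b's; rewrite (linearB (block b')) /=.
have [->|bb] := eqVneq b' b; first by rewrite block_put subrr.
rewrite block_put_neq // subr0; apply: zs; rewrite inE negb_or bb; exact: b's.
Qed.

Lemma blocks_indep (h : nat -> nat) :
  (forall m, indep (cycles m B) (boundaries (X := G) B) (h m)) ->
  indep (cycles (X := blocks) n B) (boundaries B)
    (\sum_(b <- letters n) h (n - (ldeg b).+1)).
Proof.
move=> hG; rewrite -block_cycles_letters.
have : forall b, b \in letters n -> (ldeg b < n)%N by move=> b; rewrite mem_letters.
have := letters_uniq n.
elim: (letters n) => [_ _|b s IH /= /andP[bs us] hs]; first by rewrite big_nil; exact: indep0.
rewrite big_cons.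
have [b' b's|z [zc zB]] := IH us; first by apply: hs; rewrite inE b's orbT.
have bn : (ldeg b < n)%N by apply: hs; rewrite mem_head.
have [y [yc yB]] := hG (n - (ldeg b).+1)%N.
set m2 := h _ in y yc yB *; set m1 := \sum_(_ <- _) _ in z zc zB *.
have -> : (m2 + m1)%N = #|{: 'I_m2 + 'I_m1}| by rewrite card_sum !card_ord.
apply: (indep_fin (z := fun i => match i with inl i => put b (y i) | inr i => z i end)).
  move=> [i|i]; last first.
    have [zi z0] := zc i; split=> // b'; rewrite inE negb_or => /andP[_]; exact: z0.
  split; first exact: put_cycle.
  by move=> b'; rewrite inE negb_or => /andP[bb _]; rewrite block_put_neq.
move=> c; rewrite big_sumType /=.
have -> : \sum_(i < m2) c (inl i) *: put b (y i) =
    put b (\sum_(i < m2) c (inl i) *: y i).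
  by rewrite linear_sum; apply: eq_bigr => i _; rewrite linearZ.
set Y := \sum_(i < m2) _; set Z := \sum_(i < m1) _ => YZ.
have Zs : block_cycles s Z.
  apply: submodule_sum => [|i _]; first exact: block_cycles_submodule.
  by apply: submoduleZ => //; exact: block_cycles_submodule.
have Yb : boundaries B Y.
  have /(blocks_boundaries _ B_sub)/(_ b) := YZ.
  by rewrite (linearD (block b)) /= block_put (Zs.2 b bs) addr0.
have Zb : boundaries (X := blocks) B Z.
  rewrite -(addKr (put b Y) Z) addrC; apply: submoduleB => //.
    exact: boundaries_submodule.
  apply/blocks_boundaries => // b'; have [->|bb] := eqVneq b' b.
    by rewrite block_put.
  by rewrite block_put_neq //; apply: submodule0; exact: boundaries_submodule.
by move=> [i|i]; [exact: yB Yb i|exact: zB Zb i].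
Qed.

End BlocksHomology.
End Blocks.

Lemma del_supported0 (A : comUnitRingType) (X : complex A) (V : lmodType A) (x : X -> V) :
  supported 0 x -> del x = 0.
Proof.
move=> x0; apply/funext => t; rewrite /del big_seq big1 // => s.
by rewrite mem_cbasis => /eqP st; rewrite x0 ?scaler0 // st.
Qed.

(** * The cone of the maps g_b is a resolution of the residue field *)

Section KoszulDual.
Context (A : comUnitRingType) (A_local : local_ring A).
Context (U G : complex A) (alU : U -> A) (alG : G -> A).
Context (G_res : resolves_residue alG).
Context (L : choiceType) (ldeg : L -> nat) (letters : nat -> seq L).
Hypothesis letters_uniq : forall n, uniq (letters n).
Hypothesis mem_letters : forall n b, (b \in letters n) = (ldeg b < n)%N.
Hypothesis ldeg_gt0 : forall b, (0 < ldeg b)%N.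
Context (z : L -> U -> A^o) (g : L -> G -> U -> A).
Hypothesis z_supported : forall b, supported (ldeg b) (z b).
Hypothesis g_deg : forall b s u, cdeg u != (cdeg s + ldeg b)%N -> g b s u = 0.
Hypothesis g_d : forall b s u, \sum_(v <- cbasis U (cdeg u).+1) g b s v * cd v u +
  \sum_(t <- cbasis G (cdeg u - ldeg b)) cd s t * g b t u = 0.
Hypothesis g_0 : forall b s u, cdeg s = 0 -> g b s u = alG s * z b u.
Hypothesis U_exact0 : forall x : U -> A^o, supported 0 x ->
    (maximal_ideal (\sum_(t <- cbasis U 0) alU t * x t) <-> exists y, x = del y).
Hypothesis U_unit : exists2 x : U -> A^o, supported 0 x &
    \sum_(t <- cbasis U 0) alU t * x t = 1.
Hypothesis U_gen : forall n (x : U -> A^o), supported n.+1 x -> del x = 0 ->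
  exists (c : L -> A) y,
    x = \sum_(b <- letters n.+2 | ldeg b == n.+1) c b *: z b + del y.
Hypothesis U_ind : forall n (c : L -> A) (y : U -> A^o),
  \sum_(b <- letters n.+1 | ldeg b == n) c b *: z b = del y ->
  forall b, ldeg b = n -> maximal_ideal (c b).

Let Q := blocks G letters_uniq mem_letters.

Let h (s : Q) (u : U) : A := g s.1 s.2 u.

Fact kd_deg (s : Q) u : cdeg s != (cdeg u).+1 -> h s u = 0.
Proof.
move=> su; apply: g_deg; apply: contra su => /eqP ->.
by rewrite /= /blocks_deg addnS.
Qed.

Fact kd_d (s : Q) u :
  \sum_(v <- cbasis U (cdeg u).+1) h s v * cd v u +
  \sum_(t <- cbasis Q (cdeg u).+1) cd s t * h t u = 0.
Proof.
case: s => b s; rewrite -[RHS](g_d b s u); congr (_ + _).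
have [bu|ub] := leqP (ldeg b) (cdeg u).
  rewrite -{1}(subnK bu) -addnS /= (sum_blocks_basis letters_uniq mem_letters) => [//|b' t bb].
    by apply: eq_bigr => t _; rewrite /blocks_d /= eqxx.
  by rewrite /blocks_d /= eq_sym (negbTE bb) mul0r.
(* When [cdeg u < ldeg b] both sums vanish: the truncated difference points to degree 0 of G, where
   g is zero for degree reasons, and block b has no element of degree [(cdeg u).+1]. *)
rewrite !big1_seq //.
- move=> t /andP[_]; rewrite mem_cbasis => /eqP tu; rewrite g_deg ?mulr0 // tu.
  by rewrite neq_ltn (leq_trans ub) ?leq_addl.
- move=> [b' t] /andP[_]; rewrite mem_cbasis /= /blocks_deg /= addnS eqSS => /eqP tu.
  rewrite /blocks_d /=; case: eqP => [bb|_]; last by rewrite mul0r.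
  by move: ub; rewrite bb -tu ltnNge leq_addl.
Qed.

Definition kd_cone := cone kd_deg kd_d.
Local Notation Y := kd_cone.

(** On the bottom degree of block b the map g is the augmentation of G times z b. Only the
    augmentations of the bottom parts of q survive. *)
Lemma twist_bottom n (q : Q -> A^o) : supported n.+1 q ->
  (forall b, ldeg b != n -> block b q = 0) ->
  twist h q = \sum_(b <- letters n.+1 | ldeg b == n)
    (\sum_(s <- cbasis G 0) alG s * (q (b, s) : A)) *: z b.
Proof.
move=> qn q0; apply/funext => u; rewrite fct_sumE.
have [un|un] := eqVneq (cdeg u) n; last first.
  rewrite (@twist_supported _ _ _ h _ n q qn) // big1 // => b /eqP bn.
  have zu : z b u = 0 by apply: z_supported; rewrite bn.
  by rewrite [LHS]/(_ *: z b u) zu; exact: scaler0.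
rewrite /twist un [cbasis Q _]/(blocks_basis G ldeg letters n.+1).
rewrite big_allpairs_dep /= [RHS]big_mkcond /=; apply: eq_bigr => b _.
case: eqP => [bn|/eqP bn]; last first.
  by rewrite big1 // => s _; have /(congr1 (@^~ s)) := q0 b bn; rewrite /block => ->; rewrite scaler0.
rewrite bn subnn.
transitivity ((\sum_(s <- cbasis G 0) alG s * (q (b, s) : A)) * (z b u : A)); last by [].
rewrite mulr_suml; apply: eq_big_seq => s.
rewrite mem_cbasis => /eqP s0; rewrite /h /= g_0 // [LHS]/(_ * _).
by rewrite mulrAC.
Qed.

Lemma del_cone_eq0 n (x : Y -> A^o) : supported n.+1 x -> del x = 0 ->
  del (base_part x) + twist h (shift_part x) = 0 /\ del (shift_part x) = 0.
Proof.
move=> _ dx; split; apply/funext => u.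
  by have /(congr1 (@^~ (inl u))) := dx; rewrite -{1}(glueK x) del_glue_inl.
by have /(congr1 (@^~ (inr u))) := dx; rewrite -{1}(glueK x) del_glue_inr.
Qed.

(** A cycle without Q-part is a cycle of U, hence a combination of the z b plus a boundary; the
    element c b times a bottom chain of augmentation 1 in block b has the term of z b as its
    differential. *)
Lemma cone_exact_base n (x : Y -> A^o) : supported n.+1 x -> del x = 0 ->
  shift_part x = 0 -> exists y, x = del y.
Proof.
move=> xn dx xQ; have [dU _] := del_cone_eq0 xn dx.
have xU : supported n.+1 (base_part x) by move=> u un; exact: xn.
have dU0 : del (base_part x) = 0 by move: dU; rewrite xQ linear0 addr0.
have [c [y3 xy]] := U_gen xU dU0.
have [e e0 e1] := rr_unit G_res.
pose q : Q -> A^o := fun s => if ldeg s.1 == n.+1 then c s.1 * (e s.2 : A) else 0.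
have qn : supported n.+2 q.
  move=> [b s]; rewrite /q /= /blocks_deg /=; case: (ldeg b =P n.+1) => // ->.
  by rewrite -{2}[n.+2]add0n eqn_add2r => /e0 ->; rewrite mulr0.
have q0 b : ldeg b != n.+1 -> block b q = 0.
  by move=> bn; apply/funext => s; rewrite /block /q /= (negbTE bn).
have tq : twist h q = \sum_(b <- letters n.+2 | ldeg b == n.+1) c b *: z b.
  rewrite (twist_bottom qn q0); apply: eq_bigr => b bn; congr (_ *: _).
  rewrite -[RHS]mulr1 -e1 mulr_sumr; apply: eq_bigr => s _.
  by rewrite /q /= bn mulrCA.
have dq : del q = 0.
  apply/funext => -[b t]; rewrite del_block.
  have -> : block b q = (if ldeg b == n.+1 then c b else 0) *: e.
    apply/funext => s; rewrite /block /q /=; case: ifP => // _.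
    by rewrite scale0r.
  by rewrite linearZ /= (del_supported0 e0) scaler0.
exists (glue y3 q); apply/funext => -[u|t].
  rewrite del_glue_inl tq -[LHS]/(base_part x u) xy addrC; reflexivity.
by rewrite del_glue_inr dq -[LHS]/(shift_part x t) xQ.
Qed.

Lemma cone_exact_sub n (x : Y -> A^o) (y : Q -> A^o) : supported n.+1 x -> del x = 0 ->
  let x' := x - del (glue 0 (truncate n.+2 y) : Y -> A^o) in
  [/\ supported n.+1 x', del x' = 0,
    forall b t, (blocks_deg ldeg (b, t) == n.+1) ->
      shift_part x' (b, t) = shift_part x (b, t) - del (block b y) t &
    (exists w, x' = del w) -> exists w, x = del w].
Proof.
move=> xn dx x'; split.
- move=> t tn; rewrite [LHS]/(x t - del _ t) xn //.
  rewrite (del_supported (n := n.+1)) //; first exact: subr0.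
  by apply: supported_glue; [by []|exact: supported_truncate].
- by rewrite linearB /= dx del_del subr0.
- move=> b t bt; rewrite [LHS]/(x (inr (b, t)) - del _ _) del_glue_inr.
  by rewrite del_truncate /= bt del_block.
- move=> [w xw]; exists (w + glue 0 (truncate n.+2 y)).
  by rewrite linearD /= -xw subrK.
Qed.

(** The U-part of x shows that the combination of the z b with the augmentations of the bottom parts
    as coefficients is a boundary. Minimality puts these augmentations in m, so the bottom parts are
    boundaries in G and can be subtracted. *)
Lemma cone_exact_bottom n (x : Y -> A^o) : supported n.+1 x -> del x = 0 ->
  (forall b, ldeg b != n -> block b (shift_part x) = 0) -> exists y, x = del y.
Proof.
move=> xn dx x0; have [dU dQ] := del_cone_eq0 xn dx.
have qn : supported n.+1 (shift_part x) by move=> t tn; exact: xn.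
have cm b : ldeg b = n ->
    maximal_ideal (\sum_(s <- cbasis G 0) alG s * (shift_part x (b, s) : A)).
  apply: (@U_ind n (fun b => \sum_(s <- cbasis G 0) alG s * (shift_part x (b, s) : A))
    (- base_part x)).
  rewrite -(twist_bottom qn x0) linearN; apply/eqP.
  by rewrite -addr_eq0 addrC dU.
have /choice[y hy] : forall b, exists y, ldeg b = n -> block b (shift_part x) = del y.
  move=> b; have [bn|] := pselect (ldeg b = n); last by exists 0.
  have b0 : supported 0 (block b (shift_part x)).
    by have := supported_block (b := b) qn; rewrite bn subnn.
  have [y hy] := (rr_exact0 G_res b0).1 (cm b bn).
  by exists y.
have /= [] := cone_exact_sub (fun s => if ldeg s.1 == n then y s.1 s.2 else 0) xn dx.
set x' := x - _ => x'n dx' x'E.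
apply; apply: (cone_exact_base x'n dx').
apply/funext => -[b t].
have [bt|bt] := boolP (blocks_deg ldeg (b, t) == n.+1); last exact: x'n.
rewrite x'E //; have [bn|bn] := eqVneq (ldeg b) n.
  have -> : block b (fun s : Q => if ldeg s.1 == n then y s.1 s.2 else 0) = y b :> (G -> A^o).
    by apply/funext => s; rewrite /block /= bn eqxx.
  by rewrite -hy //; exact: subrr.
have -> : block b (fun s : Q => if ldeg s.1 == n then y s.1 s.2 else 0) = 0 :> (G -> A^o).
  by apply/funext => s; rewrite /block /= (negbTE bn).
have -> : shift_part x (b, t) = 0 by have /(congr1 (@^~ t)) := x0 b bn.
by rewrite linear0; exact: subr0.
Qed.

(** In a block with [ldeg b < n] the Q-part sits in positive degree of G and is a boundary; with
    [n < ldeg b] it is zero. Only the bottom blocks [ldeg b = n] remain. *)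
Lemma cone_exact n (x : Y -> A^o) : supported n.+1 x -> del x = 0 -> exists y, x = del y.
Proof.
move=> xn dx; have [dU dQ] := del_cone_eq0 xn dx.
have qn : supported n.+1 (shift_part x) by move=> t tn; exact: xn.
have /choice[y hy] : forall b, exists y, ldeg b != n -> block b (shift_part x) = del y.
  move=> b; have [bn|bn|bn] := ltngtP (ldeg b) n.
  - have := supported_block (b := b) qn; rewrite subSS -[(n - _)%N]prednK ?subn_gt0 // => bx.
    have [|y hy] := rr_exact G_res bx; last by exists y.
    by apply/funext => t; rewrite -del_block dQ.
  - by exists 0 => _; rewrite linear0; exact: block0 qn bn.
  - by exists 0.
have /= [] := cone_exact_sub (fun s => y s.1 s.2) xn dx.
set x' := x - _ => x'n dx' x'E.
apply; apply: (cone_exact_bottom x'n dx') => b bn; apply/funext => t.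
have [bt|bt] := boolP (blocks_deg ldeg (b, t) == n.+1); last exact: x'n.
rewrite [LHS]x'E // -[block b _]/(y b) -hy //; exact: subrr.
Qed.

Definition kd_aug (s : Y) : A := match s with inl u => alU u | inr _ => 0 end.

Lemma kd_resolves : resolves_residue kd_aug.
Proof.
have sumU (x : Y -> A^o) : \sum_(t <- cbasis Y 0) kd_aug t * x t =
    \sum_(t <- cbasis U 0) alU t * base_part x t.
  rewrite big_cat !big_map /= [X in _ + X]big1 ?addr0 // => t _.
  by rewrite mul0r.
split; first exact: cone_exact.
- move=> x x0; rewrite sumU.
  have xU0 : supported 0 (base_part x) by move=> u; exact: (x0 (inl u)).
  rewrite (U_exact0 xU0); split=> [[y hy]|[y hy]].
    exists (glue y 0); apply/funext => -[u|t].
      by rewrite del_glue_inl linear0 -[LHS]/(base_part x u) hy; exact/esym/addr0.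
    rewrite del_glue_inr linear0; transitivity (0 : A^o); last by [].
    apply: (x0 (inr t)).
    by rewrite /= /blocks_deg addnS.
  exists (truncate 1 (base_part y)); apply/funext => u; rewrite del_truncate.
  case: eqP => [u0|/eqP]; last exact: xU0.
  rewrite /base_part hy -{1}(glueK y) del_glue_inl /twist u0.
  (* Letters have positive degree, so no g b reaches degree 0 of U: at the augmentation the cone
     looks like U. *)
  rewrite [X in _ + X]big1 => [|t _]; first exact: addr0.
  by rewrite /h g_deg ?scale0r // u0 eq_sym addn_eq0 negb_and -!lt0n ldeg_gt0 orbT.
- have [x x0 x1] := U_unit; exists (glue x 0); last by rewrite sumU.
  exact: supported_glue.
Qed.

Section Inequalities.
Context (k : fieldType) (pi : {rmorphism A -> k}) (k_residue : residue_field pi).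
Context (M : lmodType A) (F : free_resolution M).
Context (U_killed : homology_killed U) (G_killed : homology_killed G).
Context (e : nat -> nat).
Hypothesis U_le : forall n, homology_le U n (@syz_relations A M F 0) (e n).

Lemma betti_homology_le (X : complex A) al n : resolves_residue (X := X) al ->
  homology_le X n (@syz_relations A M F 0) (betti pi F n).
Proof. by move=> Xr m /(homology_betti k_residue F Xr). Qed.

(** The cone and G both resolve k, so the outer terms of U -> cone -> Q are known: H(cone (x) M) has
    dimension betti, and H(Q (x) M) is a sum of shifted bettis. *)
Lemma betti_upper n :
  (betti pi F n <= e n + \sum_(b <- letters n) betti pi F (n - (ldeg b).+1))%N.
Proof.
have : indep (cycles (X := Y) n (@syz_relations A M F 0)) (boundaries (@syz_relations A M F 0)) (betti pi F n).
  exact/(homology_betti k_residue F kd_resolves).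
apply: cone_homology_le => //.
- exact: syz_relations_submodule.
- exact: blocks_killed.
apply: blocks_homology_le => //; first exact: syz_relations_submodule.
by move=> m; exact: betti_homology_le G_res.
Qed.

(** In degree n + 1 of Q the shift [(ldeg b).+1] leaves degree [n - ldeg b] of G; the connecting map
    then lands in degree n of U, whence the bound [e n]. *)
Lemma betti_lower n :
  (\sum_(b <- letters n.+1) betti pi F (n - ldeg b) <= betti pi F n.+1 + e n)%N.
Proof.
have : indep (cycles (X := Q) n.+1 (@syz_relations A M F 0)) (boundaries (@syz_relations A M F 0))
    (\sum_(b <- letters n.+1) betti pi F (n.+1 - (ldeg b).+1)).
  apply: blocks_indep => //; first exact: syz_relations_submodule.
  by move=> m; exact/(homology_betti k_residue F G_res).
apply: (shift_homology_le (h_deg := kd_deg) (h_d := kd_d)) => //.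
- exact: syz_relations_submodule.
- exact: betti_homology_le kd_resolves.
Qed.

End Inequalities.
End KoszulDual.

(** * Growth of sequences *)

Section Growth.
Context (R : realType).
Implicit Types (x y a e : nat -> nat) (r : R).

Definition growth x : \bar R := limn_esup (fun n => (((x n)%:R : R) `^ (n%:R^-1))%:E).

Definition bounded_by x r := exists C : R, 0 <= C /\ forall n, (x n)%:R <= C * r ^+ n.

Definition subexponential x := forall r, 1 < r -> bounded_by x r.

Lemma root_le x r n : 0 <= r -> (0 < n)%N ->
  ((x n)%:R `^ (n%:R^-1) <= r) = ((x n)%:R <= r ^+ n).
Proof.
move=> r0 n0; have nR : (n%:R : R) != 0 by rewrite pnatr_eq0 -lt0n.
have rn : r = (r ^+ n) `^ n%:R^-1.
  by rewrite -powR_mulrn // -powRrM mulfV // powRr1.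
apply/idP/idP => h; last first.
  by rewrite rn; apply: ge0_ler_powR => //; rewrite ?invr_ge0 ?nnegrE ?exprn_ge0.
have -> : (x n)%:R = ((x n)%:R `^ n%:R^-1) ^+ n :> R.
  by rewrite -powR_mulrn ?powR_ge0 // -powRrM mulVf // powRr1.
by rewrite lerXn2r // nnegrE ?powR_ge0.
Qed.

Lemma growth_le x (l : \bar R) N :
  (forall n, (N <= n)%N -> (((x n)%:R `^ (n%:R^-1))%:E <= l)%E) -> (growth x <= l)%E.
Proof.
move=> h; apply: (@le_trans _ _ (ereal_sup
    [set (((x n)%:R : R) `^ (n%:R^-1))%:E | n in [set n | (N <= n)%N]])).
  apply: ereal_inf_lbound; exists [set n | (N <= n)%N] => //.
  by exists N.
by apply: ge_ereal_sup => _ [n nN <-]; exact: h.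
Qed.

Lemma growth_lt x (l : \bar R) : (growth x < l)%E -> exists N, forall n, (N <= n)%N ->
  (((x n)%:R `^ (n%:R^-1))%:E < l)%E.
Proof.
move=> /ereal_inf_lt[_ [V [N _ NV] <-] Vl]; exists N => n Nn.
by apply: le_lt_trans Vl; apply: ereal_sup_ubound; exists n => //; exact: NV.
Qed.

Lemma growth_ge0 x : (0 <= growth x)%E.
Proof.
rewrite leNgt; apply/negP => /growth_lt[N /(_ N (leqnn _))].
by rewrite lte_fin ltNge powR_ge0.
Qed.

Lemma growth_bounded x r : 0 < r -> (growth x < r%:E)%E -> bounded_by x r.
Proof.
move=> r0 /growth_lt[N hN].
(* The sum covers the indices up to N, where nothing is known; the 1 covers the later ones, where
   the root is below r. *)
exists (1 + \sum_(i < N.+1) (x i)%:R / r ^+ i); split.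
  by rewrite addr_ge0 // sumr_ge0 // => i _; rewrite divr_ge0 // exprn_ge0 // ltW.
move=> n; have rn : 0 < r ^+ n by rewrite exprn_gt0.
rewrite -ler_pdivrMr //; have [nN|Nn] := ltnP n N.+1.
  rewrite (bigD1 (Ordinal nN)) //= addrCA lerDl addr_ge0 // sumr_ge0 // => i _.
  by rewrite divr_ge0 // exprn_ge0 // ltW.
apply: (@le_trans _ _ 1); last first.
  by rewrite lerDl sumr_ge0 // => i _; rewrite divr_ge0 // exprn_ge0 // ltW.
rewrite ler_pdivrMr // mul1r -root_le ?(ltW r0) ?(leq_trans _ Nn) //.
by apply: ltW; have := hN n (ltnW Nn); rewrite lte_fin.
Qed.

Lemma bernoulli_ineq r n : 1 <= r -> 1 + n%:R * (r - 1) <= r ^+ n.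
Proof.
move=> r1; elim: n => [|n IH]; first by rewrite mul0r addr0 expr0.
rewrite exprS -natr1; apply: (@le_trans _ _ (r * (1 + n%:R * (r - 1)))).
  rewrite -subr_ge0.
  have -> : r * (1 + n%:R * (r - 1)) - (1 + (n%:R + 1) * (r - 1)) =
    n%:R * (r - 1) ^+ 2 by ring.
  by rewrite mulr_ge0 // sqr_ge0.
by rewrite ler_wpM2l // (le_trans _ r1).
Qed.

Lemma expr_unbounded r (C : R) : 1 < r -> exists n, C < r ^+ n.
Proof.
move=> r1; have r10 : 0 < r - 1 by rewrite subr_gt0.
exists (Num.bound (`|C| / (r - 1))).
have h : `|C| / (r - 1) < (Num.bound (`|C| / (r - 1)))%:R.
  by apply: archi_boundP; rewrite divr_ge0 // ltW.
apply: lt_le_trans (bernoulli_ineq _ (ltW r1)).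
rewrite ltr_pdivrMr // in h; apply: le_lt_trans (ler_norm C) _.
by rewrite (lt_trans h) // ltrDr.
Qed.

(** For d > 0 the constant C is eventually below ((r + d) / r)^n, hence absorbed by enlarging r to r
    + d. *)
Lemma bounded_growth x r : 0 < r -> bounded_by x r -> (growth x <= r%:E)%E.
Proof.
move=> r0 [C [C0 hC]]; apply/lee_addgt0Pr => d d0.
have rd : 0 < r + d by rewrite addr_gt0.
have q1 : 1 < (r + d) / r by rewrite ltr_pdivlMr // mul1r ltrDl.
have [N hN] := expr_unbounded C q1.
apply: (growth_le (N := N.+1)) => n Nn.
rewrite -EFinD lee_fin root_le ?(ltW rd) ?(leq_trans _ Nn) //.
apply: le_trans (hC n) _.
rewrite -ler_pdivlMr ?exprn_gt0 // -expr_div_n.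
by apply: (le_trans (ltW hN)); rewrite ler_eXn2l // ltnW.
Qed.

(** The values are natural numbers: either they vanish from some index on, or infinitely many n-th
    roots are at least 1. *)
Lemma growth_dichotomy x : growth x = 0%:E \/ (1%:E <= growth x)%E.
Proof.
have [[N hN]|inf] := pselect (exists N, forall n, (N <= n)%N -> x n = 0).
  left; apply/eqP; rewrite eq_le growth_ge0 andbT.
  apply: (growth_le (N := N.+1)) => n Nn.
  have n0 : (n%:R : R)^-1 != 0 by rewrite invr_eq0 pnatr_eq0 -lt0n (leq_trans _ Nn).
  have -> : x n = 0 by apply: hN; exact: ltnW.
  by rewrite powR0.
right; rewrite leNgt; apply/negP => /growth_lt[N hN]; apply: inf.
exists N.+1 => n Nn; have := hN n (ltnW Nn); rewrite lte_fin ltNge => /negP h.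
apply/eqP; rewrite -leqn0 leqNgt; apply/negP => xn; apply: h.
apply: (@le_trans _ _ (1 `^ n%:R^-1)); first by rewrite powR1.
apply: ge0_ler_powR; rewrite ?nnegrE ?invr_ge0 //.
by rewrite ler1n.
Qed.

Lemma bounded_byW x r r' : 0 <= r -> r <= r' -> bounded_by x r -> bounded_by x r'.
Proof.
move=> r0 rr [C [C0 hC]]; exists C; split=> // n; apply: le_trans (hC n) _.
by rewrite ler_wpM2l // lerXn2r // nnegrE // (le_trans r0).
Qed.

Lemma subexponential_growth x : subexponential x -> (growth x <= 1%:E)%E.
Proof.
move=> sx; apply/lee_addgt0Pr => d d0; rewrite -EFinD.
by apply: bounded_growth; rewrite ?addr_gt0 //; apply: sx; rewrite ltrDl.
Qed.

Lemma ereal_between (u v : \bar R) : (0 <= u)%E -> (u < v)%E ->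
  exists r, ((u < r%:E) && (r%:E < v))%E.
Proof.
case: u => [s| |] //; case: v => [t| |] // _ st.
  by exists ((s + t) / 2); rewrite !lte_fin in st *; rewrite midf_lt // midf_lt.
by exists (s + 1); rewrite lte_fin ltrDl ltr01 ltry.
Qed.

Lemma growth_mono x y C : (forall n, (x n <= C * y n)%N) -> (growth x <= growth y)%E.
Proof.
move=> xy; rewrite leNgt; apply/negP => yx.
have [r /andP[yr rx]] := ereal_between (growth_ge0 y) yx.
have r0 : 0 < r by rewrite -lte_fin (le_lt_trans (growth_ge0 y)).
have [D [D0 hD]] := growth_bounded r0 yr.
move: rx; apply/negP; rewrite -leNgt; apply: bounded_growth => //.
exists (C%:R * D); split; first by rewrite mulr_ge0.
move=> n; rewrite -mulrA (le_trans _ (ler_wpM2l (ler0n R C) (hD n))) //.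
by rewrite -natrM ler_nat.
Qed.

Lemma subexponentialM x y : subexponential x -> subexponential y ->
  subexponential (fun n => x n * y n)%N.
Proof.
(* Each factor is bounded at the radius [Num.sqrt r], so that the product is bounded at r. *)
move=> sx sy r r1; have s1 : 1 < Num.sqrt r by rewrite -[X in X < _]sqrtr1 ltr_sqrt // (lt_trans ltr01).
have [C [C0 hC]] := sx _ s1; have [D [D0 hD]] := sy _ s1.
exists (C * D); split; first exact: mulr_ge0.
move=> n; rewrite natrM -[X in X ^+ n]sqr_sqrtr ?(le_trans ler01 (ltW r1)) //.
by rewrite expr2 exprMn mulrACA ler_pM.
Qed.

Lemma subexponential_poly v : subexponential (fun n => n.+1 ^ v)%N.
Proof.
elim: v => [|v IH].
  move=> r r1; exists 1; split=> // n; rewrite expn0 mul1r.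
  by rewrite exprn_ege1 // ltW.
have -> : (fun n => n.+1 ^ v.+1)%N = (fun n => n.+1 * n.+1 ^ v)%N.
  by apply/funext => n; rewrite expnS.
apply: subexponentialM => // r r1.
have r10 : 0 < r - 1 by rewrite subr_gt0.
(* By Bernoulli's inequality n (r - 1) is at most r^n, and 1 is at most r^n. *)
exists (1 + (r - 1)^-1); split; first by rewrite addr_ge0 // invr_ge0 ltW.
move=> n; have := bernoulli_ineq n (ltW r1) => h.
have h1 : 1 <= r ^+ n by rewrite exprn_ege1 // ltW.
rewrite -natr1 addrC mulrDl mul1r lerD // mulrC ler_pdivlMr //.
by apply: le_trans h; rewrite lerDr.
Qed.

Lemma subexponential_le x y C : (forall n, (x n <= C * y n)%N) ->
  subexponential y -> subexponential x.
Proof.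
move=> xy sy r r1; have [D [D0 hD]] := sy r r1.
exists (C%:R * D); split; first by rewrite mulr_ge0.
move=> n; rewrite -mulrA (le_trans _ (ler_wpM2l (ler0n R C) (hD n))) //.
by rewrite -natrM ler_nat.
Qed.

Section Recurrence.
Context (x y a ex ey : nat -> nat).
Hypothesis ex_sub : subexponential ex.
Hypothesis ey_sub : subexponential ey.
Hypothesis x_lower : forall n,
  (\sum_(i < n.+1) a i * x (n - i) <= x n.+1 + ex n)%N.
Hypothesis y_upper : forall n,
  (y n <= ey n + \sum_(i < n) a i * y (n - i.+1))%N.

Let partial r L := \sum_(i < L) (a i)%:R / r ^+ i.+1.

(** Moving from r to r1 multiplies each term of the series by a positive power of s = r / r1, so its
    partial sums drop to at most s < 1. The constant K solves C + K s = K and is therefore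
    reproduced by the recurrence. *)
Lemma upper_bounded r r1 : 1 < r -> r < r1 -> (forall L, partial r L <= 1) ->
  bounded_by y r1.
Proof.
move=> r_gt1 rr1 hp; have r_gt0 : 0 < r := lt_trans ltr01 r_gt1.
have r1_gt0 : 0 < r1 := lt_trans r_gt0 rr1.
pose s := r / r1; have s1 : 0 < 1 - s by rewrite subr_gt0 ltr_pdivrMr // mul1r.
have s0 : 0 < s by rewrite divr_gt0.
have hp1 L : partial r1 L <= s.
  apply: (@le_trans _ _ (s * partial r L)); last by rewrite ler_piMr // ltW.
  rewrite /partial mulr_sumr; apply: ler_sum => i _.
  have -> : (a i)%:R / r1 ^+ i.+1 = s ^+ i.+1 * ((a i)%:R / r ^+ i.+1) :> R.
    by rewrite /s expr_div_n; field; rewrite !lt0r_neq0 ?exprn_gt0.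
  rewrite ler_wpM2r ?divr_ge0 ?exprn_ge0 ?(ltW r_gt0) //.
  rewrite exprS ler_piMr ?(ltW s0) // exprn_ile1 ?(ltW s0) //.
  by rewrite -subr_ge0 ltW.
have [C [C0 hC]] := ey_sub (lt_trans r_gt1 rr1).
exists (C / (1 - s)); split; first by rewrite divr_ge0 // ltW.
set K := C / _; have K0 : 0 <= K by rewrite divr_ge0 // ltW.
have KE : C + K * s = K.
  by rewrite /K; field; rewrite lt0r_neq0.
elim/ltn_ind => n IH.
apply: (@le_trans _ _ (C * r1 ^+ n + \sum_(i < n) (a i)%:R * (K * r1 ^+ (n - i.+1)))).
  apply: (@le_trans _ _ ((ey n + \sum_(i < n) a i * y (n - i.+1))%N)%:R).
    by rewrite ler_nat.
  rewrite natrD lerD // natr_sum; apply: ler_sum => i _.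
  by rewrite natrM ler_wpM2l // IH // ltn_subrL (leq_ltn_trans _ (ltn_ord i)).
have -> : \sum_(i < n) (a i)%:R * (K * r1 ^+ (n - i.+1)) = K * r1 ^+ n * partial r1 n.
  rewrite mulr_sumr; apply: eq_bigr => i _.
  rewrite exprB ?unitfE ?lt0r_neq0 //; ring.
apply: (@le_trans _ _ ((C + K * s) * r1 ^+ n)); last by rewrite KE.
rewrite mulrDl lerD2l [leRHS]mulrAC ler_wpM2l //.
by rewrite mulr_ge0 // exprn_ge0 // ltW.
Qed.

(* The potential [Phi n] dominates [x n] and grows at least by the factor r up
   to the error [ex n]: [phi] is a left eigenvector of the truncated recurrence. *)
Lemma lower_subexponential r0 r L : 1 < r0 -> r0 < r -> bounded_by x r0 ->
  1 <= partial r L -> subexponential x.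
Proof.
move=> r0_gt1 r0r [D [D0 hD]].
case: L => [|L] hp; first by move: hp; rewrite /partial big_ord0 ler10.
have r00 : 0 < r0 := lt_trans ltr01 r0_gt1.
have r_gt0 : 0 < r := lt_trans r00 r0r.
(* The weights satisfy r phi_j = a_j + phi_(j+1), with phi_(L+1) = 0, and phi_0 is the partial sum,
   which is at least 1. *)
pose phi j := \sum_(i < L.+1) (if (j <= i)%N then (a i)%:R / r ^+ (i.+1 - j) else 0).
(* For j > n the delayed value must be 0, whereas the truncated subtraction would read [x 0]. *)
pose X n j : R := if (j <= n)%N then (x (n - j))%:R else 0.
pose Phi n := \sum_(j < L.+1) phi j * X n j.
have phi0 j : 0 <= phi j.
  by apply: sumr_ge0 => i _; case: ifP => // _; rewrite divr_ge0 // exprn_ge0 // ltW.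
have X0 n j : 0 <= X n j by rewrite /X; case: ifP.
have phi_step j : (j < L.+1)%N -> r * phi j = (a j)%:R + phi j.+1.
  move=> jL; rewrite /phi mulr_sumr.
  have -> : (a j)%:R = \sum_(i < L.+1) (if i == Ordinal jL then (a i)%:R else 0) :> R.
    by rewrite -big_mkcond big_pred1_eq.
  rewrite -big_split /=; apply: eq_bigr => i _; rewrite -val_eqE /= subSS.
  have [ji|ij|ij] := ltngtP j i; rewrite ?mulr0 ?addr0 ?add0r //.
    rewrite subSn ?(ltnW ji) // exprS; field.
    by rewrite !lt0r_neq0 ?exprn_gt0.
  by rewrite ij subSnn expr1 mulrC divfK // lt0r_neq0.
have phi_0 : 1 <= phi 0.
  by apply: (le_trans hp); apply: ler_sum => i _; rewrite /= subn0.
have phi_L : phi L.+1 = 0.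
  by rewrite /phi big1 // => i _; rewrite leqNgt ltn_ord.
have Phi_step n : r * Phi n - (ex n)%:R <= Phi n.+1.
  have -> : r * Phi n = \sum_(j < L.+1) (a j)%:R * X n j + \sum_(j < L.+1) phi j.+1 * X n j.
    rewrite /Phi mulr_sumr -big_split /=; apply: eq_bigr => j _.
    by rewrite mulrA phi_step // mulrDl.
  have -> : \sum_(j < L.+1) phi j.+1 * X n j = \sum_(j < L) phi j.+1 * X n j.
    by rewrite big_ord_recr /= phi_L mul0r addr0.
  have -> : Phi n.+1 = phi 0 * (x n.+1)%:R + \sum_(j < L) phi j.+1 * X n j.
    by rewrite /Phi big_ord_recl /X subn0 /=.
  rewrite addrAC lerD2r lerBlDr.
  apply: (@le_trans _ _ ((x n.+1)%:R + (ex n)%:R)); last first.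
    by rewrite lerD2r ler_peMl.
  rewrite -natrD; apply: le_trans (_ : (\sum_(i < n.+1) a i * x (n - i))%N%:R <= _); last first.
    by rewrite ler_nat.
  rewrite natr_sum -(big_mkord xpredT (fun j => (a j)%:R * X n j)).
  rewrite -(big_mkord xpredT (fun j => (a j * x (n - j))%N%:R)).
  have -> : \sum_(0 <= i < n.+1) (a i * x (n - i))%N%:R = \sum_(0 <= i < n.+1) (a i)%:R * X n i.
    by apply: eq_big_nat => i; rewrite ltnS /X => /= ->; rewrite natrM.
  have nn (m m' : nat) : (m <= m')%N ->
      \sum_(0 <= i < m) (a i)%:R * X n i <= \sum_(0 <= i < m') (a i)%:R * X n i.
    move=> mm; rewrite [leRHS](big_cat_nat (n := m)) //= lerDl.
    by apply: sumr_ge0 => i _; rewrite mulr_ge0.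
  have [Ln|nL] := leqP L.+1 n.+1; first exact: nn.
  rewrite (big_cat_nat (n := n.+1)) ?(ltnW nL) //= gerDl big_nat big1 // => i /andP[ni _].
  by rewrite /X leqNgt ni mulr0.
have Phi_x n : (x n)%:R <= Phi n.
  rewrite /Phi (bigD1 (ord0)) //= {1}/X leq0n subn0.
  apply: (@le_trans _ _ (phi 0 * (x n)%:R)); first by rewrite ler_peMl.
  by rewrite lerDl sumr_ge0 // => j _; rewrite mulr_ge0.
have [D' D'0 Phi_D] : exists2 D', 0 <= D' & forall n, Phi n <= D' * r0 ^+ n.
  exists (\sum_(j < L.+1) phi j * D).
    by apply: sumr_ge0 => j _; rewrite mulr_ge0.
  move=> n; rewrite mulr_suml; apply: ler_sum => j _; rewrite -mulrA ler_wpM2l //.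
  rewrite /X; case: ifP => [jn|_]; last by rewrite mulr_ge0 // exprn_ge0 // ltW.
  apply: (le_trans (hD _)); rewrite ler_wpM2l // ler_weXn2l ?leq_subr //.
  exact: ltW.
have small r2 : 1 < r2 -> r2 < r -> bounded_by x r2.
  move=> r2_gt1 r2r; have r2_gt0 : 0 < r2 := lt_trans ltr01 r2_gt1.
  have [C [C0 hC]] := ex_sub r2_gt1.
  have rr2 : 0 < r - r2 by rewrite subr_gt0.
  pose K := C / (r - r2); exists K; split; first by rewrite divr_ge0 // ltW.
  move=> N; rewrite leNgt; apply/negP => KN.
  have KE : C + K * r2 = K * r by rewrite /K; field; rewrite lt0r_neq0.
  (* As C + K r2 = K r, subtracting K r2^n absorbs the error term and leaves exact growth by the
     factor r. A single positive value then grows like r^m, against the bound D' r0^n with r0 <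
     r. *)
  pose Psi n := Phi n - K * r2 ^+ n.
  have PsiN : 0 < Psi N by rewrite subr_gt0 (lt_le_trans KN).
  have Psi_step n : r * Psi n <= Psi n.+1.
    apply: le_trans (_ : r * Phi n - (ex n)%:R - K * r2 ^+ n.+1 <= _); last first.
      by rewrite lerD2r.
    rewrite mulrBr -addrA lerD2l -opprD lerN2 exprS.
    apply: (@le_trans _ _ (C * r2 ^+ n + K * (r2 * r2 ^+ n))); first by rewrite lerD2r.
    have -> : C * r2 ^+ n + K * (r2 * r2 ^+ n) = (C + K * r2) * r2 ^+ n by ring.
    by rewrite KE mulrAC mulrC mulrA.
  have Psi_ge m : r ^+ m * Psi N <= Psi (N + m)%N.
    elim: m => [|m IH]; first by rewrite addn0 mul1r.
    rewrite addnS; apply: le_trans (Psi_step _).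
    by rewrite exprS -mulrA ler_wpM2l // ltW.
  have q1 : 1 < r / r0 by rewrite ltr_pdivlMr // mul1r.
  have [m hm] := expr_unbounded (D' * r0 ^+ N / Psi N) q1.
  have : r ^+ m * Psi N <= D' * r0 ^+ (N + m).
    apply: (le_trans (Psi_ge m)); apply: le_trans (Phi_D _).
    by rewrite gerBl mulr_ge0 ?divr_ge0 ?exprn_ge0 // ltW.
  rewrite leNgt => /negP; apply.
  rewrite exprD mulrA; move: hm.
  by rewrite expr_div_n ltr_pdivrMr // mulrAC ltr_pdivlMr ?exprn_gt0.
(* For r2 at least r the bound assumed at r0 already suffices. *)
move=> r2 r2_gt1; have [r2r|rr2] := ltP r2 r; first exact: small.
apply: (bounded_byW (r := r0)); [exact: ltW|exact: le_trans (ltW r0r) rr2|].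
by exists D.
Qed.

End Recurrence.

Lemma growth_trichotomy x y a ex ey C :
  subexponential ex -> subexponential ey ->
  (forall n, (\sum_(i < n.+1) a i * x (n - i) <= x n.+1 + ex n)%N) ->
  (forall n, (y n <= ey n + \sum_(i < n) a i * y (n - i.+1))%N) ->
  (forall n, (x n <= C * y n)%N) ->
  growth x = 0%:E \/ growth x = 1%:E \/ growth x = growth y.
Proof.
move=> sex sey xl yu xy; have [|x1] := growth_dichotomy x; first by left.
right; have [xle|xgt] := leP (growth x) 1%:E.
  by left; apply/eqP; rewrite eq_le xle.
right; apply/eqP; rewrite eq_le (growth_mono xy) leNgt; apply/negP => lt_xy.
(* Three radii are placed strictly between the two growths, r0 < r < r1. The series is tested at r;
   the gap to r0 contradicts exponential growth of x, the gap to r1 makes the series strictly less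
   than 1 for y. *)
have [r /andP[xr ry]] := ereal_between (growth_ge0 x) lt_xy.
have [r0 /andP[xr0 r0r]] := ereal_between (growth_ge0 x) xr.
have r0_gt1 : 1 < r0 by rewrite -lte_fin; exact: lt_trans xgt xr0.
rewrite lte_fin in r0r.
have [r1 /andP[rr1 r1y]] : exists r1, ((r%:E < r1%:E) && (r1%:E < growth y))%E.
  by apply: ereal_between ry; rewrite lee_fin (le_trans _ (ltW r0r)) // (le_trans ler01) // ltW.
rewrite lte_fin in rr1; have r_gt1 : 1 < r := lt_trans r0_gt1 r0r.
have [[L hL]|nL] := pselect (exists L, 1 <= \sum_(i < L) (a i)%:R / r ^+ i.+1).
  have : subexponential x.
    apply: (lower_subexponential sex xl r0_gt1 r0r _ hL).
    by apply: growth_bounded xr0; exact: lt_trans r0_gt1.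
  by move=> /subexponential_growth; rewrite leNgt xgt.
have : bounded_by y r1.
  apply: (upper_bounded sey yu r_gt1 rr1) => L.
  by rewrite leNgt; apply/negP => /ltW h; apply: nL; exists L.
move=> /bounded_growth; rewrite (lt_trans ltr01) ?(lt_trans r_gt1) // => /(_ isT).
by rewrite leNgt r1y.
Qed.

End Growth.

(** * DG algebras *)

Section DGAlgebra.
Context (A : comUnitRingType) (k : fieldType) (pi : {rmorphism A -> k}).
Context (E : dg_algebra pi).
Implicit Types (a b : E).

Local Notation comp := (dg_comp E).
Local Notation d := (dg_d E).
Local Notation aug := (dg_aug E).
Local Notation hom n a := (dg_hom (d := E) n a).

Lemma comp_hom n a : hom n (comp n a).
Proof. by rewrite /dg_hom dg_compK eqxx. Qed.

Lemma hom_comp m n a : hom n a -> comp m a = if m == n then a else 0.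
Proof. by rewrite /dg_hom => an; rewrite -an dg_compK. Qed.

Lemma hom_decomposition (P : E -> Prop) :
  P 0 -> (forall a b, P a -> P b -> P (a + b)) -> (forall n a, hom n a -> P a) ->
  forall a, P a.
Proof.
move=> P0 PD Ph a; have [N [_ ->]] := dg_comp_sum a.
by apply: big_ind => // i _; apply: Ph; exact: comp_hom.
Qed.

Lemma homZ n (r : A) a : hom n a -> hom n (r *: a).
Proof. by rewrite /dg_hom linearZ /= => ->. Qed.

Lemma homD n a b : hom n a -> hom n b -> hom n (a + b).
Proof. by rewrite /dg_hom linearD /= => -> ->. Qed.

Lemma hom0 n : hom n (0 : E).
Proof. by rewrite /dg_hom linear0. Qed.

Lemma comp_d n a : comp n (d a) = d (comp n.+1 a).
Proof.
elim/hom_decomposition: a => [|a b ha hb|m a am]; first by rewrite !linear0.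
  by rewrite !linearD /= ha hb.
rewrite (hom_comp _ am); case: m am => [|m] am.
  by rewrite dg_hom_d0 // !linear0.
rewrite (hom_comp _ (dg_hom_d am)) eqSS; case: eqP => // _.
by rewrite linear0.
Qed.

Lemma bar_sum a N : (forall n, (N <= n)%N -> comp n a = 0) ->
  dg_bar a = \sum_(n < N) (-1) ^+ n.+1 * comp n a.
Proof.
move=> hN; rewrite /dg_bar.
rewrite (@fsbigTE _ _ _ _ (seq_fset tt (iota 0 N))); last first.
  move=> i; rewrite seq_fsetE mem_iota add0n /= -leqNgt => Ni.
  by rewrite hN // mulr0.
have -> : \sum_(n < N) (-1) ^+ n.+1 * comp n a =
    \sum_(n <- iota 0 N) (-1) ^+ n.+1 * comp n a.
  by rewrite -(big_mkord xpredT (fun n => (-1) ^+ n.+1 * comp n a)) /index_iota subn0.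
apply: perm_big; apply: uniq_perm; rewrite ?fset_uniq ?iota_uniq //.
by move=> i; rewrite seq_fsetE.
Qed.

(* The sign automorphism: the paper's bar is [- sgn]. *)
Definition sgn a : E := - dg_bar a.

Fact sgn_linear : linear sgn.
Proof.
move=> r a b; have [N [hN _]] := dg_comp_sum a; have [N' [hN' _]] := dg_comp_sum b.
have ub c M M' : (M <= M')%N -> (forall n, (M <= n)%N -> comp n c = 0) ->
    forall n, (M' <= n)%N -> comp n c = 0.
  by move=> MM h n Mn; apply: h; exact: leq_trans Mn.
have ha := ub a _ _ (leq_maxl N N') hN; have hb := ub b _ _ (leq_maxr N N') hN'.
rewrite /sgn (bar_sum ha) (bar_sum hb) (@bar_sum _ (maxn N N')); last first.
  by move=> n Mn; rewrite linearP /= ha // hb // scaler0 addr0.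
rewrite scalerN -opprD; congr (- _).
rewrite scaler_sumr -big_split /=; apply: eq_bigr => i _.
by rewrite linearP /= mulrDr scalerAr.
Qed.
HB.instance Definition _ := GRing.isLinear.Build A E E *:%R sgn sgn_linear.

Lemma sgn_hom n a : hom n a -> sgn a = (-1) ^+ n * a.
Proof.
move=> an; rewrite /sgn (@bar_sum _ n.+1) => [|m nm].
  rewrite big_ord_recr /= big1 => [|i _].
    by rewrite (hom_comp _ an) eqxx add0r exprS mulN1r mulNr opprK.
  by rewrite (hom_comp _ an) ltn_eqF // mulr0.
by rewrite (hom_comp _ an) gtn_eqF.
Qed.

Lemma signM n a b : a * ((-1) ^+ n * b) = (-1) ^+ n * (a * b).
Proof. by rewrite mulrA commr_sign -mulrA. Qed.

Lemma sgnM a b : sgn (a * b) = sgn a * sgn b.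
Proof.
elim/hom_decomposition: a => [|a a' ha ha'|n a an].
- by rewrite mul0r linear0 mul0r.
- by rewrite mulrDl !linearD /= ha ha' mulrDl.
elim/hom_decomposition: b => [|b b' hb hb'|m b bm].
- by rewrite mulr0 linear0 mulr0.
- by rewrite mulrDr !linearD /= hb hb' mulrDr.
rewrite (sgn_hom (dg_homM an bm)) (sgn_hom an) (sgn_hom bm).
by rewrite -[RHS]mulrA signM [RHS]mulrA -exprD.
Qed.

Lemma sgnK a : sgn (sgn a) = a.
Proof.
elim/hom_decomposition: a => [|a b ha hb|n a an]; first by rewrite !linear0.
  by rewrite !linearD /= ha hb.
have an' : hom n ((-1) ^+ n * a).
  by rewrite -signr_odd mulr_sign; case: (odd n) => //; rewrite -scaleN1r; exact: homZ.
by rewrite (sgn_hom an) (sgn_hom an') mulrA -exprD addnn -signr_odd odd_double mul1r.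
Qed.

Lemma d_sgn a : d (sgn a) = - sgn (d a).
Proof.
elim/hom_decomposition: a => [|a b ha hb|n a an]; first by rewrite !linear0.
  by rewrite !(linearD, opprD) /= ha hb.
rewrite (sgn_hom an) -signr_odd mulr_sign; case: n an => [|n] an.
  by rewrite /= dg_hom_d0 // !linear0.
rewrite (sgn_hom (dg_hom_d an)) -signr_odd mulr_sign /=.
by case: (odd n) => /=; rewrite ?linearN ?opprK.
Qed.

(** The Leibniz rule for elements that need not be homogeneous; [sgn] absorbs the degree, which is
    why the bar construction can do without a grading. *)
Lemma dM a b : d (a * b) = d a * b + sgn a * d b.
Proof.
elim/hom_decomposition: a => [|a a' ha ha'|n a an].
- by rewrite !(mul0r, linear0) addr0.
- by rewrite mulrDl !linearD /= ha ha' !mulrDl addrACA.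
by rewrite (dg_leibniz _ an) (sgn_hom an) mulrA.
Qed.

Lemma d1 : d 1 = 0.
Proof. exact/dg_hom_d0/dg_hom1. Qed.

Lemma sgn1 : sgn 1 = 1.
Proof. by rewrite (sgn_hom (dg_hom1 E)) mul1r. Qed.

Lemma augZ (r : A) a : aug (r *: a) = pi r * aug a.
Proof. by rewrite -mulr_algl rmorphM dg_aug_scalar. Qed.

Lemma aug_sgn a : aug (sgn a) = aug a.
Proof.
elim/hom_decomposition: a => [|a b ha hb|n a an]; first by rewrite linear0.
  by rewrite linearD !rmorphD ha hb.
rewrite (sgn_hom an); case: n an => [|n] an; first by rewrite mul1r.
by rewrite rmorphM (dg_aug_pos an) mulr0.
Qed.

Lemma aug_comp0 a : aug a = aug (comp 0 a).
Proof.
elim/hom_decomposition: a => [|a b ha hb|n a an]; first by rewrite linear0.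
  by rewrite linearD !rmorphD ha hb.
rewrite (hom_comp _ an); case: n an => [|n] an //.
by rewrite rmorph0 (dg_aug_pos an).
Qed.

End DGAlgebra.

(** * Finitely supported functions as a direct sum of copies of E *)

Section FiniteSupport.
Context (A : comUnitRingType) (E : lmodType A) (K : choiceType).
Implicit Types (y : K -> E) (w : K).

Definition finsup y := exists X : {fset K}, forall w, w \notin X -> y w = 0.

Definition delta w (a : E) : K -> E := fun v => if v == w then a else 0.

Fact delta_linear w : linear (delta w).
Proof.
move=> r a b; apply/funext => v; rewrite [RHS]/(r *: delta w a v + delta w b v) /delta.
by case: ifP => // _; rewrite scaler0; apply/esym/addr0.
Qed.
HB.instance Definition _ w := GRing.isLinear.Build A E (K -> E) *:%R
  (delta w) (delta_linear w).

Lemma finsup_delta w a : finsup (delta w a).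
Proof. by exists [fset w]%fset => v; rewrite inE /delta => /negbTE ->. Qed.

Lemma finsup0 : finsup 0.
Proof. by exists fset0. Qed.

Lemma finsupD y y' : finsup y -> finsup y' -> finsup (y + y').
Proof.
move=> [X hX] [X' hX']; exists (X `|` X')%fset => w; rewrite inE negb_or => /andP[wX wX'].
by rewrite [LHS]/(y w + y' w) hX // hX' //; exact: addr0.
Qed.

Lemma finsupZ r y : finsup y -> finsup (r *: y).
Proof. by move=> [X hX]; exists X => w wX; rewrite [LHS]/(r *: y w) hX //; exact: scaler0. Qed.

Lemma finsup_sum I (r : seq I) (P : pred I) (F : I -> K -> E) :
  (forall i, P i -> finsup (F i)) -> finsup (\sum_(i <- r | P i) F i).
Proof. by move=> h; apply: big_ind => //; [exact: finsup0|exact: finsupD]. Qed.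

Section Ext.
Context (W : lmodType A) (F : K -> {linear E -> W}).

(** The map out of the direct sum with components F w. The sum has its intended meaning only for
    finitely supported y, hence the [finsup] conditions in the rules below. *)
Definition ext y : W := \sum_(w \in [set: K]) F w (y w).

Lemma extE y (X : {fset K}) : (forall w, w \notin X -> y w = 0) ->
  ext y = \sum_(w <- X) F w (y w).
Proof. by move=> hX; apply: fsbigTE => w /hX ->; rewrite linear0. Qed.

Lemma extD y y' : finsup y -> finsup y' -> ext (y + y') = ext y + ext y'.
Proof.
move=> [X hX] [X' hX'].
have h w : w \notin (X `|` X')%fset -> y w = 0.
  by rewrite inE negb_or => /andP[/hX].
have h' w : w \notin (X `|` X')%fset -> y' w = 0.
  by rewrite inE negb_or => /andP[_ /hX'].
rewrite (extE h) (extE h') (@extE _ (X `|` X')%fset) => [|w wX].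
  by rewrite -big_split /=; apply: eq_bigr => w _; rewrite -linearD.
by rewrite [LHS]/(y w + y' w) h // h' //; exact: addr0.
Qed.

Lemma extZ r y : finsup y -> ext (r *: y) = r *: ext y.
Proof.
move=> [X hX]; rewrite (extE hX) (@extE _ X) => [|w wX].
  by rewrite scaler_sumr; apply: eq_bigr => w _; rewrite -linearZ.
by rewrite [LHS]/(r *: y w) hX //; exact: scaler0.
Qed.

Lemma ext0 : ext 0 = 0.
Proof. by rewrite (@extE _ fset0) ?big_seq_fset0. Qed.

Lemma ext_sum I (r : seq I) (P : pred I) (y : I -> K -> E) :
  (forall i, P i -> finsup (y i)) ->
  ext (\sum_(i <- r | P i) y i) = \sum_(i <- r | P i) ext (y i).
Proof.
move=> h; suff [] : finsup (\sum_(i <- r | P i) y i) /\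
    ext (\sum_(i <- r | P i) y i) = \sum_(i <- r | P i) ext (y i) by [].
apply: (big_ind2 (fun u v => finsup u /\ ext u = v)).
- by split; [exact: finsup0|exact: ext0].
- move=> u v u' v' [fu <-] [fu' <-]; split; first exact: finsupD.
  exact: extD.
- by move=> i /h.
Qed.

Lemma ext_delta w a : ext (delta w a) = F w a.
Proof.
rewrite (@extE _ [fset w]%fset) => [|v]; first by rewrite big_seq_fset1 /delta eqxx.
by rewrite inE /delta => /negbTE ->.
Qed.

End Ext.

Lemma ext_finsup (F : K -> {linear E -> (K -> E)}) y :
  (forall w a, finsup (F w a)) -> finsup y -> finsup (ext F y).
Proof. by move=> h [X hX]; rewrite (extE _ hX); apply: finsup_sum. Qed.

(** An identity between composites of such maps may be checked on a single word. *)
Lemma ext_comp (W : lmodType A) (F : K -> {linear E -> (K -> E)})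
    (H H' : K -> {linear E -> W}) y :
  (forall w a, finsup (F w a)) -> finsup y ->
  (forall w a, ext H (F w a) = H' w a) -> ext H (ext F y) = ext H' y.
Proof.
move=> h [X hX] HF; rewrite (extE _ hX) (extE _ hX) ext_sum //.
by apply: eq_bigr => w _.
Qed.

End FiniteSupport.

(** * The bar resolution defined by a trivial Massey operation *)

Section Words.
Context (A : comUnitRingType) (k : fieldType) (pi : {rmorphism A -> k}).
Context (k_residue : residue_field pi).
Context (E : dg_algebra pi).
Local Notation d := (dg_d E).
Local Notation aug := (dg_aug E).
Local Notation sgn := (@sgn A k pi E).

Context (S : set E) (S_sub : is_submodule S) (S1 : S 1).
Hypothesis SM : forall a b, S a -> S b -> S (a * b).
Hypothesis Sd : forall a, S a -> S (d a).
Hypothesis Ssgn : forall a, S a -> S (sgn a).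

Context (L : choiceType) (gam : seq L -> E).
Hypothesis gamS : forall w, w != [::] -> S (gam w).
Hypothesis gam_aug : forall w, w != [::] -> aug (gam w) = 0.
Hypothesis gam_d : forall w, w != [::] ->
  d (gam w) = \sum_(1 <= j < size w) dg_bar (gam (take j w)) * gam (drop j w).
Hypothesis gam_gen : forall u, S u -> d u = 0 -> aug u = 0 ->
  exists (s : seq L) (c : L -> A) t, S t /\ u = \sum_(b <- s) c b *: gam [:: b] + d t.
Hypothesis gam_ind : forall (s : seq L) (c : L -> A) t, uniq s -> S t ->
  \sum_(b <- s) c b *: gam [:: b] = d t -> forall b, b \in s -> maximal_ideal (c b).
Hypothesis gam_prod : forall t b, S t -> d t = 0 -> aug t = 0 ->
  exists2 u, S u & t * gam [:: b] = d u.

Local Notation word := (seq L).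
Implicit Types (w v : word) (y : word -> E).

(** The differential of a times the word w: the coefficient next to the word swallows an initial
    piece through its Massey value, and the final piece is left. *)
Definition bar_d1 w (a : E) : word -> E :=
  delta w (d a) + \sum_(1 <= j < (size w).+1) delta (drop j w) (sgn a * gam (take j w)).

Fact bar_d1_linear w : linear (bar_d1 w).
Proof.
move=> r a b; rewrite /bar_d1 linearP linearP scalerDr addrACA; congr (_ + _).
rewrite scaler_sumr -big_split /=; apply: eq_bigr => j _.
by rewrite linearP mulrDl -scalerAl linearP.
Qed.
HB.instance Definition _ w := GRing.isLinear.Build A E (word -> E) *:%R
  (bar_d1 w) (bar_d1_linear w).

Definition bar_d : (word -> E) -> word -> E := ext bar_d1.

Lemma finsup_bar_d1 w a : finsup (bar_d1 w a).
Proof.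
apply: finsupD; first exact: finsup_delta.
by apply: finsup_sum => j _; exact: finsup_delta.
Qed.

Lemma mulrNK (T : pzRingType) (x y z : T) : x * y + (- x * y + z) = z.
Proof. by rewrite mulNr addrA subrr add0r. Qed.

Lemma triangle_sum (V : zmodType) (f : nat -> nat -> V) n :
  \sum_(1 <= j < n.+1) \sum_(1 <= l < j) f l j =
  \sum_(1 <= l < n.+1) \sum_(1 <= i < (n - l).+1) f l (l + i)%N.
Proof.
transitivity (\sum_(1 <= j < n.+1) \sum_(1 <= l < n.+1 | (l < j)%N) f l j).
  apply: eq_big_nat => j /andP[j1 jn].
  rewrite [RHS](big_cat_nat (n := j)) //=; last by rewrite ltnW.
  rewrite [X in _ = _ + X]big_nat_cond [X in _ = _ + X]big1 => [|l]; last first.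
    by move=> /andP[/andP[jl _]]; rewrite ltnNge jl.
  rewrite addr0 [LHS]big_nat_cond [RHS]big_nat_cond; apply: eq_bigl => l.
  by case/boolP: (1 <= l < j)%N => //= /andP[_ ->].
rewrite (exchange_big_dep_nat xpredT) //=; apply: eq_big_nat => l /andP[l1 ln].
rewrite (big_cat_nat (n := l.+1)) //=.
rewrite [X in X + _]big_nat_cond [X in X + _]big1 => [|j]; last first.
  by move=> /andP[/andP[_]]; rewrite ltnS leqNgt => /negbTE ->.
rewrite add0r -[l.+1 in LHS]add1n big_addn.
rewrite subSn ?(ltnW ln) //.
rewrite big_nat_cond [RHS]big_nat_cond.
apply: eq_big => [i|i _]; last by rewrite addnC.
by rewrite leq_add2r andbT; case: (0 < i)%N; rewrite ?andbF ?andbT.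
Qed.

(** The two terms containing d a cancel. What is left of cutting once and differentiating the Massey
    value is, by [gam_d], the sum over cutting twice, with opposite sign; [triangle_sum] matches the
    two indexings by pairs of cuts. *)
Lemma bar_d_bar_d1 w a : bar_d (bar_d1 w a) = 0.
Proof.
rewrite /bar_d extD; [|exact: finsup_delta|by apply: finsup_sum => j _; exact: finsup_delta].
rewrite ext_delta ext_sum => [|j _]; last exact: finsup_delta.
under eq_bigr do rewrite ext_delta.
rewrite /= /bar_d1 dg_dd.
rewrite linear0 add0r -big_split /=.
set n := size w.
have e1 j : (1 <= j < n.+1)%N ->
    delta (drop j w) (sgn (d a) * gam (take j w)) +
    (delta (drop j w) (d (sgn a * gam (take j w))) +
     \sum_(1 <= i < (size (drop j w)).+1)
      delta (drop i (drop j w)) (sgn (sgn a * gam (take j w)) * gam (take i (drop j w)))) =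
    \sum_(1 <= l < j) delta (drop j w)
      (a * (dg_bar (gam (take l w)) * gam (take (j - l) (drop l w)))) -
    \sum_(1 <= i < (n - j).+1) delta (drop (j + i) w)
      (a * (dg_bar (gam (take j w)) * gam (take i (drop j w)))).
  move=> /andP[j1 jn].
  have tj : take j w != [::] by rewrite -size_eq0 size_take_min -/n (minn_idPl _) // -lt0n.
  rewrite dM d_sgn sgnK (gam_d tj) addrA -linearD /=.
  rewrite mulrNK.
  congr (_ + _).
    rewrite size_take_min -/n (minn_idPl _) // mulr_sumr linear_sum /=.
    apply: eq_big_nat => l /andP[l1 lj].
    rewrite take_takel ?(ltnW lj) // take_drop subnK ?(ltnW lj) //.
  rewrite size_drop -/n -sumrN; apply: eq_bigr => i _.
  rewrite drop_drop addnC -linearN /=; congr (delta _ _).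
  by rewrite sgnM sgnK -mulrA -mulrN -mulNr.
rewrite (eq_big_nat _ _ e1) sumrB.
rewrite (triangle_sum (fun l j => delta (drop j w)
  (a * (dg_bar (gam (take l w)) * gam (take (j - l) (drop l w)))))).
apply/eqP; rewrite subr_eq0; apply/eqP.
by apply: eq_big_nat => l _; apply: eq_bigr => i _; rewrite addKn.
Qed.

Lemma bar_d_bar_d y : finsup y -> bar_d (bar_d y) = 0.
Proof.
move=> fy; rewrite /bar_d (ext_comp (H' := fun w => \0)) //; first last.
- by move=> w a; exact: bar_d_bar_d1.
- exact: finsup_bar_d1.
by case: fy => X hX; rewrite (extE _ hX) big1.
Qed.

(** The component of the bar differential from [rcons w b] to the empty word. Words ending in b,
    with that b removed, form a shifted copy of the bar construction, so over all w this is a map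
    from it to E. *)
Definition tail_map b w (a : E) : E := sgn a * gam (rcons w b).

Fact tail_map_linear b w : linear (tail_map b w).
Proof. by move=> r x y; rewrite /tail_map linearP mulrDl scalerAl. Qed.
HB.instance Definition _ b w := GRing.isLinear.Build A E E *:%R
  (tail_map b w) (tail_map_linear b w).

Definition tail b : (word -> E) -> E := ext (tail_map b).

(** The Massey relation of the word [rcons w b]: each cut leaves the last letter in the final piece,
    so it is also a cut of w. *)
Lemma d_tail b y : finsup y -> d (tail b y) = - tail b (bar_d y).
Proof.
move=> fy; rewrite /tail /bar_d.
rewrite (ext_comp (H' := fun w => - (d \o tail_map b w))) //; first last.
- move=> w a; rewrite extD; [|exact: finsup_delta|by apply: finsup_sum => j _; exact: finsup_delta].
  rewrite ext_delta ext_sum => [|j _]; last exact: finsup_delta.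
  under eq_bigr do rewrite ext_delta.
  rewrite /= /tail_map dM d_sgn sgnK gam_d; last by case: w.
  rewrite size_rcons opprD mulNr opprK; congr (_ + _).
  rewrite mulr_sumr -sumrN; apply: eq_big_nat => j /andP[j1 jw].
  have -> : take j (rcons w b) = take j w by rewrite -cats1 takel_cat.
  rewrite drop_rcons //.
  by rewrite sgnM sgnK -mulrA -mulrN -mulNr.
- exact: finsup_bar_d1.
case: fy => X hX; rewrite !(extE _ hX) linear_sum -sumrN /=.
by apply: eq_bigr => w _; rewrite opprK.
Qed.

Lemma bar_d_coef y (X : {fset word}) v : (forall w, w \notin X -> y w = 0) ->
  bar_d y v = \sum_(w <- X) bar_d1 w (y w) v.
Proof. by move=> hX; rewrite /bar_d (extE _ hX) fct_sumE. Qed.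

Lemma bar_d1E w a v : bar_d1 w a v = delta w (d a) v +
  \sum_(1 <= j < (size w).+1) delta (drop j w) (sgn a * gam (take j w)) v.
Proof.
transitivity (delta w (d a) v + (\sum_(1 <= j < (size w).+1)
  delta (drop j w) (sgn a * gam (take j w))) v); first by [].
by rewrite fct_sumE.
Qed.

(** Cuts strictly shorten words, so on the graded pieces of the length filtration the bar
    differential is just d. *)
Lemma bar_d1_top w a v : (size w <= size v)%N ->
  bar_d1 w a v = if v == w then d a else 0.
Proof.
move=> wv; rewrite bar_d1E big_nat big1 ?addr0 // => j.
move=> /andP[j1 jw]; rewrite /delta; case: eqP => // vE; move: wv.
by rewrite vE size_drop leqNgt ltn_subrL j1 (leq_trans j1).
Qed.

(** One step down in length, the differential multiplies by the class of the first letter. *)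
Lemma bar_d1_next w a v : size w = (size v).+1 ->
  bar_d1 w a v = if v == behead w then sgn a * gam (take 1 w) else 0.
Proof.
move=> wv; rewrite bar_d1E.
rewrite {1}/delta; case: eqP => [vw|_].
  by move: wv; rewrite vw => /eqP; rewrite -[X in X == _]addn0 -addn1 eqn_add2l.
rewrite add0r wv big_ltn // [X in _ + X]big_nat [X in _ + X]big1 ?addr0 /delta ?drop1 //.
move=> j /andP[j1 jw]; case: eqP => // vE; exfalso.
have sv : size v = (size w - j)%N by rewrite vE size_drop.
lia.
Qed.

Lemma sum_pick (X : {fset word}) (F : word -> E) w : (w \notin X -> F w = 0) ->
  \sum_(v <- X) (if w == v then F v else 0) = F w.
Proof.
move=> h; have [wX|wX] := boolP (w \in X).
  by rewrite (bigD1_seq w) ?fset_uniq //= eqxx big1 ?addr0 // => v; rewrite eq_sym => /negbTE ->.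
rewrite (h wX) big_seq big1 // => v vX; case: eqP => // wv.
by rewrite wv vX in wX.
Qed.

Section TopLength.
Context (y : word -> E) (X : {fset word}) (n : nat).
Hypothesis yX : forall w, w \notin X -> y w = 0.
Hypothesis yS : forall w, S (y w).
Hypothesis yn : forall w, (n < size w)%N -> y w = 0.
Hypothesis dy : bar_d y = 0.

Lemma top_cycle w : size w = n -> d (y w) = 0.
Proof.
move=> wn; have /(congr1 (@^~ w)) := dy; rewrite (bar_d_coef _ yX) => dyw.
rewrite -[RHS]dyw -[LHS](@sum_pick X (fun v => d (y v))); last first.
  by move=> /yX ->; rewrite linear0.
apply: eq_bigr => v _; have [vn|nv] := leqP (size v) n.
  by rewrite bar_d1_top // wn.
by rewrite yn // !linear0; case: ifP.
Qed.

(** At the word w left after deleting the first letter, the equation [bar_d y = 0] reads: the sum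
    over letters b of sgn (y (b :: w)) times gam b is a boundary. Replacing these coefficients by
    scalars of the same augmentation changes the sum by boundaries, by [gam_prod], and [gam_ind]
    then puts the scalars in m. *)
Lemma top_aug w : size w = n -> (0 < n)%N -> aug (y w) = 0.
Proof.
case: w => [<- //|b0 w] wn _.
have [wX|/yX ->] := boolP (b0 :: w \in X); last by rewrite rmorph0.
have /(congr1 (@^~ w)) := dy; rewrite (bar_d_coef _ yX) => dyw.
have /choice[e he] : forall v, exists e : A, pi e = aug (y v).
  by move=> v; case: k_residue => surj _; exact: surj.
(* The coefficient minus its scalar is a cycle of augmentation 0, so its product with the class of a
   letter is the boundary d u. *)
have /choice[u hu] : forall v, exists u, size v = n -> S u /\
    sgn (y v) * gam (take 1 v) = e v *: gam (take 1 v) + d u.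
  move=> v; have [vn|] := pselect (size v = n); last by exists 0.
  case: v vn => [|b v] vn; first by rewrite -vn in wn.
  pose t := y (b :: v) - e (b :: v) *: 1.
  have tS : S t by apply: submoduleB => //; exact: submoduleZ.
  have dt : d t = 0 by rewrite linearB linearZ /= d1 scaler0 subr0 top_cycle.
  have at0 : aug t = 0 by rewrite rmorphB augZ rmorph1 mulr1 he subrr.
  have [||x xS hx] := @gam_prod (sgn t) b (Ssgn tS); first by rewrite d_sgn dt linear0 oppr0.
    by rewrite aug_sgn.
  exists x => _; split=> //; rewrite /= take0 -hx.
  by rewrite -[X in X * _ = _](subrK (sgn t)) -linearB subKr linearZ /= sgn1 mulrDl -scalerAl mul1r.
pose P v := (size v == n) && (w == behead v).
(* This is the coefficient of [bar_d y] at w: d (y w) from w itself, the products from the words of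
   length n, and nothing from longer words. *)
have dyw' : \sum_(v <- X | P v) e v *: gam (take 1 v) =
    d (- (y w + \sum_(v <- X | P v) u v)).
  apply/eqP; rewrite linearN linearD linear_sum -addr_eq0 /= addrC -addrA -big_split /=.
  apply/eqP; rewrite -[RHS]dyw.
  rewrite -[d (y w)](@sum_pick X (fun v => d (y v))); last by move=> /yX ->; rewrite linear0.
  rewrite [X in _ + X]big_mkcond -big_split /=; apply: eq_bigr => v _.
  have [vn|vn|vn] := ltngtP (size v) n.
  - have vw : (size v <= size w)%N by move: vn; rewrite -wn.
    by rewrite bar_d1_top // /P ltn_eqF //= addr0.
  - rewrite yn // !linear0 /P gtn_eqF //= addr0; by case: ifP.
  - rewrite /P vn eqxx bar_d1_next ?vn -?wn //.
    have -> : w == v = false.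
      by apply/negP => /eqP wv; move: vn; rewrite -wv -wn /=; lia.
    rewrite add0r; case: (w == behead v) => //.
    have [_ ->] := hu v vn.
    by rewrite addrC.
apply/eqP; rewrite -he; apply/eqP/(residue0 k_residue).
have hP v : P v -> v = head b0 v :: w.
  by move=> /andP[/eqP vn /eqP ->]; case: v vn => // v0; rewrite -v0 in wn.
have := @gam_ind (map (head b0) [seq v <- X | P v]) (fun b => e (b :: w))
  (- (y w + \sum_(v <- X | P v) u v)).
apply; last first.
- apply/mapP; exists (b0 :: w) => //; by rewrite mem_filter wX andbT /P wn /= !eqxx.
- rewrite -dyw' big_map big_filter; apply: eq_bigr => v /hP ->.
  by rewrite /= take0.
- apply: submoduleN => //; apply: submoduleD => //; apply: submodule_sum => // v /andP[/eqP vn _].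
  by have [] := hu v vn.
rewrite map_inj_in_uniq ?filter_uniq ?fset_uniq // => v v'.
by rewrite !mem_filter => /andP[/hP vE _] /andP[/hP vE' _] h; rewrite vE vE' h.
Qed.

End TopLength.

Lemma bar_d1_S w a v : S a -> S (bar_d1 w a v).
Proof.
have dS u x v' : S x -> S (delta u x v').
  by move=> Sx; rewrite /delta; case: ifP => // _; exact: submodule0.
move=> Sa; rewrite bar_d1E; apply: submoduleD => //; first by apply: dS; exact: Sd.
rewrite big_nat; apply: submodule_sum => // j /andP[j1 jw]; apply: dS.
apply: SM; first exact: Ssgn.
by apply: gamS; rewrite -size_eq0 size_take_min (minn_idPl _) // -lt0n.
Qed.

Lemma bar_d_S y w : finsup y -> (forall v, S (y v)) -> S (bar_d y w).
Proof.
move=> [X hX] yS; rewrite (bar_d_coef _ hX); apply: submodule_sum => // v _.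
exact: bar_d1_S.
Qed.

Lemma aug_bar_d y v : finsup y -> aug (bar_d y v) = 0.
Proof.
have augdelta (u x : word) a : aug a = 0 -> aug (delta u a x) = 0.
  by move=> a0; rewrite /delta; case: ifP => // _; rewrite rmorph0.
move=> [X hX]; rewrite (bar_d_coef _ hX) rmorph_sum big1 // => w _.
rewrite bar_d1E rmorphD augdelta ?dg_aug_d // add0r rmorph_sum big_nat big1 // => j /andP[j1 jw].
apply: augdelta; rewrite rmorphM gam_aug ?mulr0 //.
by rewrite -size_eq0 size_take_min (minn_idPl _) // -lt0n.
Qed.

(** Induction on the length of the words involved. The coefficients on the longest words are cycles
    of augmentation 0, hence combinations of the classes of letters plus boundaries, and such terms
    can be removed by a boundary. *)
Lemma bar_exact_length n y : finsup y -> (forall w, S (y w)) ->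
  (forall w, (n <= size w)%N -> y w = 0) -> bar_d y = 0 -> aug (y [::]) = 0 ->
  exists y', [/\ finsup y', forall w, S (y' w) & y = bar_d y'].
Proof.
elim: n y => [|n IH] y fy yS yn dy ay.
  exists 0; split; [exact: finsup0|by move=> w; exact: submodule0|].
  by rewrite [RHS]ext0; apply/funext => w; exact: yn.
have [X hX] := fy.
have /choice[s /choice[c /choice[t ht]]] : forall w,
    exists (s : seq L) (c : L -> A) t, size w = n ->
      S t /\ y w = \sum_(b <- s) c b *: gam [:: b] + d t.
  move=> w; have [wn|] := pselect (size w = n); last first.
    by exists [::], (fun=> 0), 0.
  have [||s [c [t [tS hw]]]] := @gam_gen (y w) (yS w); last by exists s, c, t.
    exact: (top_cycle hX yn dy).
  (* On the empty word the augmentation vanishes by assumption; on longer words by [top_aug]. *)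
  case: n wn yn {IH} => [/size0nil -> //|n] wn yn.
  exact: (top_aug hX yS yn dy wn).
(* The term t at w supplies d t, and the scalar c b at the longer word [b :: w] supplies c b times
   the class of b. Scalars are cycles, so nothing new arises in length n + 1. *)
pose y' := \sum_(w <- X | size w == n) (delta w (t w) +
  \sum_(b <- s w) delta (b :: w) (c w b *: 1)).
have fy1 w : finsup (\sum_(b <- s w) delta (b :: w) (c w b *: (1 : E))).
  by apply: finsup_sum => b _; exact: finsup_delta.
have fy2 w : finsup (delta w (t w) + \sum_(b <- s w) delta (b :: w) (c w b *: (1 : E))).
  by apply: finsupD => //; exact: finsup_delta.
have fy' : finsup y' by exact: finsup_sum.
have y'S v : S (y' v).
  rewrite /y' fct_sumE; apply: submodule_sum => // w /eqP wn.
  have -> : (delta w (t w) + \sum_(b <- s w) delta (b :: w) (c w b *: (1 : E))) v =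
    delta w (t w) v + (\sum_(b <- s w) delta (b :: w) (c w b *: (1 : E))) v by [].
  apply: submoduleD => //.
    by rewrite /delta; case: ifP => _; [case: (ht w wn)|exact: submodule0].
  rewrite fct_sumE; apply: submodule_sum => // b _; rewrite /delta.
  by case: ifP => _; [exact: submoduleZ|exact: submodule0].
have dy' v : (n <= size v)%N -> bar_d y' v = y v.
  move=> nv; rewrite /bar_d /y' ext_sum //.
  rewrite (eq_bigr (fun w => bar_d1 w (t w) +
      \sum_(b <- s w) bar_d1 (b :: w) (c w b *: 1))); last first.
    move=> w _; rewrite extD //; last exact: finsup_delta.
    rewrite ext_delta ext_sum => [|b _]; last exact: finsup_delta.
    by congr (_ + _); apply: eq_bigr => b _; rewrite ext_delta.
  rewrite fct_sumE.
  rewrite (eq_bigr (fun w => if v == w then y w else 0)); last first.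
    move=> w /eqP wn.
    have -> : (bar_d1 w (t w) + \sum_(b <- s w) bar_d1 (b :: w) (c w b *: 1)) v =
      bar_d1 w (t w) v + (\sum_(b <- s w) bar_d1 (b :: w) (c w b *: 1)) v by [].
    rewrite fct_sumE bar_d1_top ?wn //; have [_ yw] := ht w wn.
    have e1 b : bar_d1 (b :: w) (c w b *: 1) v = if v == w then c w b *: gam [:: b] else 0.
      have [vn|vn] := eqVneq (size v) n.
        rewrite bar_d1_next /= ?wn ?vn // take0; case: ifP => // _.
        by rewrite linearZ /= sgn1 -scalerAl mul1r.
      rewrite bar_d1_top /= ?wn; last by rewrite ltn_neqAle eq_sym vn.
      have -> : v == w = false by apply: contra_neqF vn => /eqP ->; rewrite wn.
      by rewrite linearZ /= d1 scaler0; case: ifP.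
    under eq_bigr do rewrite e1.
    case: eqP => [_|_]; last by rewrite big1 ?addr0.
    by rewrite [RHS]yw addrC.
  rewrite big_mkcond /=.
  rewrite (eq_bigr (fun w => if v == w then y w else 0)); last first.
    move=> w _; case: eqP => // wn; case: eqP => // vw; rewrite yn //.
    by rewrite -vw ltn_neqAle nv andbT; apply/eqP => nE; apply: wn; rewrite -vw nE.
  by rewrite sum_pick // => /hX.
have fdy' : finsup (bar_d y') by apply: ext_finsup => //; exact: finsup_bar_d1.
have fNdy' : finsup (- bar_d y') by rewrite -scaleN1r; exact: finsupZ.
have [|w|w nw|||y2 [fy2' y2S hy2]] := IH (y - bar_d y').
- exact: finsupD.
- by apply: submoduleB => //; exact: bar_d_S.
- by rewrite [LHS]/(y w - bar_d y' w) dy' //; exact: subrr.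
- transitivity (bar_d y + bar_d (- bar_d y')); first exact: extD.
  transitivity (bar_d y + -1 *: bar_d (bar_d y')).
    by rewrite -scaleN1r; congr (_ + _); exact: extZ.
  by rewrite dy bar_d_bar_d // scaler0 addr0.
- rewrite [X in aug X]/(y [::] - bar_d y' [::]) rmorphB ay aug_bar_d //.
  exact: subrr.
exists (y2 + y'); split; first exact: finsupD.
  by move=> w; apply: submoduleD.
by rewrite [bar_d _]extD // -[ext _ y2]/(bar_d y2) -hy2 subrK.
Qed.

Lemma bar_d_unit (r : A) : bar_d (delta [::] (r *: (1 : E))) = 0.
Proof.
rewrite /bar_d ext_delta; apply/funext => v.
transitivity (bar_d1 [::] (r *: 1) v); first by [].
by rewrite bar_d1_top // linearZ /= d1 scaler0; case: ifP.
Qed.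

Lemma bar_exact y : finsup y -> (forall w, S (y w)) -> bar_d y = 0 -> aug (y [::]) = 0 ->
  exists y', [/\ finsup y', forall w, S (y' w), aug (y' [::]) = 0 & y = bar_d y'].
Proof.
move=> fy yS dy ay; have [X hX] := fy.
have [|y' [fy' y'S hy']] := @bar_exact_length (\max_(w <- X) size w).+1 y fy yS _ dy ay.
  move=> w hw; apply: hX; apply: contraL hw => wX; rewrite -leqNgt.
  by rewrite (big_rem w) //= leq_maxl.
have [e he] : exists e : A, pi e = aug (y' [::]) by case: k_residue => surj _; exact: surj.
have fe : finsup (delta ([::] : word) (- e *: (1 : E))) by exact: finsup_delta.
(* A scalar at the empty word is a cycle, so it can be used to make the augmentation of the
   primitive zero; the next lifting step needs this. *)
exists (y' + delta ([::] : word) (- e *: (1 : E))); split.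
- exact: finsupD.
- move=> w; apply: submoduleD => //; rewrite /delta; case: ifP => _.
    exact: submoduleZ.
  exact: submodule0.
- rewrite [X in aug X]/(y' [::] + - e *: 1) rmorphD augZ rmorph1 mulr1 rmorphN he.
  exact: subrr.
- by rewrite [bar_d _]extD // [X in _ = _ + X]bar_d_unit addr0.
Qed.

Section Lift.
Context (G : complex A) (al : G -> A) (G_res : resolves_residue al).

Let sum_d (f : G -> word -> E) (s : G) : word -> E :=
  \sum_(t <- cbasis G (cdeg s).-1) cd s t *: f t.

Let good n (f : G -> word -> E) :=
  (forall s, cdeg s = n -> finsup (f s) /\ forall w, S (f s w)) /\
  (forall s, cdeg s = n.+1 -> bar_d (sum_d f s) = 0 /\ aug (sum_d f s [::]) = 0).

Let sum_d_finsup f s : (forall t, cdeg t = (cdeg s).-1 -> finsup (f t)) -> finsup (sum_d f s).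
Proof.
move=> h; rewrite /sum_d big_seq; apply: finsup_sum => t; rewrite mem_cbasis => /eqP ts.
by apply: finsupZ; exact: h.
Qed.

Let sum_d_S f s w : (forall t, cdeg t = (cdeg s).-1 -> S (f t w)) -> S (sum_d f s w).
Proof.
move=> h; rewrite /sum_d fct_sumE big_seq; apply: submodule_sum => // t.
by rewrite mem_cbasis => /eqP ts; apply: submoduleZ => //; exact: h.
Qed.

Let bar_d_sum_d f s : (forall t, cdeg t = (cdeg s).-1 -> finsup (f t)) ->
  bar_d (sum_d f s) = sum_d (fun t => bar_d (f t)) s.
Proof.
move=> h; rewrite /bar_d /sum_d big_seq ext_sum => [|t]; last first.
  by rewrite mem_cbasis => /eqP ts; apply: finsupZ; exact: h.
rewrite [RHS]big_seq; apply: eq_bigr => t; rewrite mem_cbasis => /eqP ts.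
by rewrite extZ //; exact: h.
Qed.

Let aug_sum_d f s : aug (sum_d f s [::]) =
  \sum_(t <- cbasis G (cdeg s).-1) pi (cd s t) * aug (f t [::]).
Proof.
rewrite /sum_d fct_sumE rmorph_sum; apply: eq_bigr => t _.
by rewrite -augZ.
Qed.

Let good_step n f : good n f -> exists f', good n.+1 f' /\
  forall s, cdeg s = n.+1 -> bar_d (f' s) = sum_d f s.
Proof.
move=> [fok fd].
have /choice[f' hf'] : forall s, exists y, cdeg s = n.+1 ->
    [/\ finsup y, forall w, S (y w), aug (y [::]) = 0 & sum_d f s = bar_d y].
  move=> s; have [sn|] := pselect (cdeg s = n.+1); last by exists 0.
  have [||||y hy] := @bar_exact (sum_d f s); last by exists y.
  - by apply: sum_d_finsup => t; rewrite sn /= => /fok[].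
  - by move=> w; apply: sum_d_S => t; rewrite sn /= => /fok[].
  - by case: (fd s sn).
  - by case: (fd s sn).
exists f'; split; last by move=> s /hf'[].
split=> [s /hf'[]//|s sn]; split; last first.
  rewrite aug_sum_d big_seq big1 // => t; rewrite mem_cbasis sn => /eqP tn.
  by have [_ _ -> _] := hf' t tn; rewrite mulr0.
rewrite bar_d_sum_d => [|t]; last by rewrite sn => /hf'[].
transitivity (\sum_(t <- cbasis G n.+1) \sum_(u <- cbasis G n) (cd s t * cd t u) *: f u).
  rewrite /sum_d sn; apply: eq_big_seq => t; rewrite mem_cbasis => /eqP tn.
  have [_ _ _ <-] := hf' t tn; rewrite /sum_d tn scaler_sumr.
  by apply: eq_bigr => u _; rewrite scalerA.
rewrite exchange_big big_seq big1 //= => u; rewrite mem_cbasis => /eqP un.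
by rewrite -scaler_suml -un cdd scale0r.
Qed.

(** The comparison theorem: G is free and the bar construction exact. The first step is possible
    because the augmentation of a differential of G lies in m. *)
Lemma bar_lift : exists psi : G -> word -> E,
  [/\ forall s, finsup (psi s), forall s w, S (psi s w),
    forall s, cdeg s = 0 -> psi s = delta ([::] : word) (al s *: (1 : E)) &
    forall s, bar_d (psi s) = \sum_(t <- cbasis G (cdeg s).-1) cd s t *: psi t].
Proof.
pose f0 s : word -> E := delta ([::] : word) (al s *: (1 : E)).
have good0 : good 0 f0.
  split=> [s _|s s1].
    split=> [|w]; first exact: finsup_delta.
    by rewrite /f0 /delta; case: ifP => _; [exact: submoduleZ|exact: submodule0].
  rewrite bar_d_sum_d => [|t _]; last exact: finsup_delta.
  split; first by rewrite /sum_d big1 // => t _; rewrite bar_d_unit scaler0.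
  have e0 : supported 0 (fun t => cd s t : A^o).
    by move=> t t0; suff: cd s t = 0 by []; apply: cd_deg; rewrite s1 eqSS eq_sym.
  have : maximal_ideal (\sum_(t <- cbasis G 0) al t * cd s t).
    apply/(rr_exact0 G_res e0); exists (fun t => if t == s then 1 else 0 : A^o).
    apply/funext => t; rewrite /del.
    have [st|st] := eqVneq (cdeg s) (cdeg t).+1.
      rewrite (bigD1_seq s) ?cbasis_uniq ?mem_cbasis ?st //= eqxx big1 => [|u us].
        by rewrite addr0; exact/esym/mulr1.
      by rewrite (negbTE us) scaler0.
    rewrite cd_deg // big_seq big1 // => u; rewrite mem_cbasis => /eqP ut.
    by case: eqP => [us|_]; [rewrite -us ut eqxx in st|rewrite scaler0].
  move=> /(residue0 k_residue); rewrite rmorph_sum aug_sum_d s1 => hh; rewrite -[RHS]hh.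
  apply: eq_bigr => t _; rewrite rmorphM mulrC; congr (_ * _).
  by rewrite /f0 /delta /= augZ rmorph1 mulr1.
(* The stage for degree n is a function on all of G that matters only in degree n; the lift is read
   off on the diagonal [f (cdeg s) s]. *)
have /choice[next nextP] : forall p : nat * (G -> word -> E), exists f',
    good p.1 p.2 -> good p.1.+1 f' /\ forall s, cdeg s = p.1.+1 -> bar_d (f' s) = sum_d p.2 s.
  move=> [n f]; have [gf|] := pselect (good n f); last by exists f.
  by have [f' hf'] := good_step gf; exists f'.
pose f := fix f n := if n is n'.+1 then next (n', f n') else f0.
have gf n : good n (f n).
  by elim: n => [|n IH] //=; have [] := nextP (n, f n) IH.
exists (fun s => f (cdeg s) s); split.
- by move=> s; case: (gf (cdeg s)) => /(_ s erefl)[].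
- by move=> s w; case: (gf (cdeg s)) => /(_ s erefl)[].
- by move=> s ->.
move=> s; case sn: (cdeg s) => [|n].
  rewrite /= bar_d_unit big_seq big1 // => t; rewrite mem_cbasis => /eqP t0.
  by rewrite cd_deg ?scale0r // sn.
have [_ ->] // := nextP (n, f n) (gf n).
rewrite /sum_d sn; apply: eq_big_seq => t.
by rewrite mem_cbasis => /eqP ->.
Qed.

(** Lift to the bar construction, then apply [tail]; on the empty word [tail] gives the Massey value
    of b alone. *)
Lemma chain_map b : exists phi : G -> E,
  [/\ forall s, S (phi s), forall s, cdeg s = 0 -> phi s = al s *: gam [:: b] &
    forall s, d (phi s) = - \sum_(t <- cbasis G (cdeg s).-1) cd s t *: phi t].
Proof.
have [psi [fpsi Spsi psi0 dpsi]] := bar_lift.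
exists (fun s => tail b (psi s)); split=> [s|s s0|s].
- case: (fpsi s) => X hX; rewrite /tail (extE _ hX); apply: submodule_sum => // w _.
  by apply: SM; [exact: Ssgn|apply: gamS; case: (w)].
- rewrite psi0 // /tail ext_delta /= /tail_map linearZ /= sgn1 -scalerAl mul1r.
  by [].
rewrite d_tail // dpsi /tail ext_sum => [|t _]; last exact: finsupZ.
by congr (- _); apply: eq_bigr => t _; rewrite extZ.
Qed.

End Lift.
End Words.

(** * The subalgebra of an acyclic closure generated up to degree q *)

Section GeneratedUpto.
Context (A : comUnitRingType) (k : fieldType) (pi : {rmorphism A -> k}).
Context (E : acyclic_closure pi) (q : nat).

Local Notation e := (ac_num E).
Local Notation dp := (@ac_dp A k pi E).
Local Notation S := (generated_upto dp q).
Local Notation d := (dg_d E).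
Local Notation aug := (dg_aug E).
Local Notation comp := (dg_comp E).
Local Notation hom n a := (dg_hom (d := E) n a).
Local Notation var := (variable e).
Local Notation expo := (exponent e).
Local Notation mon := (monomial dp).

Lemma generated_subalgebra n : is_subalgebra (generated_upto dp n).
Proof.
split=> [T [T1 _ _ _] _ //|a b Sa Sb T Ts|r a Sa T Ts|a b Sa Sb T Ts] Td.
- by case: (Ts) => _ TD _ _; apply: TD; [exact: Sa|exact: Sb].
- by case: (Ts) => _ _ TZ _; apply: TZ; exact: Sa.
- by case: (Ts) => _ _ _ TM; apply: TM; [exact: Sa|exact: Sb].
Qed.

Lemma generated1 : S 1. Proof. by case: (generated_subalgebra q). Qed.

Lemma generated_submodule n : is_submodule (generated_upto dp n).
Proof.
case: (generated_subalgebra n) => S1 SD SZ _; split=> //.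
by rewrite -(scale0r (1 : E)); exact: SZ.
Qed.

Lemma generatedM n a b : generated_upto dp n a -> generated_upto dp n b ->
  generated_upto dp n (a * b).
Proof. by case: (generated_subalgebra n) => _ _ _; apply. Qed.

Lemma generated_dp n x j : (vdeg x <= n)%N -> (odd (vdeg x) -> (j <= 1)%N) ->
  generated_upto dp n (dp x j).
Proof. by move=> xn xj T _; apply. Qed.

Lemma generatedW n a : (n <= q)%N -> generated_upto dp n a -> S a.
Proof.
move=> nq; apply; first exact: generated_subalgebra.
by move=> x j xn xj; apply: generated_dp => //; exact: leq_trans nq.
Qed.

Lemma generated_ind (T : set E) : is_subalgebra T ->
  (forall x j, (vdeg x <= q)%N -> (odd (vdeg x) -> (j <= 1)%N) -> T (dp x j)) ->
  forall a, S a -> T a.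
Proof. by move=> Ts Td a; apply. Qed.

Lemma generated_comp a n : S a -> S (comp n a).
Proof.
have Ssub := generated_submodule q.
suff : S a -> forall n, S (comp n a) by move=> h /h.
apply: (generated_ind (T := [set a | forall n, S (comp n a)])) => /=; first split=> /=.
- move=> i; rewrite (hom_comp _ (dg_hom1 E)); case: ifP => _; first exact: generated1.
  exact: (submodule0 Ssub).
- by move=> b c hb hc i; rewrite linearD; exact: (submoduleD Ssub (hb i) (hc i)).
- by move=> r b hb i; rewrite linearZ /=; exact: (submoduleZ Ssub r (hb i)).
- move=> b c hb hc i.
  have [N [_ ->]] := dg_comp_sum b; have [N' [_ ->]] := dg_comp_sum c.
  rewrite mulr_suml linear_sum; apply: (submodule_sum Ssub) => j _.
  rewrite mulr_sumr linear_sum; apply: (submodule_sum Ssub) => l _ /=.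
  rewrite (hom_comp _ (dg_homM (comp_hom j b) (comp_hom l c))).
  by case: ifP => _; [exact: (generatedM (hb _) (hc _))|exact: (submodule0 Ssub)].
move=> x j xq xj i; rewrite (hom_comp _ (ac_dp_hom xj)).
by case: ifP => _; [exact: generated_dp|exact: (submodule0 Ssub)].
Qed.

Lemma generated_sgn a : S a -> S (sgn a).
Proof.
have Ssub := generated_submodule q.
move=> Sa; have [N [hN _]] := dg_comp_sum a.
rewrite /sgn (bar_sum hN); apply: (submoduleN Ssub); apply: (submodule_sum Ssub) => i _.
rewrite -signr_odd mulr_sign; case: (odd _); last exact: (generated_comp _ Sa).
exact: (submoduleN Ssub (generated_comp _ Sa)).
Qed.

Lemma vdeg_gt0 (x : var) : (0 < vdeg x)%N.
Proof.
case: x => n i; rewrite /vdeg /=; case: n i => // i.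
by case: i => i; rewrite (ac_num0 E).
Qed.

Lemma generated_d_var x : (vdeg x <= q)%N -> S (d (dp x 1)).
Proof.
have Ssub := generated_submodule q.
have := vdeg_gt0 x; case: x => n i; rewrite /vdeg /= => n0 nq.
case: n i n0 nq => [|[|n]] i // _ nq.
  have [/(_ i)[r _ rE] _ _] := ac_kill1 E.
  by rewrite -[d _]/(variable_d dp i) -rE; exact: (submoduleZ Ssub _ generated1).
have [/(_ i)[Sd _ _] _ _] := ac_kill E (isT : (1 <= n.+1)%N).
by apply: generatedW Sd; rewrite ltnW.
Qed.

Lemma generated_d a : S a -> S (d a).
Proof.
have Ssub := generated_submodule q.
(* The Leibniz rule involves the factors as well as their differentials, so both memberships are
   carried through the induction. *)
move=> Sa; suff [] : S a /\ S (d a) by [].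
apply: (generated_ind (T := [set a | S a /\ S (d a)])) Sa => /=; first split=> /=.
- by split; [exact: generated1|rewrite d1; exact: (submodule0 Ssub)].
- by move=> b c [Sb db] [Sc dc]; rewrite linearD; split; exact: (submoduleD Ssub).
- by move=> r b [Sb db]; rewrite linearZ /=; split; exact: (submoduleZ Ssub).
- move=> b c [Sb db] [Sc dc]; rewrite dM; split; first exact: (generatedM Sb Sc).
  exact: (submoduleD Ssub (generatedM db Sc) (generatedM (generated_sgn Sb) dc)).
move=> x j xq xj; split; first exact: generated_dp.
case: j xj => [|j] xj; first by rewrite ac_dp0 d1; exact: (submodule0 Ssub).
have [xo|xe] := boolP (odd (vdeg x)).
  by have := xj xo; rewrite ltnS leqn0 => /eqP ->; exact: generated_d_var.
rewrite ac_dp_d //; apply: (generatedM (generated_d_var xq)).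
by apply: generated_dp => //; rewrite (negbTE xe).
Qed.

Definition good (m : expo) := normal m /\ forall x, m x <> 0%N -> (vdeg x <= q)%N.

Definition mdeg (m : expo) := (\sum_(x <- finsupp m) m x * vdeg x)%N.

Lemma prod_hom (s : seq var) (f : var -> E) (g : var -> nat) :
  (forall x, x \in s -> hom (g x) (f x)) ->
  hom (\sum_(x <- s) g x)%N (\prod_(x <- s) f x).
Proof.
elim: s => [|x s IH] h; first by rewrite !big_nil; exact: dg_hom1.
rewrite !big_cons; apply: dg_homM; first by apply: h; rewrite mem_head.
by apply: IH => y ys; apply: h; rewrite inE ys orbT.
Qed.

Lemma perm_prod (s s' : seq var) (f : var -> E) (g : var -> nat) :
  (forall x, x \in s -> hom (g x) (f x)) -> perm_eq s s' ->
  exists b : bool, \prod_(x <- s) f x = (-1) ^+ b * \prod_(x <- s') f x.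
Proof.
elim: s s' => [|x s IH] s' h ps.
  have /perm_nilP -> : perm_eq s' [::] by rewrite perm_sym.
  by exists false; rewrite mul1r.
have xs' : x \in s' by rewrite -(perm_mem ps) mem_head.
case/splitPr: xs' ps => s1 s2 ps.
have ps' : perm_eq s (s1 ++ s2).
  rewrite -(perm_cons x); apply: (perm_trans ps).
  by rewrite -[x :: s2]cat1s perm_catCA.
have hs y : y \in s -> hom (g y) (f y) by move=> ys; apply: h; rewrite inE ys orbT.
have hx : hom (g x) (f x) by apply: h; rewrite mem_head.
have [b hb] := IH _ hs ps'.
have h1 : hom (\sum_(y <- s1) g y)%N (\prod_(y <- s1) f y).
  by apply: prod_hom => y ys; apply: hs; rewrite (perm_mem ps') mem_cat ys.
exists (b (+) odd ((\sum_(y <- s1) g y) * g x)%N).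
rewrite big_cons hb big_cat [in RHS]big_cat big_cons /= signM signr_addb -mulrA.
congr (_ * _); rewrite [X in _ = _ * X]mulrA (dg_mulC h1 hx) signr_odd -mulrA [RHS]mulrA.
by rewrite -exprD addnn -signr_odd odd_double mul1r !mulrA.
Qed.

Lemma monomial_extract (m : expo) x : normal m -> exists b : bool,
  mon m = (-1) ^+ b * (dp x (m x) * \prod_(y <- finsupp m | y != x) dp y (m y)).
Proof.
move=> nm; have hm y : hom (m y * vdeg y) (dp y (m y)).
  by apply: ac_dp_hom => /nm.
have [xm|xm] := boolP (x \in finsupp m).
  have ps : perm_eq (finsupp m) (x :: [seq y <- finsupp m | y != x]).
    rewrite -rem_filter ?fset_uniq //; exact: perm_to_rem.
  have [b hb] := perm_prod (f := fun y => dp y (m y)) (g := fun y => (m y * vdeg y)%N)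
    (fun y _ => hm y) ps.
  by exists b; rewrite /monomial hb big_cons big_filter.
exists false; rewrite mul1r fsfun_dflt // ac_dp0 mul1r.
rewrite /monomial big_seq [RHS]big_seq_cond; apply: eq_bigl => y.
by case ym: (y \in _) => //=; apply/esym; apply: contraTneq ym => ->.
Qed.

Definition span (P : expo -> Prop) : set E := [set a | exists r : seq (A * expo),
  (forall p, p \in r -> P p.2) /\ a = \sum_(p <- r) p.1 *: mon p.2].

Lemma span_submodule P : is_submodule (span P).
Proof.
split=> [|_ _ [r [hr ->]] [r' [hr' ->]]|a _ [r [hr ->]]].
- by exists [::]; rewrite big_nil.
- exists (r ++ r'); rewrite big_cat; split=> // p.
  by rewrite mem_cat => /orP[/hr|/hr'].
- exists [seq (a * p.1, p.2) | p <- r]; split; first by move=> _ /mapP[p /hr ? ->].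
  by rewrite big_map scaler_sumr; apply: eq_bigr => p _; rewrite scalerA.
Qed.

Lemma span_monomial (P : expo -> Prop) m : P m -> span P (mon m).
Proof.
move=> Pm; exists [:: (1, m)]; rewrite big_seq1 scale1r; split=> // p.
by rewrite inE => /eqP ->.
Qed.

(** For even x the divided powers multiply with a binomial coefficient. For odd x, either x already
    occurs and the square is zero, or its exponent becomes 1. Moving x to the front costs a sign
    only. *)
Lemma span_dpM x j m : (vdeg x <= q)%N -> (odd (vdeg x) -> (j <= 1)%N) ->
  good m -> span good (dp x j * mon m).
Proof.
have Psub := span_submodule good.
move=> xq xj gm; have [b ->] := monomial_extract x gm.1.
rewrite signM -signr_odd mulr_sign mulrA.
set P := \prod_(y <- _ | _) _.
suff h : span good (dp x j * dp x (m x) * P).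
  by case: (odd b) => //; exact: (submoduleN Psub).
have [->|j0] := eqVneq j 0.
  rewrite ac_dp0 mul1r; have [b' bm] := monomial_extract x gm.1.
  have := span_monomial gm; rewrite bm -signr_odd mulr_sign -/P.
  by case: (odd b') => // /(submoduleN Psub); rewrite opprK.
pose m' : expo := [fsfun m with x |-> (j + m x)%N].
have m'E y : m' y = if y == x then (j + m x)%N else m y.
  by rewrite fsfun_withE.
have goodm' : (odd (vdeg x) -> (j + m x <= 1)%N) -> good m'.
  move=> h; split=> y.
    by rewrite m'E; case: eqP => [-> /h //|_]; exact: gm.1.
  by rewrite m'E; case: eqP => [-> //|_]; exact: gm.2.
have mon_m' (C : nat) : good m' -> span good (C%:R * dp x (j + m x) * P).
  move=> gm'; have [b1 hb1] := monomial_extract x gm'.1.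
  have hm' y : hom (m' y * vdeg y) (dp y (m' y)).
    by apply: ac_dp_hom => /gm'.1.
  have ps : perm_eq [seq y <- finsupp m' | y != x] [seq y <- finsupp m | y != x].
    apply: uniq_perm; rewrite ?filter_uniq ?fset_uniq // => y.
    rewrite !mem_filter !mem_finsupp m'E; by case: eqP.
  have [b2 hb2] := perm_prod (f := fun y => dp y (m' y)) (g := fun y => (m' y * vdeg y)%N)
    (fun y _ => hm' y) ps.
  have PE : P = \prod_(y <- finsupp m | y != x) dp y (m' y).
    by apply: eq_bigr => y yx; rewrite m'E (negbTE yx).
  have := span_monomial gm'; rewrite hb1 -[in X in span _ X]big_filter hb2 big_filter -PE.
  rewrite m'E eqxx signM mulrA -exprD -signr_odd mulr_sign => h.
  rewrite -mulrA mulr_natl -scaler_nat.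
  apply: (submoduleZ Psub); move: h; case: (odd _) => // /(submoduleN Psub).
  by rewrite opprK.
have [xo|xe] := boolP (odd (vdeg x)); last first.
  by rewrite ac_dpM //; apply: mon_m'; apply: goodm' => xo; rewrite xo in xe.
have j1 : j = 1%N by apply/eqP; rewrite eqn_leq xj // lt0n.
have [mx|mx] := eqVneq (m x) 0%N; last first.
  have -> : m x = 1%N by apply/eqP; rewrite eqn_leq gm.1 // lt0n.
  have h : hom (1 * vdeg x) (dp x 1) by exact: ac_dp_hom.
  rewrite j1 (dg_sqr_odd _ h) ?mul1n // mul0r; exact: (submodule0 Psub).
have := mon_m' 1%N; rewrite mx ac_dp0 mulr1 addn0 mul1r; apply.
by apply: goodm' => _; rewrite mx addn0 j1.
Qed.

Lemma good0 : good [fsfun].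
Proof. by split=> x; rewrite fsfunE. Qed.

Lemma monomial0 : mon [fsfun] = 1.
Proof. by rewrite /monomial finsupp0 big_seq_fset0. Qed.

(** The elements that multiply the span into itself form a subalgebra, it contains the generators of
    S, and a is its own product with the monomial 1. *)
Lemma generated_span a : S a -> span good a.
Proof.
have Psub := span_submodule good.
move=> Sa; suff h : forall b, span good b -> span good (a * b).
  by rewrite -[a]mulr1; apply: h; rewrite -monomial0; exact: span_monomial good0.
apply: (generated_ind (T := [set a | forall b, span good b -> span good (a * b)])) Sa => /=.
  split=> /=.
  - by move=> b; rewrite mul1r.
  - move=> c c' hc hc' b sb; rewrite mulrDl; exact: (submoduleD Psub (hc _ sb) (hc' _ sb)).
  - move=> r c hc b sb; rewrite -scalerAl; exact: (submoduleZ Psub r (hc _ sb)).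
  - by move=> c c' hc hc' b sb; rewrite -mulrA; apply/hc/hc'.
move=> x j xq xj b [r [hr ->]]; rewrite mulr_sumr big_seq.
apply: (submodule_sum Psub) => p pr; rewrite -scalerAr.
by apply: (submoduleZ Psub); apply: span_dpM => //; exact: hr.
Qed.

Lemma monomial_hom m : good m -> hom (mdeg m) (mon m).
Proof. by move=> gm; apply: prod_hom => x _; apply: ac_dp_hom => /gm.1. Qed.

Lemma monomial_generated m : good m -> S (mon m).
Proof.
move=> gm; rewrite /monomial; set s := finsupp m : seq var.
have : forall x, x \in s -> m x <> 0%N by move=> x; rewrite mem_finsupp => /eqP.
elim: s => [|x s IH] h; first by rewrite big_nil; exact: generated1.
rewrite big_cons; apply: generatedM.
  by apply: generated_dp; [apply/gm.2/h; rewrite mem_head|exact: gm.1].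
by apply: IH => y ys; apply: h; rewrite inE ys orbT.
Qed.

Lemma monomial_free (X : seq expo) (c : expo -> A) : uniq X ->
  (forall m, m \in X -> good m) -> \sum_(m <- X) c m *: mon m = 0 ->
  forall m, m \in X -> c m = 0.
Proof.
move=> uX gX sX m mX; have [_ free] := ac_basis E.
pose f : {fsfun expo -> A with 0} := [fsfun m in seq_fset tt X => c m | 0].
have fE m' : f m' = if m' \in X then c m' else 0.
  by rewrite /f fsfunE seq_fsetE.
suff : forall m, f m = 0 by move=> /(_ m); rewrite fE mX.
apply: free; first by move=> m'; rewrite fE; case: ifP => // /gX[].
rewrite -[RHS]sX /lincomb.
rewrite (big_fset_incl _ (B := seq_fset tt X)); first last.
- by move=> m' _; rewrite mem_finsupp negbK => /eqP ->; rewrite scale0r.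
- apply/fsubsetP => m'; rewrite mem_finsupp fE. by rewrite seq_fsetE; case: ifP => //; rewrite eqxx.
rewrite (perm_big X); last first.
  by apply: uniq_perm => [||m']; rewrite ?fset_uniq ?seq_fsetE.
by apply: eq_big_seq => m' m'X; rewrite fE m'X.
Qed.

Lemma mdeg_ge (m : expo) x : (m x <= mdeg m)%N.
Proof.
have [xm|xm] := boolP (x \in finsupp m); last by rewrite fsfun_dflt.
rewrite /mdeg (big_rem x) //= (leq_trans _ (leq_addr _ _)) // leq_pmulr //.
exact: vdeg_gt0.
Qed.

Local Notation low_var := {i : 'I_q.+1 & 'I_(e i)}.

Let low (t : low_var) : var := Tagged (fun n => 'I_(e n)) (tagged t).

(** Variables have positive degree, so in degree n every exponent is at most n; as only finitely
    many variables have degree at most q, this exponent vector gives the polynomial bound. *)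
Let code n (m : expo) : {ffun low_var -> 'I_n.+1} := [ffun t => inord (m (low t))].

Let code_inj n m m' : good m -> mdeg m = n -> good m' -> mdeg m' = n ->
  code n m = code n m' -> m = m'.
Proof.
move=> gm mn gm' mn' cm; apply/fsfunP => x.
have [xq|xq] := leqP (vdeg x) q; last first.
  have z (m0 : expo) : good m0 -> m0 x = 0%N.
    move=> [_ h]; apply: contrapT => /h; apply/negP; by rewrite -ltnNge.
  by rewrite !z.
have [t ->] : exists t, x = low t.
  case: x xq => n0 i /= n0q.
  by exists (Tagged (fun j : 'I_q.+1 => 'I_(e j)) (i : 'I_(e (Ordinal (n0q : n0 < q.+1)%N)))).
have := congr1 (fun f : {ffun low_var -> 'I_n.+1} => nat_of_ord (f t)) cm.
by rewrite /= !ffunE !inordK // ltnS ?(leq_trans (mdeg_ge m _)) ?(leq_trans (mdeg_ge m' _)) ?mn ?mn'.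
Qed.

Lemma monomial_enum n : exists X : seq expo, [/\ uniq X,
  forall m, (m \in X) <-> good m /\ mdeg m = n &
  (size X <= n.+1 ^ #|{: low_var}|)%N].
Proof.
(* A partial inverse of [code]; listing its values enumerates the monomials of degree n without
   repetition. *)
have /choice[g hg] : forall f : {ffun low_var -> 'I_n.+1}, exists o : option expo,
    match o with
    | Some m => [/\ good m, mdeg m = n & code n m = f]
    | None => forall m, good m -> mdeg m = n -> code n m <> f
    end.
  move=> f; have [[m hm]|h] := pselect (exists m, [/\ good m, mdeg m = n & code n m = f]).
    by exists (Some m).
  by exists None => m gm mn mf; apply: h; exists m.
exists (pmap g (enum {: {ffun low_var -> 'I_n.+1}})); split.
- apply: (@pmap_uniq _ _ g (code n)); last exact: enum_uniq.
  by move=> f; have := hg f; case: (g f) => //= m [].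
- move=> m; rewrite mem_pmap; split.
    by move=> /mapP[f _ fm]; have := hg f; rewrite -fm => -[].
  move=> [gm mn]; apply/mapP; exists (code n m); first by rewrite mem_enum.
  have := hg (code n m); case: (g _) => [m' [gm' mn' /code_inj]|/(_ m gm mn)//].
  by move=> /(_ gm' mn' gm mn) ->.
- rewrite size_pmap (leq_trans (count_size _ _)) // -cardE card_ffun.
  by rewrite card_ord.
Qed.

(** S is free with polynomially growing ranks. Indices are plain naturals, meaningful below [r n],
    which avoids dependent types in the coordinates later. *)
Lemma generated_basis : exists (r : nat -> nat) (u : nat -> nat -> E) (v : nat),
  [/\ forall n, (r n <= n.+1 ^ v)%N,
    forall n i, (i < r n)%N -> S (u n i) /\ hom n (u n i),
    forall n a, S a -> hom n a -> exists c : nat -> A, a = \sum_(i < r n) c i *: u n i &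
    forall n (c : nat -> A), \sum_(i < r n) c i *: u n i = 0 -> forall i, (i < r n)%N -> c i = 0].
Proof.
have /choice[X hX] := monomial_enum.
exists (fun n => size (X n)), (fun n i => mon (nth [fsfun] (X n) i)), #|{: low_var}|.
have Xn n m : m \in X n -> good m /\ mdeg m = n by case: (hX n) => _ /(_ m)[h _] _ /h.
split=> [n|n i iX|n a Sa an|n c].
- by case: (hX n).
- have [gm mn] := Xn n _ (mem_nth [fsfun] iX).
  by split; [exact: monomial_generated|rewrite -[X in hom X _]mn; exact: monomial_hom].
- have [r [hr aE]] := generated_span Sa.
  pose c m : A := \sum_(p <- r | p.2 == m) p.1.
  exists (fun i => c (nth [fsfun] (X n) i)).
  rewrite -(big_mkord xpredT (fun i => c (nth [fsfun] (X n) i) *: mon (nth [fsfun] (X n) i))).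
  rewrite -(big_nth [fsfun] xpredT (fun m => c m *: mon m)).
  rewrite -an aE linear_sum big_seq.
  rewrite (eq_bigr (fun p : A * expo => \sum_(m <- X n | p.2 == m) p.1 *: mon m)); last first.
    move=> p pr; rewrite linearZ /= (hom_comp _ (monomial_hom (hr p pr))).
    have [mn|mn] := eqVneq n (mdeg p.2).
      have [uX inX _] := hX n.
      rewrite -big_filter (eq_filter (a2 := pred1 p.2)) => [|m]; last by rewrite /= eq_sym.
      rewrite filter_pred1_uniq // ?big_seq1 //.
      by apply/inX; split=> //; exact: hr.
    rewrite scaler0 big_seq_cond big1 // => m /andP[/Xn[_ mm] /eqP pm].
    by rewrite pm mm eqxx in mn.
  rewrite -big_seq (exchange_big_dep xpredT) //=; apply: eq_bigr => m _.
  by rewrite scaler_suml.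
move=> h i iX; have [uX _ _] := hX n.
pose c' m := c (index m (X n)).
have := @monomial_free (X n) c' uX (fun m mX => (Xn n m mX).1) _ _ (mem_nth [fsfun] iX).
rewrite /c' index_uniq //; apply.
rewrite -[RHS]h -(big_mkord xpredT (fun i => c i *: mon (nth [fsfun] (X n) i))).
rewrite (big_nth [fsfun]); apply: eq_big_nat => j /= jX.
by rewrite index_uniq.
Qed.

Lemma one_free (r : A) : r *: (1 : E) = 0 -> r = 0.
Proof.
move=> h; apply: (@monomial_free [:: [fsfun]] (fun=> r) _ _ _ [fsfun]); rewrite ?mem_head //.
  by move=> m; rewrite inE => /eqP ->; exact: good0.
by rewrite big_seq1 monomial0.
Qed.

Lemma generated_degree0 a : S a -> hom 0 a -> exists r : A, a = r *: 1.
Proof.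
move=> Sa a0; have [r [hr aE]] := generated_span Sa.
exists (\sum_(p <- r | mdeg p.2 == 0%N) p.1).
rewrite scaler_suml -a0 aE linear_sum [RHS]big_mkcond /= big_seq [RHS]big_seq.
apply: eq_bigr => p pr; rewrite linearZ /= (hom_comp _ (monomial_hom (hr p pr))).
rewrite eq_sym; case: eqP => [m0|_]; last exact: scaler0.
have -> : p.2 = [fsfun].
  by apply/fsfunP => x; rewrite fsfunE; move: (mdeg_ge p.2 x); rewrite m0 leqn0 => /eqP.
by rewrite monomial0.
Qed.

End GeneratedUpto.

(** * Null-homotopies on resolutions of the residue field *)

Section ResolutionKilled.
Context (A : comUnitRingType) (X : complex A) (al : X -> A).
Context (X_res : resolves_residue al) (a : A) (am : maximal_ideal a).

Let unit_chain (t : X) : X -> A^o := fun s => if t == s then a else 0.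

Let del_unit_chain t u : del (unit_chain t) u = a * cd t u.
Proof.
rewrite /del; have [tu|tu] := eqVneq (cdeg t) (cdeg u).+1.
  rewrite (bigD1_seq t) ?cbasis_uniq ?mem_cbasis ?tu //= /unit_chain eqxx big1 => [|v vt].
    by rewrite addr0; exact: mulrC.
  by rewrite eq_sym (negbTE vt) scaler0.
rewrite cd_deg // mulr0 big_seq big1 // => v; rewrite mem_cbasis => /eqP vu.
by rewrite /unit_chain; case: eqP => [tv|_]; [rewrite tv vu eqxx in tu|rewrite scaler0].
Qed.

(** What the homotopy on t has to bound: a times t minus the homotopy already chosen on the
    differential of t. *)
Let defect (f : X -> X -> A^o) t : X -> A^o :=
  unit_chain t - \sum_(v <- cbasis X (cdeg t).-1) cd t v *: f v.

Let good n (f : X -> X -> A^o) :=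
  (forall t, cdeg t = n -> supported n.+1 (f t)) /\
  (forall t, cdeg t = n.+1 -> del (defect f t) = 0).

Let defect_supported n f t : cdeg t = n.+1 ->
  (forall t, cdeg t = n -> supported n.+1 (f t)) -> supported n.+1 (defect f t).
Proof.
move=> tn fn u un; rewrite /defect.
have -> : (unit_chain t - \sum_(v <- cbasis X (cdeg t).-1) cd t v *: f v) u =
  unit_chain t u - (\sum_(v <- cbasis X (cdeg t).-1) cd t v *: f v) u by [].
rewrite fct_sumE big_seq big1 => [|v]; last first.
  rewrite mem_cbasis tn /= => /eqP vn; rewrite [LHS]/(cd t v *: f v u) fn //; exact: scaler0.
by rewrite subr0 /unit_chain; case: (t =P u) un => [<-|//]; rewrite tn eqxx.
Qed.

Let good_next n f f' : (forall t, cdeg t = n.+1 -> del (f' t) = defect f t) ->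
  forall t, cdeg t = n.+2 -> del (defect f' t) = 0.
Proof.
move=> hf t tn; rewrite linearB /= linear_sum.
have -> : \sum_(v <- cbasis X (cdeg t).-1) del (cd t v *: f' v) =
    \sum_(v <- cbasis X (cdeg t).-1) cd t v *: unit_chain v -
    \sum_(v <- cbasis X n.+1) \sum_(w <- cbasis X n) (cd t v * cd v w) *: f w.
  rewrite tn /= -sumrB; apply: eq_big_seq => v; rewrite mem_cbasis => /eqP vn.
  rewrite linearZ /= hf // scalerBr; congr (_ - _); rewrite vn scaler_sumr.
  by apply: eq_bigr => w _; rewrite scalerA.
rewrite exchange_big [X in _ - (_ - X)]big_seq [X in _ - (_ - X)]big1 => [|w]; last first.
  by rewrite mem_cbasis => /eqP wn; rewrite -scaler_suml -wn cdd scale0r.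
rewrite subr0; apply/eqP; rewrite subr_eq0; apply/eqP/funext => u.
rewrite del_unit_chain fct_sumE.
have [tu|tu] := eqVneq (cdeg t) (cdeg u).+1.
  rewrite tu /= (bigD1_seq u) ?cbasis_uniq ?mem_cbasis //= big1 => [|v vu].
    by rewrite addr0 [RHS]/(_ * _) /unit_chain eqxx; exact: mulrC.
  by rewrite [LHS]/(_ * _) /unit_chain (negbTE vu); exact: mulr0.
have c0 : cd t u = 0 by exact: cd_deg.
rewrite c0 mulr0 big1 // => v _; rewrite [LHS]/(_ * _) /unit_chain.
by case: (v =P u) => [->|_]; [rewrite c0; exact: mul0r|exact: mulr0].
Qed.

(** Multiplication by a is zero on k, hence null-homotopic on a resolution; the homotopy is built
    degree by degree, as each defect is a cycle in positive degree. *)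
Lemma resolution_homotopy : exists h : X -> X -> A, forall s t, cdeg s = cdeg t ->
  \sum_(u <- cbasis X (cdeg t).+1) h s u * cd u t +
  \sum_(u <- cbasis X (cdeg t).-1) cd s u * h u t = if s == t then a else 0.
Proof.
have /choice[f0 hf0] : forall t, exists y : X -> A^o, cdeg t = 0 ->
    supported 1 y /\ del y = unit_chain t.
  move=> t; have [t0|] := pselect (cdeg t = 0); last by exists 0.
  have u0 : supported 0 (unit_chain t).
    by move=> u un; rewrite /unit_chain; case: (t =P u) un => [<-|//]; rewrite t0.
  have [|y hy] := (rr_exact0 X_res u0).1 _.
    rewrite (bigD1_seq t) ?cbasis_uniq ?mem_cbasis ?t0 //= big1 => [|u ut].
      by rewrite addr0 /unit_chain eqxx; exact: maximal_idealM.
    by rewrite /unit_chain eq_sym (negbTE ut) mulr0.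
  exists (truncate 1 y) => _; split; first exact: supported_truncate.
  by apply/funext => u; rewrite del_truncate -hy; case: eqP => // /eqP /u0.
have good0 : good 0 f0.
  split=> [t /hf0[]//|t t1]; rewrite linearB /= linear_sum /= t1.
  apply/funext => u; rewrite [LHS]/(del (unit_chain t) u - _ u) fct_sumE.
  rewrite (eq_big_seq (fun v => cd t v * unit_chain v u)) => [|v]; last first.
    by rewrite mem_cbasis => /eqP v0; rewrite linearZ /=; have [_ ->] := hf0 v v0.
  rewrite del_unit_chain; have [u0|u0] := eqVneq (cdeg u) 0.
    rewrite (bigD1_seq u) ?cbasis_uniq ?mem_cbasis ?u0 //= big1 => [|v vu].
      by rewrite addr0 /unit_chain eqxx mulrC; exact: subrr.
    by rewrite /unit_chain (negbTE vu) mulr0.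
  rewrite cd_deg ?t1 ?eqSS 1?eq_sym // mulr0 big_seq big1 => [|v]; first exact: subr0.
  rewrite mem_cbasis => /eqP v0; rewrite /unit_chain; case: eqP => [vu|_]; last by rewrite mulr0.
  by rewrite -vu v0 in u0.
have /choice[next nextP] : forall p : nat * (X -> X -> A^o), exists f',
    good p.1 p.2 -> good p.1.+1 f' /\ forall s, cdeg s = p.1.+1 -> del (f' s) = defect p.2 s.
  move=> [n f]; have [[fn fd]|] := pselect (good n f); last by exists f.
  have /choice[f' hf'] : forall t, exists y : X -> A^o, cdeg t = n.+1 ->
      supported n.+2 y /\ del y = defect f t.
    move=> t; have [tn|] := pselect (cdeg t = n.+1); last by exists 0.
    have [y hy] := rr_exact X_res (defect_supported tn fn) (fd t tn).
    exists (truncate n.+2 y) => _; split; first exact: supported_truncate.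
    apply/funext => u; rewrite del_truncate -hy; case: eqP => // /eqP un.
    by rewrite (defect_supported tn fn).
  exists f' => _; split; last by move=> s /hf'[].
  split; first by move=> t /hf'[].
  by apply: (@good_next n f) => t tn; case: (hf' t tn).
pose f := fix f n := if n is n'.+1 then next (n', f n') else f0.
have gf n : good n (f n) by elim: n => [|n IH] //=; have [] := nextP (n, f n) IH.
exists (fun s u => f (cdeg s) s u) => s t st.
have -> : \sum_(u <- cbasis X (cdeg t).+1) f (cdeg s) s u * cd u t = del (f (cdeg s) s) t.
  by apply: eq_bigr => u _; exact: mulrC.
rewrite -st; case sn: (cdeg s) => [|n].
  have [_ ->] := hf0 s sn; rewrite big_seq big1 ?addr0 // => u.
  by rewrite mem_cbasis => /eqP u0; rewrite cd_deg ?mul0r // sn.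
have [_ ->] // := nextP (n, f n) (gf n).
rewrite /defect [X in X + _]/(unit_chain s t - (\sum_(v <- cbasis X (cdeg s).-1) cd s v *: f n v) t).
rewrite fct_sumE sn /= [X in _ - X + _](eq_big_seq (fun u => cd s u * f (cdeg u) u t)).
  exact: subrK.
by move=> u; rewrite mem_cbasis => /eqP ->.
Qed.

End ResolutionKilled.

Lemma resolution_killed (A : comUnitRingType) (X : complex A) (al : X -> A) :
  resolves_residue al -> homology_killed X.
Proof. by move=> Xr; apply: homotopy_killed => a am; exact: (resolution_homotopy Xr am). Qed.

Section RankedIndex.
Context (r : nat -> nat).

Definition ranked : choiceType := {n : nat & 'I_(r n)}.

Definition ranked_elt n (i : 'I_(r n)) : ranked := Tagged (fun n => 'I_(r n)) i.

Definition ranked_basis n : seq ranked := [seq ranked_elt i | i <- enum 'I_(r n)].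

Lemma ranked_basis_uniq n : uniq (ranked_basis n).
Proof.
rewrite map_inj_uniq ?enum_uniq // => i j /eqP.
by rewrite eq_Tagged => /eqP.
Qed.

Lemma mem_ranked_basis n s : (s \in ranked_basis n) = (tag s == n).
Proof.
apply/mapP/eqP => [[i _ ->] //|]; case: s => m i /= mn.
by case: n / mn; exists i; rewrite ?mem_enum.
Qed.

Lemma sum_ranked_basis (V : zmodType) n (F : ranked -> V) :
  \sum_(s <- ranked_basis n) F s = \sum_(i < r n) F (ranked_elt i).
Proof. by rewrite big_map big_enum. Qed.

End RankedIndex.

(** * The complex of a free resolution *)

Section ResolutionComplex.
Context (A : comUnitRingType) (M : lmodType A) (F : free_resolution M).

Local Notation r := (fr_rank F).
Local Notation idx := (ranked r).

(** Entries by natural indices, with default 0: degrees of basis elements match only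
    propositionally, and this avoids casting between matrix sizes. *)
Definition fr_entry n (i j : nat) : A :=
  match insub i : option 'I_(r n.+1), insub j : option 'I_(r n) with
  | Some i, Some j => fr_diff F n i j
  | _, _ => 0
  end.

Lemma fr_entryE n (i : 'I_(r n.+1)) (j : 'I_(r n)) : fr_entry n i j = fr_diff F n i j.
Proof. by rewrite /fr_entry !valK. Qed.

Definition fr_cd (s t : idx) : A :=
  if tag s == (tag t).+1 then fr_entry (tag t) (tagged s) (tagged t) else 0.

Lemma fr_dd n : fr_diff F n.+1 *m fr_diff F n = 0.
Proof.
apply/row_matrixP => i; rewrite row_mul row0; apply/fr_exact.
by exists (delta_mx 0 i); rewrite rowE.
Qed.

Fact fr_cd_deg s t : tag s != (tag t).+1 -> fr_cd s t = 0.
Proof. by rewrite /fr_cd => /negbTE ->. Qed.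

Fact fr_cdd s u : \sum_(t <- ranked_basis r (tag u).+1) fr_cd s t * fr_cd t u = 0.
Proof.
rewrite sum_ranked_basis; case: s => m i; case: u => n j.
have [mn|mn] := eqVneq m n.+2; last first.
  by rewrite big1 // => l _; rewrite {1}/fr_cd /= (negbTE mn) mul0r.
subst m.
have /matrixP/(_ i j) := fr_dd n; rewrite !mxE => e; rewrite -[RHS]e.
by apply: eq_bigr => l _; rewrite /fr_cd /= !eqxx !fr_entryE.
Qed.

Definition fr_complex : complex A :=
  Complex (ranked_basis_uniq r) (mem_ranked_basis (r := r)) fr_cd_deg fr_cdd.

Definition chain_row n (x : fr_complex -> A^o) : 'rV[A]_(r n) :=
  \row_i x (ranked_elt i).

Lemma chain_row_del n x : chain_row n (del x) = chain_row n.+1 x *m fr_diff F n.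
Proof.
apply/rowP => j; rewrite !mxE /del /= sum_ranked_basis.
apply: eq_bigr => i _; rewrite mxE /fr_cd /= eqxx fr_entryE; exact: mulrC.
Qed.

Definition row_chain n (v : 'rV[A]_(r n)) : fr_complex -> A^o :=
  fun s => if insub (tagged s : nat) : option 'I_(r n) is Some i
           then if tag s == n then v 0 i else 0 else 0.

Lemma row_chainK n v : chain_row n (row_chain v) = v.
Proof. by apply/rowP => i; rewrite mxE /row_chain /= valK eqxx. Qed.

Lemma row_chain_supported n (v : 'rV[A]_(r n)) : supported n (row_chain v).
Proof. by move=> s /= /negbTE sn; rewrite /row_chain sn; case: insub. Qed.

Lemma chain_row_inj n x y : supported n x -> supported n y ->
  chain_row n x = chain_row n y -> x = y.
Proof.
move=> xn yn /rowP xy; apply/funext => -[m i].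
have [mn|mn] := eqVneq m n; last by rewrite xn // yn.
by subst m; have := xy i; rewrite !mxE.
Qed.

Lemma fr_complex_exact n (x : fr_complex -> A^o) : supported n.+1 x -> del x = 0 ->
  exists y, x = del y.
Proof.
move=> xn dx; have : chain_row n.+1 x *m fr_diff F n = 0.
  by rewrite -chain_row_del dx; apply/rowP => i; rewrite !mxE.
move=> /fr_exact[w xw]; exists (row_chain w); apply: (chain_row_inj xn).
  exact/del_supported/row_chain_supported.
by rewrite chain_row_del row_chainK.
Qed.

End ResolutionComplex.

Section ResidueResolution.
Context (A : comUnitRingType) (k : fieldType) (pi : {rmorphism A -> k}).
Context (k_residue : residue_field pi) (G : free_resolution (residue_module pi)).

(** The augmentation of G on basis vectors is lifted to A entry by entry; [key] says that the lift
    reduces to the augmentation of G. *)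
Lemma residue_resolution : exists al : fr_complex G -> A, resolves_residue al.
Proof.
have /choice[l lP] : forall y : k, exists a, pi a = y by case: k_residue.
pose e0 (i : nat) : 'rV[A]_(fr_rank G 0) := \row_j ((i == j)%:R).
pose al (s : ranked (fr_rank G)) := l (fr_aug G (e0 (nat_of_ord (tagged s)))).
exists al.
have key (x : fr_complex G -> A^o) :
    pi (\sum_(t <- cbasis (fr_complex G) 0) al t * x t) =
    fr_aug G (chain_row 0 x).
  rewrite /= sum_ranked_basis rmorph_sum /=.
  have -> : chain_row 0 x = \sum_(i < fr_rank G 0) (x (ranked_elt i) : A) *: e0 i.
    apply/rowP => j; rewrite summxE !mxE (bigD1 j) //= !mxE eqxx mulr1 big1 ?addr0 // => i ij.
    by rewrite !mxE val_eqE (negbTE ij) mulr0.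
  rewrite linear_sum; apply: eq_bigr => i _.
  by rewrite rmorphM lP linearZ mulrC.
split; first exact: fr_complex_exact.
- move=> x x0; rewrite (residue0 k_residue) key; split=> [h|[y xy]].
    have [w xw] := (fr_exact0 (chain_row 0 x)).1 h.
    exists (row_chain w); apply: (chain_row_inj x0).
      exact/del_supported/row_chain_supported.
    by rewrite chain_row_del row_chainK.
  by apply: (fr_exact0 (chain_row 0 x)).2; exists (chain_row 1 y); rewrite xy chain_row_del.
have [v v1] := fr_aug_surj G (1 : k).
have := key (row_chain v); rewrite row_chainK v1.
set a := \sum_(t <- _) _ => pia.
have au : a \is a GRing.unit.
  apply: not_maximal_ideal => /(residue0 k_residue); rewrite pia => /eqP.
  by rewrite oner_eq0.
(* The lift of 1 is determined only modulo m, so it is a unit that must be normalized to 1. *)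
exists (a^-1 *: row_chain v).
  by move=> t t0; rewrite [LHS]/(a^-1 *: row_chain v t) row_chain_supported //; exact: scaler0.
rewrite -[RHS](mulVr au) /a mulr_sumr; apply: eq_bigr => t _.
by rewrite mulrCA.
Qed.

End ResidueResolution.

(** * The complex of the subalgebra generated up to degree q *)

Section Coordinates.
Context (A : comUnitRingType) (A_local : local_ring A).
Context (k : fieldType) (pi : {rmorphism A -> k}) (k_residue : residue_field pi).
Context (E : acyclic_closure pi) (q : nat) (q_gt0 : (0 < q)%N).

Local Notation S := (generated_upto (@ac_dp A k pi E) q).
Local Notation d := (dg_d E).
Local Notation aug := (dg_aug E).
Local Notation comp := (dg_comp E).
Local Notation hom n a := (dg_hom (d := E) n a).

Let S_sub : is_submodule S := generated_submodule E q.

Context (r : nat -> nat) (u : nat -> nat -> E).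
Hypothesis u_in : forall n i, (i < r n)%N -> S (u n i) /\ hom n (u n i).
Hypothesis u_span : forall n a, S a -> hom n a ->
  exists c : nat -> A, a = \sum_(i < r n) c i *: u n i.
Hypothesis u_free : forall n (c : nat -> A), \sum_(i < r n) c i *: u n i = 0 ->
  forall i, (i < r n)%N -> c i = 0.

Local Notation idx := (ranked r).

Definition basis_elt (s : idx) : E := u (tag s) (tagged s).

Lemma basis_eltS s : S (basis_elt s).
Proof. by case: (u_in (ltn_ord (tagged s))). Qed.

Lemma basis_elt_hom s : hom (tag s) (basis_elt s).
Proof. by case: (u_in (ltn_ord (tagged s))). Qed.

(** Coordinates are chosen, with a default outside the homogeneous part of S; [u_free] makes them
    unique where they exist. *)
Definition coord_in n (a : E) : nat -> A :=
  xget (fun=> 0) [set c : nat -> A | a = \sum_(i < r n) c i *: u n i].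

Definition co (a : E) (s : idx) : A := coord_in (tag s) (comp (tag s) a) (tagged s).

Lemma coE n a : S a -> comp n a = \sum_(s <- ranked_basis r n) co a s *: basis_elt s.
Proof.
move=> Sa; rewrite sum_ranked_basis.
have [c hc] := u_span (generated_comp n Sa) (comp_hom n a).
exact: (@xgetPex _ (fun=> 0) [set c : nat -> A | comp n a = \sum_(i < r n) c i *: u n i]
  (ex_intro _ c hc)).
Qed.

Lemma co_unique n (c : idx -> A) a : S a ->
  comp n a = \sum_(s <- ranked_basis r n) c s *: basis_elt s ->
  forall s, tag s = n -> co a s = c s.
Proof.
move=> Sa; rewrite (coE n Sa) !sum_ranked_basis => /eqP.
rewrite -subr_eq0 -sumrB => /eqP e [m i] /= mn; subst m.
pose c' j := if insub j : option 'I_(r n) is Some j'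
  then co a (ranked_elt j') - c (ranked_elt j') else 0.
have := @u_free n c' _ i (ltn_ord i); rewrite /c' valK => h.
apply/eqP; rewrite -subr_eq0; apply/eqP; apply: h.
by rewrite -[RHS]e; apply: eq_bigr => j _; rewrite valK scalerBl.
Qed.

Lemma coP x a b : S a -> S b -> co (x *: a + b) = x *: (co a : idx -> A^o) + co b :> (idx -> A^o).
Proof.
move=> Sa Sb; apply/funext => s.
apply: (co_unique (n := tag s) (c := fun s => x * co a s + co b s)) => //.
  exact: (submoduleD S_sub (submoduleZ S_sub x Sa) Sb).
rewrite linearP /= (coE _ Sa) (coE _ Sb) scaler_sumr -big_split /=.
by apply: eq_bigr => t _; rewrite scalerA scalerDl.
Qed.

Lemma co0 : co 0 = 0 :> (idx -> A^o).
Proof.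
apply/funext => s; apply: (co_unique (n := tag s) (c := fun=> 0)) => //.
  exact: (submodule0 S_sub).
by rewrite linear0 big1 // => t _; rewrite scale0r.
Qed.

Lemma coZ x a s : S a -> co (x *: a) s = x * co a s.
Proof.
move=> Sa; have := congr1 (@^~ s) (coP x Sa (submodule0 S_sub)).
by rewrite addr0 => ->; rewrite co0; exact: addr0.
Qed.

Lemma coD a b s : S a -> S b -> co (a + b) s = co a s + co b s.
Proof. by move=> Sa Sb; have := congr1 (@^~ s) (coP 1 Sa Sb); rewrite !scale1r. Qed.

Lemma co_sum I (l : seq I) (F : I -> E) s : (forall i, S (F i)) ->
  co (\sum_(i <- l) F i) s = \sum_(i <- l) co (F i) s.
Proof.
move=> SF; elim: l => [|i l IH]; first by rewrite !big_nil co0.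
rewrite !big_cons coD ?IH //; exact: (submodule_sum S_sub).
Qed.

Lemma co_basis_elt s t : co (basis_elt s) t = (s == t)%:R.
Proof.
apply: (co_unique (n := tag t) (c := fun t => (s == t)%:R)) => //; first exact: basis_eltS.
rewrite (hom_comp _ (basis_elt_hom s)); case: eqP => [ts|ts].
  rewrite (bigD1_seq s) ?ranked_basis_uniq ?mem_ranked_basis ?ts //= eqxx scale1r.
  by rewrite big1 ?addr0 // => t'; rewrite eq_sym => /negbTE ->; rewrite scale0r.
rewrite big_seq big1 // => t'; rewrite mem_ranked_basis => /eqP t'n.
by case: eqP => [st|_]; [rewrite st t'n in ts|rewrite scale0r].
Qed.

Lemma co_hom n a s : S a -> hom n a -> tag s != n -> co a s = 0.
Proof.
move=> Sa an sn; apply: (co_unique (n := tag s) (c := fun=> 0)) => //.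
by rewrite (hom_comp _ an) (negbTE sn) big1 // => t _; rewrite scale0r.
Qed.

Lemma co_d a t : S a ->
  co (d a) t = \sum_(s <- ranked_basis r (tag t).+1) co (d (basis_elt s)) t * co a s.
Proof.
move=> Sa; apply: (co_unique (n := tag t)
  (c := fun t' => \sum_(s <- ranked_basis r (tag t).+1) co (d (basis_elt s)) t' * co a s)) => //.
  exact: generated_d.
rewrite comp_d (coE _ Sa) linear_sum.
under [RHS]eq_bigr do rewrite scaler_suml.
rewrite [RHS]exchange_big; apply: eq_big_seq => s; rewrite mem_ranked_basis => /eqP sn.
have ds : hom (tag t) (d (basis_elt s)).
  by apply: dg_hom_d; rewrite -sn; exact: basis_elt_hom.
rewrite linearZ /= -{1}ds (coE _ (generated_d (basis_eltS s))) scaler_sumr.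
by apply: eq_bigr => t' _; rewrite scalerA mulrC.
Qed.

Lemma comp_homM m n w b : hom m w -> comp (m + n)%N (w * b) = w * comp n b.
Proof.
move=> wm; elim/hom_decomposition: b => [|b b' hb hb'|l b bl].
- by rewrite !(mulr0, linear0).
- by rewrite mulrDr !linearD /= hb hb' mulrDr.
rewrite (hom_comp _ (dg_homM wm bl)) (hom_comp _ bl) eqn_add2l.
by case: ifP => // _; rewrite mulr0.
Qed.

Lemma co_mul1 w b t : S w -> hom 1 w -> S b ->
  co (w * b) t = if tag t is n.+1
    then \sum_(v <- ranked_basis r n) co b v * co (w * basis_elt v) t else 0.
Proof.
move=> Sw w1 Sb; have Swb := generatedM Sw Sb.
case tn: (tag t) => [|n].
  apply: (co_unique (n := 0) (c := fun=> 0)) => //.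
  rewrite big1 => [|s _]; last by rewrite scale0r.
  elim/hom_decomposition: b {Sb Swb} => [|b b' hb hb'|l b bl].
  - by rewrite mulr0 linear0.
  - by rewrite mulrDr linearD /= hb hb' addr0.
  - by rewrite (hom_comp _ (dg_homM w1 bl)).
apply: (co_unique (n := n.+1)
  (c := fun t' => \sum_(v <- ranked_basis r n) co b v * co (w * basis_elt v) t')) => //.
rewrite -add1n (comp_homM _ _ w1) (coE _ Sb) mulr_sumr.
under [RHS]eq_bigr do rewrite scaler_suml.
rewrite [RHS]exchange_big; apply: eq_big_seq => v; rewrite mem_ranked_basis => /eqP vn.
have wv : hom (1 + n) (w * basis_elt v).
  by apply: dg_homM => //; rewrite -vn; exact: basis_elt_hom.
rewrite -scalerAr -{1}wv (coE _ (generatedM Sw (basis_eltS v))) scaler_sumr.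
by apply: eq_bigr => t' _; rewrite scalerA.
Qed.

Definition sub_cd (s t : idx) : A := co (d (basis_elt s)) t.

Fact sub_cd_deg s t : tag s != (tag t).+1 -> sub_cd s t = 0.
Proof.
move=> st; have Sd := generated_d (basis_eltS s).
case sn: (tag s) st => [|n] st.
  have s0 := basis_elt_hom s; rewrite sn in s0.
  by rewrite /sub_cd dg_hom_d0 // co0.
apply: (co_hom (n := n)) => //; last by rewrite eq_sym.
by apply: dg_hom_d; rewrite -sn; exact: basis_elt_hom.
Qed.

Fact sub_cdd s t :
  \sum_(v <- ranked_basis r (tag t).+1) sub_cd s v * sub_cd v t = 0.
Proof.
have := @co_d (d (basis_elt s)) t (generated_d (basis_eltS s)).
rewrite dg_dd co0 => e; rewrite [RHS]e.
by apply: eq_bigr => v _; exact: mulrC.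
Qed.

Definition sub_complex : complex A :=
  Complex (ranked_basis_uniq r) (mem_ranked_basis (r := r)) sub_cd_deg sub_cdd.

Local Notation U := sub_complex.

Definition cochain (a : E) : U -> A^o := co a.

Lemma cochain_d a : S a -> cochain (d a) = del (cochain a).
Proof. by move=> Sa; apply/funext => t; exact: co_d. Qed.

Lemma cochain_supported n a : S a -> hom n a -> supported n (cochain a).
Proof. by move=> Sa an s; exact: co_hom. Qed.

Definition realize n (x : U -> A^o) : E := \sum_(s <- ranked_basis r n) (x s : A) *: basis_elt s.

Lemma realizeS n x : S (realize n x).
Proof.
by apply: (submodule_sum S_sub) => s _; exact: (submoduleZ S_sub _ (basis_eltS s)).
Qed.

Lemma realize_hom n x : hom n (realize n x).
Proof.
rewrite /realize big_seq; apply: big_ind; [exact: hom0|by move=> ? ?; exact: homD|].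
by move=> s; rewrite mem_ranked_basis => /eqP <-; apply: homZ; exact: basis_elt_hom.
Qed.

Fact realize_linear n : linear (realize n).
Proof.
move=> a x y; rewrite /realize scaler_sumr -big_split /=; apply: eq_bigr => s _.
by rewrite [(a *: x + y) s]/(a * x s + y s) scalerDl scalerA.
Qed.
HB.instance Definition _ n := GRing.isLinear.Build A (U -> A^o) E *:%R
  (realize n) (realize_linear n).

Lemma realizeK n x : supported n x -> cochain (realize n x) = x.
Proof.
move=> xn; apply/funext => s; have [sn|sn] := eqVneq (tag s) n.
  apply: (co_unique (n := n) (c := x)) => //; first exact: realizeS.
  by rewrite (hom_comp _ (realize_hom n x)) eqxx.
by rewrite xn //; apply: (co_hom (n := n)) => //; [exact: realizeS|exact: realize_hom].
Qed.

Lemma cochainK n a : S a -> hom n a -> realize n (cochain a) = a.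
Proof. by move=> Sa an; rewrite -[RHS]an (coE n Sa). Qed.

Lemma d_realize n y : d (realize n.+1 y) = realize n (del y).
Proof.
rewrite -[LHS](cochainK (n := n)); [|exact: (generated_d (realizeS _ _))|exact: (dg_hom_d (realize_hom _ _))].
rewrite cochain_d; last exact: realizeS.
have -> : realize n.+1 y = realize n.+1 (truncate n.+1 y).
  by apply: eq_big_seq => s; rewrite mem_ranked_basis /truncate /= => ->.
rewrite realizeK; last exact: supported_truncate.
by apply: eq_big_seq => s; rewrite mem_ranked_basis del_truncate /= => ->.
Qed.

(** As q is at least 1, S contains the variables of degree 1, whose differentials generate m. *)
Lemma maximal_boundary a : maximal_ideal a -> exists w, [/\ S w, hom 1 w & d w = a *: (1 : E)].
Proof.
move=> am; have [_ gen _] := ac_kill1 E.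
have [|c hc] := gen (a *: 1); first by exists a.
exists (\sum_(i < ac_num E 1) c i *: @ac_dp A k pi E (Tagged (fun n => 'I_(ac_num E n)) i) 1); split.
- apply: (submodule_sum S_sub) => i _; apply: (submoduleZ S_sub).
  exact: generated_dp.
- apply: big_ind; [exact: hom0|by move=> ? ?; exact: homD|move=> i _; apply: homZ].
  by have := @ac_dp_hom A k pi E (Tagged (fun n => 'I_(ac_num E n)) i) 1; apply.
rewrite linear_sum; apply/eqP; rewrite eq_sym -subr_eq0; apply/eqP.
by rewrite -[RHS]hc; congr (_ - _); apply: eq_bigr => i _; rewrite linearZ.
Qed.

(** Left multiplication by an element w of degree 1 with d w = a is a null-homotopy of a: by
    Leibniz, d (w s) + w d s = a s. *)
Lemma sub_killed : homology_killed U.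
Proof.
apply: homotopy_killed => a /maximal_boundary[w [Sw w1 dw]].
exists (fun s t => co (w * basis_elt s) t) => s t st.
have Sws := generatedM Sw (basis_eltS s).
have e1 : \sum_(v <- cbasis U (cdeg t).+1) co (w * basis_elt s) v * cd v t = co (d (w * basis_elt s)) t.
  by rewrite (co_d _ Sws); apply: eq_bigr => v _; exact: mulrC.
have e2 : \sum_(v <- cbasis U (cdeg t).-1) cd s v * co (w * basis_elt v) t =
    co (w * d (basis_elt s)) t.
  rewrite (co_mul1 _ Sw w1 (generated_d (basis_eltS s))) /=.
  case tn: (tag t) => [|n] //=.
  rewrite big_seq big1 // => v; rewrite mem_ranked_basis => /eqP v0.
  have s0 : tag s = 0 by have := st; rewrite /= tn.
  by rewrite sub_cd_deg ?mul0r // s0 v0.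
rewrite e1 e2 dM (sgn_hom w1) dw expr1 mulN1r mulNr -scalerAl mul1r.
rewrite -coD; last exact: (generatedM Sw (generated_d (basis_eltS s))).
  rewrite subrK coZ ?co_basis_elt; last exact: basis_eltS.
  by case: eqP; rewrite ?mulr1 ?mulr0.
apply: (submoduleB S_sub); first exact: (submoduleZ S_sub _ (basis_eltS s)).
exact: (generatedM Sw (generated_d (basis_eltS s))).
Qed.

(** In degree 0 the algebra S is A times 1, so the coefficient of a basis element at 1 is a lift of
    its augmentation; the boundaries there form m by [maximal_boundary]. *)
Lemma sub_augmentation : exists al : U -> A,
  (forall x : U -> A^o, supported 0 x ->
    (maximal_ideal (\sum_(t <- cbasis U 0) al t * x t) <-> exists y, x = del y)) /\
  (exists2 x : U -> A^o, supported 0 x & \sum_(t <- cbasis U 0) al t * x t = 1).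
Proof.
have /choice[al hal] : forall t : U, exists a : A, cdeg t = 0 -> basis_elt t = a *: (1 : E).
  move=> t; have [t0|] := pselect (cdeg t = 0); last by exists 0.
  have t0' : hom (cdeg t) (basis_elt t) := basis_elt_hom t.
  rewrite t0 in t0'.
  by have [a ha] := generated_degree0 (basis_eltS t) t0'; exists a.
have key x : realize 0 x = (\sum_(t <- cbasis U 0) al t * x t) *: (1 : E).
  rewrite scaler_suml; apply: eq_big_seq => t; rewrite mem_ranked_basis => /eqP t0.
  by rewrite hal // scalerA mulrC.
exists al; split.
- move=> x x0; split=> [/maximal_boundary[w [Sw w1 dw]]|[y xy]].
    exists (cochain w); rewrite -cochain_d // dw -key; exact/esym/realizeK.
  apply/(residue0 k_residue); rewrite -[LHS]mulr1 -(rmorph1 aug) -augZ -key xy -d_realize.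
  exact: dg_aug_d.
have S1 : S 1 by exact: generated1.
exists (cochain 1); first exact: cochain_supported S1 (dg_hom1 E).
have e1 : (\sum_(t <- cbasis U 0) al t * cochain 1 t - 1) *: (1 : E) = 0.
  by rewrite scalerBl -key cochainK ?scale1r ?subrr //; exact: dg_hom1.
by apply/eqP; rewrite -subr_eq0; apply/eqP; exact: one_free e1.
Qed.

End Coordinates.

Section RankedBelow.
Context (r : nat -> nat).

Fixpoint ranked_below (n : nat) : seq (ranked r) :=
  if n is m.+1 then ranked_below m ++ ranked_basis r m else [::].

Lemma mem_ranked_below n b : (b \in ranked_below n) = (tag b < n)%N.
Proof.
elim: n => [|n IH] //=; rewrite mem_cat IH mem_ranked_basis.
by rewrite [RHS]ltnS [RHS]leq_eqVlt orbC.
Qed.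

Lemma ranked_below_uniq n : uniq (ranked_below n).
Proof.
elim: n => [|n IH] //=; rewrite cat_uniq IH ranked_basis_uniq andbT /=.
apply/hasPn => b; rewrite mem_ranked_basis => /eqP bn.
by rewrite /= mem_ranked_below bn ltnn.
Qed.

Lemma sum_ranked_below (V : nmodType) n (F : ranked r -> V) :
  \sum_(b <- ranked_below n) F b = \sum_(i < n) \sum_(b <- ranked_basis r i) F b.
Proof.
elim: n => [|n IH]; first by rewrite big_nil big_ord0.
by rewrite big_ord_recr /= big_cat IH.
Qed.

Lemma sum_ranked_below_top (V : nmodType) n (F : ranked r -> V) :
  \sum_(b <- ranked_below n.+1 | tag b == n) F b = \sum_(b <- ranked_basis r n) F b.
Proof.
rewrite /= big_cat /= big1_seq ?add0r => [|b /andP[/eqP bn]]; last first.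
  by rewrite mem_ranked_below bn ltnn.
have e : [seq b <- ranked_basis r n | tag b == n] = ranked_basis r n.
  by apply/all_filterP/allP => b; rewrite mem_ranked_basis.
by rewrite -[in RHS]e big_filter.
Qed.

Lemma sum_ranked_degree n (F : nat -> nat) :
  (\sum_(b <- ranked_below n) F (tag b) = \sum_(i < n) r i * F i)%N.
Proof.
rewrite sum_ranked_below; apply: eq_bigr => i _.
under eq_big_seq => b do [rewrite mem_ranked_basis => /eqP ->; over].
rewrite big_const_seq count_predT iter_addn_0 mulnC.
by rewrite /ranked_basis size_map size_enum_ord.
Qed.

End RankedBelow.

(** * Dimensions and bases of homology *)

Section HomologyBases.
Context (A : comUnitRingType) (A_local : local_ring A).

Section Residue.
Context (k : fieldType) (pi : {rmorphism A -> k}) (k_residue : residue_field pi).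
Context (X : complex A) (n : nat).

Definition values (x : X -> A^o) : 'rV[A]_(size (cbasis X n)) :=
  \row_j x (tnth (in_tuple (cbasis X n)) j).

Fact values_linear : linear values.
Proof. by move=> a x y; apply/rowP => j; rewrite !mxE. Qed.
HB.instance Definition _ := GRing.isLinear.Build A (X -> A^o) 'rV[A]_(size (cbasis X n))
  *:%R values values_linear.

(** Over k, the homology in degree n is a subquotient of the n-chains, a vector space of dimension
    the rank of X in degree n. *)
Lemma homology_le_residue :
  homology_le X n (@maximal_ideal A : set A^o) (size (cbasis X n)).
Proof.
pose N := size (cbasis X n).
apply: (@dim_le_sub _ _ _ _ _ setT (@maximal_row A N) values).
- apply: cycles_submodule; split.
  + exact: maximal_ideal0.
  + by move=> x y; exact: A_local.
  + move=> a x; exact: maximal_idealM.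
- by [].
- move=> z [zn _] zm; exists 0 => t; rewrite linear0 subr0.
  have [tn|tn] := eqVneq (cdeg t) n; last by rewrite zn //; exact: maximal_ideal0.
  have tb : t \in cbasis X n by rewrite mem_cbasis tn.
  have := zm (Ordinal (etrans (index_mem t (cbasis X n)) tb)).
  by rewrite mxE (tnth_nth t) /= nth_index.
have rkN : \rank ((1%:M : 'M[k]_N) :\: (0 : 'M[k]_N))%MS = N.
  have := mxrank_cap_compl (1%:M : 'M[k]_N) (0 : 'M[k]_N).
  by rewrite capmx0 mxrank0 add0n mxrank1.
move=> m mind; rewrite -/N -rkN; move: mind.
apply: (iffLR (@indep_rank A k pi k_residue N N N 1%:M 0 setT (@maximal_row A N) _ _ _ m)).
- exact: sub0mx.
- by move=> p; split=> // _; exact: submx1.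
move=> p; rewrite submx0.
by split=> [/(maximal_row0 k_residue) ->|/eqP/(maximal_row0 k_residue)].
Qed.

End Residue.

Section Basis.
Context (X : complex A) (X_killed : homology_killed X).
Hypothesis X_finite : forall n, exists h, homology_le X n ([set 0] : set A^o) h.

Lemma homology_bases : exists (w : nat -> nat) (z : ranked w -> X -> A^o),
  [/\ w 0 = 0, forall b, supported (tag b) (z b), forall b, del (z b) = 0,
    forall n x, supported n.+1 x -> del x = 0 -> exists (c : ranked w -> A) y,
      x = \sum_(b <- ranked_basis w n.+1) c b *: z b + del y &
    forall n (c : ranked w -> A) y, \sum_(b <- ranked_basis w n) c b *: z b = del y ->
      forall b, tag b = n -> maximal_ideal (c b)].
Proof.
have zs := @submodule_zero A A^o.
pose basis_of (n : nat) (p : {m & 'I_m -> X -> A^o}) : Prop :=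
    [/\ forall i, cycles n [set 0] (tagged p i),
      forall c : 'I_(tag p) -> A, boundaries [set 0] (\sum_i c i *: tagged p i) ->
        forall i, maximal_ideal (c i) &
      forall u, cycles n [set 0] u ->
        exists c : 'I_(tag p) -> A, boundaries [set 0] (u - \sum_i c i *: tagged p i)].
have /choice[p hp] : forall n : nat, exists p,
    (n = 0 -> tag p = 0) /\ ((0 < n)%N -> basis_of n p).
  (* Degree 0 gets no letters: the homology of S there is k, which the augmentation accounts for. *)
  case=> [|n]; first by exists (existT _ 0 (fun=> 0)).
  have [h hh] := X_finite n.+1.
  have [m [z [_ z1 z2 z3]]] := dim_le_basis (cycles_submodule X zs n.+1)
    (boundaries_submodule X zs) (X_killed (n := n.+1) zs) hh.
  by exists (existT _ m z).
pose w n := tag (p n).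
pose z (b : ranked w) : X -> A^o := tagged (p (tag b)) (tagged b).
have w0 : w 0 = 0 by exact: (proj1 (hp 0) erefl).
have wP n (i : 'I_(w n)) : (0 < n)%N by case: n i => // -[m]; rewrite w0.
have bdE x : boundaries [set 0] x <-> exists y, x = del y.
  split=> -[y hy]; exists y; last by move=> t; rewrite hy /= subrr.
  by apply/funext => t; apply/eqP; rewrite -subr_eq0; apply/eqP; exact: hy.
have zc b : cycles (tag b) [set 0] (z b).
  case: b => n i; have n0 := wP n i; rewrite /z /=.
  by have [h _ _] := proj2 (hp n) n0; exact: h.
exists w, z; split=> //.
- by move=> b; case: (zc b).
- by move=> b; apply/funext => t; case: (zc b) => _; exact.
- move=> n x xn dx; have xc : cycles n.+1 [set 0] x by split=> // t; rewrite dx.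
  have [_ _ /(_ x xc)[c /bdE[y hy]]] := proj2 (hp n.+1) isT.
  exists (fun b : ranked w => oapp c 0 (insub (nat_of_ord (tagged b)))), y.
  apply/eqP; rewrite addrC -subr_eq; apply/eqP; rewrite -hy sum_ranked_basis.
  by congr (_ - _); apply: eq_bigr => i _; rewrite /= valK.
move=> n c y; rewrite sum_ranked_basis => e [m i] /= mn; subst m.
have [_ h _] := proj2 (hp n) (wP n i).
by apply: (h (fun i => c (ranked_elt i))); apply/bdE; exists y.
Qed.

End Basis.

End HomologyBases.

(** * Massey operations on words *)

Section Words.
Context (A : comUnitRingType) (k : fieldType) (pi : {rmorphism A -> k}).
Context (k_residue : residue_field pi).
Context (E : acyclic_closure pi) (q : nat) (q_gt0 : (0 < q)%N).

Local Notation S := (generated_upto (@ac_dp A k pi E) q).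
Local Notation d := (dg_d E).
Local Notation aug := (dg_aug E).
Local Notation comp := (dg_comp E).
Local Notation hom n a := (dg_hom (d := E) n a).

Let S_sub : is_submodule S := generated_submodule E q.

Context (r : nat -> nat) (u : nat -> nat -> E).
Hypothesis u_in : forall n i, (i < r n)%N -> S (u n i) /\ hom n (u n i).
Hypothesis u_span : forall n a, S a -> hom n a ->
  exists c : nat -> A, a = \sum_(i < r n) c i *: u n i.
Hypothesis u_free : forall n (c : nat -> A), \sum_(i < r n) c i *: u n i = 0 ->
  forall i, (i < r n)%N -> c i = 0.

Local Notation U := (sub_complex u_in u_span u_free).

Context (w : nat -> nat) (z : ranked w -> U -> A^o).
Hypothesis w0 : w 0 = 0.
Hypothesis z_supported : forall b, supported (tag b) (z b).
Hypothesis z_cycle : forall b, del (z b) = 0.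
Hypothesis z_gen : forall n x, supported n.+1 x -> del x = 0 ->
  exists (c : ranked w -> A) y,
    x = \sum_(b <- ranked_basis w n.+1) c b *: z b + del y.
Hypothesis z_ind : forall n (c : ranked w -> A) y,
  \sum_(b <- ranked_basis w n) c b *: z b = del y ->
  forall b, tag b = n -> maximal_ideal (c b).

Context (gamma : seq (set E) -> E) (gamma_massey : is_trivial_massey S gamma).

Lemma letter_gt0 (b : ranked w) : (0 < tag b)%N.
Proof. by case: b => -[|n] // [m hm]; exfalso; move: hm; rewrite w0. Qed.

Let zE (b : ranked w) : E := realize (tag b) (z b).

Let zE_cycle b : d (zE b) = 0.
Proof.
rewrite /zE; case: (tag b) (letter_gt0 b) => // n _.
by rewrite d_realize z_cycle linear0.
Qed.

Definition letter_class (b : ranked w) : set E :=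
  [set zE b + d s | s in S].

Lemma letter_class_reduced b : reduced_homology S (letter_class b).
Proof.
exists (zE b); split=> //; first exact: realizeS.
have := realize_hom (tag b) (z b); rewrite -/(zE b).
by case: (tag b) (letter_gt0 b) => // n _; exact: dg_aug_pos.
Qed.

(** The bar construction needs values on words in a chosen minimal set of classes only, not on all
    sequences of classes. *)
Definition massey_word (s : seq (ranked w)) : E := gamma [seq letter_class b | b <- s].

Let word_reduced (s : seq (ranked w)) v :
  v \in [seq letter_class b | b <- s] -> reduced_homology S v.
Proof. by move=> /mapP[b _ ->]; exact: letter_class_reduced. Qed.

Let massey_wordP (s : seq (ranked w)) : s != [::] ->
  [/\ S (massey_word s), aug (massey_word s) = 0 &
      d (massey_word s) = \sum_(1 <= j < size s)
        dg_bar (massey_word (take j s)) * massey_word (drop j s)].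
Proof.
move=> s0; have [h _] := gamma_massey.
have [||? ? e] := h [seq letter_class b | b <- s].
- by case: (s) s0.
- exact: word_reduced.
split=> //; rewrite e size_map; apply: eq_bigr => j _.
by rewrite -map_take -map_drop.
Qed.

Lemma massey_wordS s : s != [::] -> S (massey_word s).
Proof. by case/massey_wordP. Qed.

Lemma massey_word_aug s : s != [::] -> aug (massey_word s) = 0.
Proof. by case/massey_wordP. Qed.

Lemma massey_word_d s : s != [::] ->
  d (massey_word s) = \sum_(1 <= j < size s)
    dg_bar (massey_word (take j s)) * massey_word (drop j s).
Proof. by case/massey_wordP. Qed.

Lemma massey_letter b : exists2 t, S t & massey_word [:: b] = zE b + d t.
Proof.
have [_ h] := gamma_massey.
by have [t St e] := h _ (letter_class_reduced b); exists t => //; exact/esym.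
Qed.

Lemma massey_letter_d b : d (massey_word [:: b]) = 0.
Proof. by rewrite massey_word_d // big_geq. Qed.

(** In degree 0 augmentation zero means a scalar in m, which is a boundary. In positive degree the
    chosen cycles generate, and passing to the representatives given by the operation changes only
    the boundary part. *)
Let massey_gen_hom n a : S a -> hom n a -> d a = 0 -> aug a = 0 ->
  exists (c : ranked w -> A) t, S t /\
    a = \sum_(b <- ranked_basis w n) c b *: massey_word [:: b] + d t.
Proof.
move=> Sa; have /choice[p hp] : forall b, exists t, S t /\ massey_word [:: b] = zE b + d t.
  by move=> b; have [t ? ?] := massey_letter b; exists t.
case: n => [|n] an da aa.
  have [x ax] := generated_degree0 Sa an.
  have xm : maximal_ideal x.
    by apply/(residue0 k_residue); rewrite -[LHS](@dg_aug_scalar _ _ _ E) -ax.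
  have [t [St _ dt]] := maximal_boundary E q_gt0 xm.
  exists (fun=> 0), t; split=> //.
  by rewrite big1 ?add0r ?dt // => b _; rewrite scale0r.
pose x : U -> A^o := cochain a.
have [|c [y xE]] := z_gen (cochain_supported Sa an).
  by rewrite -cochain_d // da; exact: (co0 u_span u_free).
exists c, (realize n.+2 y - \sum_(b <- ranked_basis w n.+1) c b *: p b); split.
  apply: (submoduleB S_sub); first exact: realizeS.
  by apply: (submodule_sum S_sub) => b _; apply: (submoduleZ S_sub); case: (hp b).
rewrite -[LHS](cochainK u_in u_span u_free Sa an) xE linearD linear_sum linearB d_realize.
rewrite linear_sum [RHS]addrCA [LHS]addrC; congr (_ + _).
rewrite -sumrB big_seq [RHS]big_seq; apply: eq_bigr => b.
rewrite mem_ranked_basis => /eqP bn; case: (hp b) => _ ->.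
by rewrite scalerDr [d (c b *: _)]linearZ addrK linearZ /zE bn.
Qed.

Lemma massey_gen a : S a -> d a = 0 -> aug a = 0 ->
  exists (s : seq (ranked w)) (c : ranked w -> A) t, S t /\
    a = \sum_(b <- s) c b *: massey_word [:: b] + d t.
Proof.
move=> Sa da aa; have [N [_ aE]] := dg_comp_sum a.
have /choice[ct hct] : forall n, exists ct : (ranked w -> A) * E, S ct.2 /\
    comp n a = \sum_(b <- ranked_basis w n) ct.1 b *: massey_word [:: b] + d ct.2.
  move=> n; have [||c [t ?]] := massey_gen_hom (generated_comp n Sa) (comp_hom n a).
  - case: n => [|n]; first exact/dg_hom_d0/comp_hom.
    by rewrite -comp_d da linear0.
  - case: n => [|n]; first by rewrite -aug_comp0.
    exact/dg_aug_pos/comp_hom.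
  by exists (c, t).
exists (ranked_below w N), (fun b => (ct (tag b)).1 b), (\sum_(n < N) (ct n).2); split.
  by apply: (submodule_sum S_sub) => n _; case: (hct n).
rewrite [LHS]aE sum_ranked_below linear_sum -big_split; apply: eq_bigr => n _ /=.
case: (hct n) => _ ->; congr (_ + _).
rewrite big_seq [RHS]big_seq; apply: eq_bigr => b.
by rewrite mem_ranked_basis => /eqP ->.
Qed.

(** The letters of s may have different degrees, so the relation is projected to the degree of b,
    where minimality of the chosen cycles applies. *)
Lemma massey_ind (s : seq (ranked w)) (c : ranked w -> A) t : uniq s -> S t ->
  \sum_(b <- s) c b *: massey_word [:: b] = d t ->
  forall b, b \in s -> maximal_ideal (c b).
Proof.
move=> us St e b bs; pose n := tag b.
have /choice[p hp] : forall b, exists t, S t /\ massey_word [:: b] = zE b + d t.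
  by move=> b'; have [t' ? ?] := massey_letter b'; exists t'.
pose t' := t - \sum_(b <- s) c b *: p b.
have St' : S t'.
  apply: (submoduleB S_sub) => //; apply: (submodule_sum S_sub) => b' _.
  by apply: (submoduleZ S_sub); case: (hp b').
have e' : \sum_(b <- s) c b *: zE b = d t'.
  rewrite linearB /= -e linear_sum -sumrB; apply: eq_bigr => b' _.
  by case: (hp b') => _ ->; rewrite linearZ /= scalerDr addrK.
(* Letters of degree n outside s receive coefficient 0, so that the relation runs over the whole
   basis in that degree. *)
pose c' b := if b \in s then c b else 0.
have c'b : c' b = c b by rewrite /c' bs.
pose x : U -> A^o := \sum_(b <- ranked_basis w n) c' b *: z b.
have xn : supported n x.
  move=> v vn; rewrite /x fct_sumE big_seq big1 // => b'.
  rewrite mem_ranked_basis => /eqP b'n; rewrite [LHS]/(c' b' *: z b' v).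
  by rewrite z_supported ?b'n //; exact: scaler0.
have xE : realize n x = d (comp n.+1 t').
  rewrite -comp_d -e' !linear_sum /=.
  transitivity (\sum_(b <- s | tag b == n) c b *: zE b).
    rewrite -[RHS]big_filter.
    transitivity (\sum_(b <- ranked_basis w n | b \in s) c b *: zE b).
      rewrite [RHS]big_mkcond big_seq [RHS]big_seq; apply: eq_bigr => b'.
      rewrite mem_ranked_basis linearZ /= /c' => /eqP b'n.
      by case: ifP => _; rewrite ?scale0r // /zE b'n.
    rewrite -[LHS]big_filter; apply: perm_big; apply: uniq_perm.
    - exact: filter_uniq (ranked_basis_uniq _ _).
    - exact: filter_uniq.
    by move=> b'; rewrite !mem_filter mem_ranked_basis andbC.
  rewrite big_mkcond; apply: eq_bigr => b' _.
  rewrite linearZ /= (hom_comp _ (realize_hom _ _)) eq_sym.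
  by case: ifP => _; rewrite ?scaler0.
rewrite -c'b; apply: (z_ind (n := n) (y := cochain (comp n.+1 t'))) => //.
rewrite -cochain_d; last exact: generated_comp.
by rewrite -xE realizeK.
Qed.

(* The Massey product of t and b shows that the product of the classes of
   [sgn t] and b vanishes. *)
Lemma massey_prod t b : S t -> d t = 0 -> aug t = 0 ->
  exists2 a, S a & t * massey_word [:: b] = d a.
Proof.
move=> St dt at0; have [h1 h2] := gamma_massey.
pose v : set E := [set sgn t + d s | s in S].
have vr : reduced_homology S v.
  exists (sgn t); split=> //; first exact: generated_sgn.
  - by rewrite d_sgn dt linear0 oppr0.
  - by rewrite aug_sgn.
have [s Ss vE] := h2 _ vr.
have [||Sg _ dg] := h1 [:: v; letter_class b] => //.
  by move=> v'; rewrite !inE => /orP[] /eqP -> //; exact: letter_class_reduced.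
(* The operation represents the class of [sgn t] by [sgn t + d s]; the term with s corrects for the
   difference. *)
exists (sgn s * massey_word [:: b] - gamma [:: v; letter_class b]).
  apply: (submoduleB S_sub) => //; apply: generatedM; first exact: generated_sgn.
  exact: massey_wordS.
rewrite linearB /= dg big_nat1 /= dM massey_letter_d mulr0 addr0 d_sgn -vE.
rewrite -[dg_bar (_ + _)]opprK -/(sgn _) linearD /= sgnK !mulNr opprK mulrDl.
by rewrite opprK addrCA /sgn mulNr [X in _ + X]subrr addr0.
Qed.

(** The value of the operation on a letter need not be homogeneous; its component in the degree of
    the letter differs from z b by a boundary. *)
Definition letter_chain (b : ranked w) : U -> A^o :=
  cochain (comp (tag b) (massey_word [:: b])).

Let letter_chainE : exists y : ranked w -> U -> A^o,
  forall b, letter_chain b = z b + del (y b).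
Proof.
have /choice[p hp] : forall b, exists t, S t /\ massey_word [:: b] = zE b + d t.
  by move=> b'; have [t' ? ?] := massey_letter b'; exists t'.
exists (fun b => cochain (comp (tag b).+1 (p b))) => b; case: (hp b) => Sp pE.
rewrite -cochain_d; last exact: generated_comp.
rewrite /letter_chain pE linearD /= comp_d (hom_comp _ (realize_hom _ _)) eqxx.
apply/funext => t; rewrite /cochain (coD u_span u_free); last 2 first.
- exact: realizeS.
- exact: (generated_d (generated_comp _ Sp)).
by rewrite -[in RHS](realizeK (@z_supported b)).
Qed.

Lemma letter_chain_supported b : supported (tag b) (letter_chain b).
Proof.
by apply: cochain_supported; [apply: generated_comp; exact: massey_wordS|exact: comp_hom].
Qed.

Lemma letter_chain_gen n x : supported n.+1 x -> del x = 0 ->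
  exists (c : ranked w -> A) y,
    x = \sum_(b <- ranked_below w n.+2 | tag b == n.+1) c b *: letter_chain b + del y.
Proof.
move=> xn dx; have [c [y ->]] := z_gen xn dx; have [y' hy'] := letter_chainE.
exists c, (y - \sum_(b <- ranked_basis w n.+1) c b *: y' b).
rewrite sum_ranked_below_top linearB /= linear_sum [RHS]addrCA [LHS]addrC.
congr (_ + _); rewrite -sumrB; apply: eq_bigr => b _.
by rewrite hy' linearZ /= scalerDr addrK.
Qed.

Lemma letter_chain_ind n (c : ranked w -> A) y :
  \sum_(b <- ranked_below w n.+1 | tag b == n) c b *: letter_chain b = del y ->
  forall b, tag b = n -> maximal_ideal (c b).
Proof.
have [y' hy'] := letter_chainE; rewrite sum_ranked_below_top => e.
apply: (z_ind (y := y - \sum_(b <- ranked_basis w n) c b *: y' b)).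
rewrite linearB /= -e linear_sum -sumrB; apply: eq_bigr => b _.
by rewrite hy' linearZ /= scalerDr addrK.
Qed.

Section BlockMaps.
Context (G : complex A) (al : G -> A) (G_res : resolves_residue al).

(** The maps phi of [chain_map] ignore degrees. Taking the component of phi b s in degree
    [cdeg s + tag b] gives homogeneous maps and preserves the chain condition, as d is
    homogeneous. *)
Lemma word_chain_maps : exists g : ranked w -> G -> U -> A, [/\
  forall b s v, cdeg v != (cdeg s + tag b)%N -> g b s v = 0,
  forall b s v, \sum_(v' <- cbasis U (cdeg v).+1) g b s v' * cd v' v +
    \sum_(t <- cbasis G (cdeg v - tag b)) cd s t * g b t v = 0 &
  forall b s v, cdeg s = 0 -> g b s v = al s * letter_chain b v].
Proof.
have /choice[phi phiP] := chain_map k_residue S_sub (@generated1 _ _ _ E q)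
  (@generatedM _ _ _ E q) (@generated_d _ _ _ E q) (@generated_sgn _ _ _ E q)
  massey_wordS massey_word_aug massey_word_d massey_gen massey_ind massey_prod G_res.
have Sphi b s : S (phi b s) by case: (phiP b).
pose g b s : U -> A^o := cochain (comp (cdeg s + tag b)%N (phi b s)).
have g_deg b s v : cdeg v != (cdeg s + tag b)%N -> g b s v = 0.
  by apply: cochain_supported; [exact: generated_comp|exact: comp_hom].
exists g; split=> //; last first.
  move=> b s v s0; case: (phiP b) => _ phi0 _.
  rewrite /g s0 (phi0 s s0) linearZ /= add0n; apply: (coZ u_span u_free).
  by apply: generated_comp; exact: massey_wordS.
move=> b s v; case: (phiP b) => _ _ phid.
(* If v is not one degree below the value on s, every term of both sums vanishes for degree
   reasons. *)
have [Nv|Nv] := eqVneq (cdeg s + tag b)%N (cdeg v).+1; last first.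
  rewrite big_seq big1 => [|v']; last first.
    by rewrite mem_cbasis => /eqP v'v; rewrite g_deg ?mul0r // v'v eq_sym.
  rewrite add0r big_seq big1 // => t; rewrite mem_cbasis => /eqP tv.
  have [st|st] := eqVneq (cdeg s) (cdeg t).+1; last by rewrite cd_deg ?mul0r.
  rewrite g_deg ?mulr0 //; apply: contra Nv => /eqP ->.
  by rewrite st addSn.
have e1 : \sum_(v' <- cbasis U (cdeg v).+1) g b s v' * cd v' v =
    cochain (comp (cdeg v) (d (phi b s))) v.
  rewrite comp_d cochain_d; last exact: generated_comp.
  by apply: eq_bigr => v' _; rewrite /g Nv; exact: mulrC.
have S0 t : S (cd s t *: comp (cdeg v) (phi b t)).
  exact: (submoduleZ S_sub _ (generated_comp _ (Sphi b t))).
have e2 : cochain (comp (cdeg v) (d (phi b s))) v =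
    - \sum_(t <- cbasis G (cdeg s).-1) cd s t * cochain (comp (cdeg v) (phi b t)) v.
  rewrite phid linearN linear_sum /cochain -scaleN1r (coZ u_span u_free).
    rewrite mulN1r (co_sum u_span u_free) => [|t]; last by rewrite linearZ; exact: S0.
    congr (- _); apply: eq_bigr => t _; rewrite linearZ /= (coZ u_span u_free) //.
    exact: generated_comp.
  by apply: (submodule_sum S_sub) => t _; rewrite linearZ; exact: S0.
rewrite e1 e2; apply/eqP; rewrite addrC subr_eq0; apply/eqP.
case sn: (cdeg s) Nv => [|n] Nv.
  by rewrite !big1 // => t _; rewrite cd_deg ?mul0r ?sn.
have e : (n + tag b)%N = cdeg v by move: Nv; rewrite addSn => -[].
have -> : (cdeg v - tag b)%N = n by rewrite -e addnK.
rewrite /= big_seq [RHS]big_seq; apply: eq_bigr => t; rewrite mem_cbasis => /eqP tn.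
by rewrite /g tn e.
Qed.

End BlockMaps.

End Words.

(** * Betti numbers over a generalized Golod ring *)

Lemma row_finitely_generated (A : comUnitRingType) n :
  @finitely_generated A 'rV[A]_n setT.
Proof.
by exists n, (delta_mx 0); split=> // x _; exists (x 0); exact: row_sum_delta.
Qed.

Lemma regular_finitely_generated (A : comUnitRingType) : @finitely_generated A A^o setT.
Proof.
exists 1, (fun=> 1); split=> // x _; exists (fun=> x).
by rewrite big_ord1; exact/esym/mulr1.
Qed.

(** * Betti numbers of M against those of k *)

Section Comparison.
Context (A : comUnitRingType) (A_local : local_ring A) (A_noetherian : noetherian A).
Context (k : fieldType) (pi : {rmorphism A -> k}) (k_residue : residue_field pi).
Context (G : free_resolution (residue_module pi)).
Context (X : complex A) (al : X -> A) (X_res : resolves_residue al).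

(** A/m and the module presented by G are identified by sending 1 to a vector e of augmentation 1; a
    primitive over the latter is carried back by lifting its augmentations to A. *)
Lemma homology_le_betti n :
  homology_le X n (@maximal_ideal A : set A^o) (betti pi G n).
Proof.
have [e e1] := fr_aug_surj G (1 : k).
have relE (v : 'rV[A]_(fr_rank G 0)) : @syz_relations A _ G 0 v <-> fr_aug G v = 0.
  by split=> [h|/fr_exact0]; [apply/fr_exact0|].
have augE (a : A^o) : fr_aug G (scale_to e a) = pi a :> k.
  by rewrite /scale_to linearZ /= e1; exact: mulr1.
have mrel (a : A^o) : maximal_ideal (a : A) <-> @syz_relations A _ G 0 (scale_to e a).
  by rewrite (residue0 k_residue) relE augE.
have mS : is_submodule (@maximal_ideal A : set A^o).
  split; [exact: maximal_ideal0|by move=> x y; exact: A_local|].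
  by move=> a x; exact: maximal_idealM.
apply: (@dim_le_sub _ _ _ _ _ _ _ (pointwise (scale_to e))
  _ _ _ _ (betti_homology_le k_residue X_res)).
- exact: cycles_submodule.
- move=> z [zn zm]; split=> [t tn|t].
    rewrite [LHS]/(scale_to e (z t)) zn //; exact: scale0r.
  by rewrite del_pointwise; apply/mrel; exact: zm.
move=> z _ [y hy]; case: k_residue => /choice[l hl] _.
exists (fun t => l (fr_aug G (y t))) => t; apply/mrel/relE.
have /relE := hy t; rewrite !linearB /= => /eqP; rewrite subr_eq0 => /eqP e2.
apply/eqP; rewrite subr_eq0; apply/eqP; rewrite [LHS]e2 augE /del.
rewrite rmorph_sum linear_sum; apply: eq_bigr => s _.
by rewrite linearZ rmorphM hl.
Qed.

Lemma betti_le_residue (M : lmodType A) (F : free_resolution M) :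
  exists C, forall n, (betti pi F n <= C * betti pi G n)%N.
Proof.
have [C hC] := homology_le_fg A_local A_noetherian (resolution_killed X_res)
  homology_le_betti (V := 'rV[A]_(fr_rank F 0)) (B := @syz_relations A _ F 0)
  (row_finitely_generated _ _) (@syz_relations_submodule A M F 0).
exists C => n; apply: hC; exact/(homology_betti k_residue F X_res).
Qed.

End Comparison.

(** The order of quantifiers matters: w and v belong to the ring, so the lower inequality for M and
    the upper one for k test the same series. Only C depends on the module. *)
Lemma golod_betti_inequalities (A : comUnitRingType) (k : fieldType)
    (pi : {rmorphism A -> k}) (A_noetherian : noetherian A) (A_local : local_ring A)
    (k_residue : residue_field pi) (G : free_resolution (residue_module pi)) :
  generalized_golod pi -> exists (w : nat -> nat) (v : nat),
    forall (M : lmodType A) (F : free_resolution M), exists C : nat, forall n,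
      (betti pi F n <= C * n.+1 ^ v + \sum_(i < n) w i * betti pi F (n - i.+1))%N /\
      (\sum_(i < n.+1) w i * betti pi F (n - i) <= betti pi F n.+1 + C * n.+1 ^ v)%N.
Proof.
move=> [q q_gt0 [E [gamma gammaP]]].
have [r [u [v [r_le u_in u_span u_free]]]] := generated_basis E q.
pose U := sub_complex u_in u_span u_free.
have U_killed : homology_killed U := @sub_killed _ _ _ E q q_gt0 r u u_in u_span u_free.
have U_le (V : lmodType A) (B : set V) : @finitely_generated A V setT -> is_submodule B ->
    exists C, forall n, homology_le U n B (C * n.+1 ^ v).
  move=> Vfg sB.
  have Uk n : homology_le U n (@maximal_ideal A : set A^o) (size (cbasis U n)).
    by move=> m; apply: (homology_le_residue A_local k_residue).
  have [C hC] := homology_le_fg A_local A_noetherian U_killed Uk Vfg sB.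
  exists C => n; apply: dim_le_trans (hC n); rewrite leq_mul2l.
  by rewrite /= /ranked_basis size_map size_enum_ord r_le orbT.
(* With coefficients in A itself devissage shows that the homology of S is finite-dimensional in
   each degree, so that it has finite minimal generating sets. *)
have [C0 hC0] := U_le A^o [set 0] (regular_finitely_generated A) (submodule_zero A^o).
have [|w [z [w0 z_supp z_cycle z_gen z_ind]]] := homology_bases U_killed.
  by move=> n; exists (C0 * n.+1 ^ v)%N; exact: hC0.
have [al G_res] := residue_resolution k_residue G.
have [alU [U_exact0 U_unit]] := sub_augmentation k_residue q_gt0 u_in u_span u_free.
have [g [g_deg g_d g_0]] :=
  word_chain_maps k_residue q_gt0 w0 z_supp z_cycle z_gen z_ind gammaP G_res.
exists w, v => M F.
have [C hC] := U_le _ (@syz_relations A M F 0) (row_finitely_generated _ _)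
  (@syz_relations_submodule A M F 0).
exists C => n; split.
  rewrite -(sum_ranked_degree w n (fun i => betti pi F (n - i.+1))).
  apply: (betti_upper A_local G_res (ranked_below_uniq w)
    (@mem_ranked_below w) (letter_gt0 w0)
    (letter_chain_supported w0 z_cycle gammaP) g_deg g_d g_0 U_exact0 U_unit
    (letter_chain_gen w0 z_supp z_cycle z_gen gammaP)
    (letter_chain_ind w0 z_supp z_cycle z_ind gammaP)
    k_residue (resolution_killed G_res) hC).
rewrite -(sum_ranked_degree w n.+1 (fun i => betti pi F (n - i))).
apply: (betti_lower A_local G_res (ranked_below_uniq w)
    (@mem_ranked_below w) (letter_gt0 w0)
    (letter_chain_supported w0 z_cycle gammaP) g_deg g_d g_0 U_exact0 U_unit
    (letter_chain_gen w0 z_supp z_cycle z_gen gammaP)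
    (letter_chain_ind w0 z_supp z_cycle z_ind gammaP)
    k_residue U_killed hC).
Qed.

Theorem lemma3p3 (R : realType) (A : comUnitRingType) (k : fieldType)
    (pi : {rmorphism A -> k})
    (A_noetherian : noetherian A) (A_local : local_ring A)
    (k_residue : residue_field pi)
    (A_golod : generalized_golod pi)
    (M : lmodType A) (M_fg : @finitely_generated A M setT)
    (F : free_resolution M) (G : free_resolution (residue_module pi)) :
  curv pi F R = 0%:E \/ curv pi F R = 1%:E \/ curv pi F R = curv pi G R.
Proof.
have [w [v wv]] := golod_betti_inequalities A_noetherian A_local k_residue G A_golod.
have [C1 hF] := wv M F; have [C2 hG] := wv _ G.
have [al G_res] := residue_resolution k_residue G.
have [C hC] := betti_le_residue A_local A_noetherian k_residue G G_res F.
have sub C' : subexponential R (fun n => (C' * n.+1 ^ v)%N).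
  exact: (@subexponential_le R _ _ C' (fun=> leqnn _) (@subexponential_poly R v)).
apply: (growth_trichotomy (a := w) (sub C1) (sub C2) _ _ hC) => n.
- by case: (hF n).
- by case: (hG n).
Qed.
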